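(* The following hold, where a nonsingular map $g$ is said to satisfy a property if its Perron--Frobenius operator $\mathcal L_g$ does. (1) Any one-dimensional piecewise $C^2$ nonsingular transformation $g:[0,1]\to[0,1]$ with a finite partition satisfying $\frac1{|g'(x)|}<1$ for every $x\in[0,1]$ (at discontinuity points, the condition is required for the left and right limits of $g'$) is (C) but not (UC). (2) The baker's transformation is (AC) but not (C). (3) Any irrational rotation is (MC) but not (AC). (4) Any rational rotation is (WAP) but not (MC). (5) Let $g:X\to X$ be a nonsingular measurable map of a probability space $(X,m)$ preserving a splitting of $X$ by two positive measure sets $X_-,X_+$ such that the restriction of $g$ to $X_+$ satisfies (S) and the restriction of $g$ to $X_-$ does not. Then $g$ is (S) but not (WAP).
   Context: The reference measure $m$ is the Lebesgue measure on $[0,1]$ in (1), on $[0,1]^2$ in (2), and the normalized Lebesgue measure on $\mathbb R/\mathbb Z$ in (3), (4). The rotations are $x\mapsto x+\alpha\pmod1$ on $\mathbb R/\mathbb Z$ with $\alpha$ irrational (resp. rational). The baker's transformation is $g:[0,1]^2\to[0,1]^2$, $g(x,y)=(2x,\frac y2)$ for $0\le x<\frac12$ and $g(x,y)=(2x-1,\frac y2+\frac12)$ for $\frac12\le x\le1$. Piecewise $C^2$ with a finite partition: there is a finite partition of $[0,1]$ into intervals such that the map on the interior of each interval extends to a $C^2$ function on its closure. A map $g$ is nonsingular if $m(A)=0$ implies $m(g^{-1}A)=0$. $\mathcal L_g$ is defined by $\int_A\mathcal L_g\varphi\,dm=\int_{g^{-1}(A)}\varphi\,dm$. In (5), $X_\pm$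 carry the normalized restrictions of $m$, and preserving the splitting means $X=X_-\sqcup X_+$ and $g(X_\pm)\subset X_\pm$. Let $D(m)=\{h\in L^1(m):h\ge0,\ \|h\|=1\}$, $d(\varphi,F)=\inf_{\psi\in F}\|\varphi-\psi\|$ and $A_n=\frac1n\sum_{i=0}^{n-1}P^i$. Properties of a Markov operator $P$ on $L^1(m)$: (UC): there is a compact $F\subset L^1(m)$ with $\lim_n\sup_{h\in D(m)}d(P^nh,F)=0$. (C): there is a compact $F\subset L^1(m)$ with $\lim_nd(P^nh,F)=0$ for every $h\in D(m)$. (AC): for any $\varepsilon>0$ there is $\delta>0$ such that $\limsup_n\int_AP^n\varphi\,dm<\varepsilon$ for any $\varphi\in D(m)$ and measurable $A$ with $m(A)<\delta$. (MC): there is a compact $F\subset L^1(m)$ with $\lim_nd(A_nh,F)=0$ for every $h\in D(m)$. (WAP): $(P^n\varphi)_{n\ge1}$ is weakly precompact in $L^1(m)$ for every $\varphi\in L^1(m)$. (S): there is $h\in D(m)$ with $Ph=h$. *)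

(* Defs.v *)
From HB Require Import structures.
From mathcomp Require Import all_boot all_order all_algebra.
From mathcomp Require Import all_classical all_reals all_analysis.
From mathcomp Require Import measurable_realfun lra.

Set Implicit Arguments.
Unset Strict Implicit.
Unset Printing Implicit Defensive.

Import Order.TTheory GRing.Theory Num.Theory.
Import numFieldNormedType.Exports.

Local Open Scope classical_set_scope.
Local Open Scope ring_scope.

Section L1_quotient.
Context d (T : measurableType d) (R : realType).
Variable m : {measure set T -> \bar R}.
Local Open Scope quotient_scope.
Local Notation Lfun1 := (LfunType m (@lexx _ _ 1%E)).
Implicit Types f g : Lfun1.

(* The library's LfunType m 1 consists of functions, with no norm instance;
   L^1(m) is its quotient by equality m-almost everywhere, normed by the
   integral of the absolute value (L1_normE). *)
Definition L1_ae f g : bool := `[< (f : T -> R) = g %[ae m] >].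

Let L1_ae_refl : reflexive L1_ae.
Proof. by move=> f; apply/asboolP; exact: ae_eq_refl. Qed.

Let L1_ae_sym : symmetric L1_ae.
Proof. by move=> f g; apply/asboolP/asboolP; exact: ae_eq_sym. Qed.

Let L1_ae_trans : transitive L1_ae.
Proof.
move=> g f h /asboolP fg /asboolP gh; apply/asboolP; exact: ae_eq_trans fg gh.
Qed.

Canonical L1_ae_canonical := EquivRel L1_ae L1_ae_refl L1_ae_sym L1_ae_trans.

Definition L1 : Type := {eq_quot L1_ae}.
HB.instance Definition _ := Choice.on L1.
HB.instance Definition _ := EqQuotient.on L1.

Implicit Types x y z : L1.

Definition L1_fun x : T -> R := (repr x : Lfun1).
Definition L1_class f : L1 := \pi_L1 f.

Lemma L1_class_ae f : L1_fun (L1_class f) = f %[ae m].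
Proof.
by have /eqmodP/asboolP : L1_class (repr (L1_class f)) = L1_class f
  by exact: reprK.
Qed.

Lemma L1_reprK x : L1_class (repr x) = x.
Proof. exact: reprK. Qed.

Lemma L1_classP f g : L1_class f = L1_class g <-> (f : T -> R) = g %[ae m].
Proof. by split=> [/eqmodP/asboolP|fg]//; apply/eqmodP/asboolP. Qed.

Lemma L1_aeP x y : x = y <-> L1_fun x = L1_fun y %[ae m].
Proof. by rewrite -L1_classP !L1_reprK. Qed.

Lemma measurable_L1 x : measurable_fun setT (L1_fun x).
Proof. exact: measurable_funPT. Qed.

Lemma integrable_L1 x : m.-integrable setT (EFin \o L1_fun x).
Proof. by apply/Lfun1_integrable; exact: LfunP. Qed.

Definition L1_add x y := L1_class (repr x + repr y).
Definition L1_opp x := L1_class (- repr x).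
Definition L1_zero := L1_class 0.
Definition L1_scale (a : R) x := L1_class (a *: (repr x : Lfun1)).
Definition L1_norm x : R := fine ('N[m]_1[EFin \o L1_fun x])%E.

Lemma L1_add_ae x y : L1_fun (L1_add x y) = L1_fun x \+ L1_fun y %[ae m].
Proof. exact: L1_class_ae. Qed.

Lemma L1_opp_ae x : L1_fun (L1_opp x) = \- L1_fun x %[ae m].
Proof. exact: L1_class_ae. Qed.

Lemma L1_zero_ae : L1_fun L1_zero = cst 0 %[ae m].
Proof. exact: L1_class_ae. Qed.

Lemma L1_scale_ae a x : L1_fun (L1_scale a x) = a \*: L1_fun x %[ae m].
Proof. exact: L1_class_ae. Qed.

Lemma L1_addA : associative L1_add.
Proof.
move=> x y z; apply/L1_aeP.
move: (L1_add_ae x (L1_add y z)); apply: filter_app.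
move: (L1_add_ae y z); apply: filter_app.
move: (L1_add_ae (L1_add x y) z); apply: filter_app.
move: (L1_add_ae x y); apply: filterS => t /= e1 e2 e3 e4 _.
by rewrite e4// e3// e2// e1//= addrA.
Qed.

Lemma L1_addC : commutative L1_add.
Proof. by move=> x y; rewrite /L1_add addrC. Qed.

Lemma L1_add0 : left_id L1_zero L1_add.
Proof.
move=> x; apply/L1_aeP.
move: (L1_add_ae L1_zero x); apply: filter_app.
by move: L1_zero_ae; apply: filterS => t /= e1 e2 _; rewrite e2// e1//= add0r.
Qed.

Lemma L1_addN : left_inverse L1_zero L1_opp L1_add.
Proof.
move=> x; apply/L1_aeP.
move: (L1_add_ae (L1_opp x) x); apply: filter_app.
move: (L1_opp_ae x); apply: filter_app.
move: L1_zero_ae; apply: filterS => t /= e1 e2 e3 _.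
by rewrite e3// e2// e1//= addNr.
Qed.

HB.instance Definition _ :=
  GRing.isZmodule.Build L1 L1_addA L1_addC L1_add0 L1_addN.

Lemma L1_scaleA a b x : L1_scale a (L1_scale b x) = L1_scale (a * b) x.
Proof.
apply/L1_aeP; move: (L1_scale_ae a (L1_scale b x)); apply: filter_app.
move: (L1_scale_ae b x); apply: filter_app.
move: (L1_scale_ae (a * b) x); apply: filterS => t /= e1 e2 e3 _.
by rewrite e3// e2// e1//= scalerA.
Qed.

Lemma L1_scale1 : left_id 1 L1_scale.
Proof.
by move=> x; apply/L1_aeP; move: (L1_scale_ae 1 x); apply: filterS => t /= e _;
  rewrite e//= scale1r.
Qed.

Lemma L1_scaleDr : right_distributive L1_scale +%R.
Proof.
move=> a x y; apply/L1_aeP; move: (L1_scale_ae a (x + y)); apply: filter_app.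
move: (L1_add_ae x y); apply: filter_app.
move: (L1_add_ae (L1_scale a x) (L1_scale a y)); apply: filter_app.
move: (L1_scale_ae a x); apply: filter_app.
move: (L1_scale_ae a y); apply: filterS => t /= e1 e2 e3 e4 e5 _.
by rewrite e5// e4// e3// e2// e1//= scalerDr.
Qed.

Lemma L1_scaleDl x : {morph L1_scale^~ x : a b / a + b}.
Proof.
move=> a b; apply/L1_aeP; move: (L1_scale_ae (a + b) x); apply: filter_app.
move: (L1_add_ae (L1_scale a x) (L1_scale b x)); apply: filter_app.
move: (L1_scale_ae a x); apply: filter_app.
move: (L1_scale_ae b x); apply: filterS => t /= e1 e2 e3 e4 _.
by rewrite e4// e3// e2// e1//= scalerDl.
Qed.

HB.instance Definition _ := GRing.Zmodule_isLmodule.Build R L1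
  L1_scaleA L1_scale1 L1_scaleDr L1_scaleDl.

Lemma L1_norm_class f : L1_norm (L1_class f) = fine ('N[m]_1[EFin \o f])%E.
Proof.
rewrite /L1_norm !Lnorm1; congr fine; apply: ae_eq_integral => //.
- by do 2 apply: measurableT_comp => //; exact: measurable_L1.
- by do 2 apply: measurableT_comp => //; exact: measurable_funPT.
- by move: (L1_class_ae f); apply: filterS => x + _ => /(_ I) /= ->.
Qed.

Lemma L1_ler_normD x y : L1_norm (x + y) <= L1_norm x + L1_norm y.
Proof. by rewrite L1_norm_class; exact: ler_LnormD. Qed.

Lemma L1_normZ a x : L1_norm (a *: x) = `|a| * L1_norm x.
Proof.
rewrite L1_norm_class; apply: EFin_inj.
rewrite (finite_norm_fine (a *: (repr x : Lfun1))) EFinM (finite_norm_fine (repr x)).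
exact: (LnormZ (repr x)).
Qed.

Lemma L1_norm0_eq0 x : L1_norm x = 0 -> x = 0.
Proof.
move=> /(@fine_Lnormr_eq0 _ _ _ m 1%E (@lexx _ _ 1%E) (repr x)) x0.
apply/L1_aeP; move: L1_zero_ae; apply: filter_app.
move: x0; apply: filterS => t /= e1 e2 tT.
by rewrite e2//; exact: e1.
Qed.

HB.instance Definition _ := Lmodule_isNormed.Build R L1
  L1_ler_normD L1_normZ L1_norm0_eq0.

Lemma L1_normE x : `|x|%:E = (\int[m]_t `|(L1_fun x t)%:E|)%E.
Proof.
have -> : `|x| = L1_norm x by [].
by rewrite (finite_norm_fine (repr x)) Lnorm1.
Qed.

End L1_quotient.

Coercion L1_fun : L1 >-> Funclass.

Section weak_topology.
Context (R : realType) (V : normedModType R).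

(* The weak topology is the initial topology for the evaluations at all
   continuous linear forms; precompact A means that closure A is compact. *)
Definition cont_dual : Type := [set l : {linear V -> R^o} | continuous l].

Definition dual_eval (v : V) : {ptws cont_dual -> R^o} := fun l => sval l v.

Definition weakly_precompact (A : set V) : Prop :=
  precompact (A : set (initial_topology dual_eval)).

End weak_topology.

Section Markov_properties.
Context d (T : measurableType d) (R : realType).
Variable m : {measure set T -> \bar R}.
Implicit Type P : L1 m -> L1 m.

Definition densities : set (L1 m) :=
  [set h : L1 m | {ae m, forall x, 0 <= h x} /\ `|h| = 1].

(* Extended real, so that the distance to the empty set is +oo: a real-valued
   inf would give 0 and make the empty set a compact attractor. *)
Definition dist_to (phi : L1 m) (F : set (L1 m)) : \bar R :=
  ereal_inf [set `|phi - psi|%:E | psi in F].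

Definition cesaro_mean P (n : nat) (h : L1 m) : L1 m :=
  n%:R^-1 *: \sum_(i < n) iter i P h.

Definition propUC P : Prop := exists2 F : set (L1 m), compact F &
  ereal_sup [set dist_to (iter n P h) F | h in densities] @[n --> \oo] --> 0%E.

Definition propC P : Prop := exists2 F : set (L1 m), compact F &
  forall h, densities h -> dist_to (iter n P h) F @[n --> \oo] --> 0%E.

Definition propAC P : Prop := forall e : R, 0 < e ->
  exists2 delta : R, 0 < delta & forall (phi : L1 m) (A : set T),
    densities phi -> measurable A -> (m A < delta%:E)%E ->
    (limn_esup (fun n => \int[m]_(x in A) (iter n P phi x)%:E) < e%:E)%E.

Definition propMC P : Prop := exists2 F : set (L1 m), compact F &
  forall h, densities h -> dist_to (cesaro_mean P n h) F @[n --> \oo] --> 0%E.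

Definition propWAP P : Prop := forall phi : L1 m,
  weakly_precompact [set iter n P phi | n in [set n | (1 <= n)%N]].

Definition propS P : Prop := exists2 h, densities h & P h = h.

End Markov_properties.
Arguments propUC {d T R m} P.
Arguments propC {d T R m} P.
Arguments propAC {d T R m} P.
Arguments propMC {d T R m} P.
Arguments propWAP {d T R m} P.
Arguments propS {d T R m} P.

Section Perron_Frobenius.
Context d (T : measurableType d) (R : realType).
Variables (m : {measure set T -> \bar R}) (g : T -> T).

Definition nonsingular : Prop := measurable_fun setT g /\
  forall A, measurable A -> m A = 0%E -> m (g @^-1` A) = 0%E.

Definition is_PF (phi psi : L1 m) : Prop := forall A, measurable A ->
  (\int[m]_(x in A) (psi x)%:E = \int[m]_(x in g @^-1` A) (phi x)%:E)%E.

(* is_PF determines psi uniquely (is_PF_uniq), and such a psi exists for every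
   phi when g is nonsingular (PFP). *)
Definition PF (phi : L1 m) : L1 m := get (is_PF phi).

Definition satisfies (prop : (L1 m -> L1 m) -> Prop) : Prop :=
  nonsingular /\ prop PF.

End Perron_Frobenius.
Arguments satisfies {d T R} m g prop.

(* Measurable spaces are pointed in the library, hence the nonemptiness. *)
Record msubset d (T : measurableType d) := MSubset {
  msubset_carrier :> set T ;
  msubset_measurable : measurable msubset_carrier ;
  msubset_nonempty : msubset_carrier !=set0 }.

Definition msub_display d (T : measurableType d) : msubset T -> measure_display.
Proof. exact. Qed.

Definition msub d (T : measurableType d) (X : msubset T) : Type :=
  set_type X.

Section msub.
Context d (T : measurableType d) (X : msubset T).

HB.instance Definition _ := Choice.on (msub X).

Definition msub_val (x : msub X) : T := sval x.

Lemma msub_point_subproof : exists x : T, x \in (X : set T).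
Proof. by have [x Xx] := msubset_nonempty X; exists x; exact/mem_set. Qed.

HB.instance Definition _ := isPointed.Build (msub X)
  (exist _ (sval (cid msub_point_subproof)) (svalP (cid msub_point_subproof))).

Definition msub_measurable : set (set (msub X)) :=
  [set A | measurable (msub_val @` A)].

Lemma msub_val_inj : injective msub_val.
Proof. exact: val_inj. Qed.

Lemma msub_measurable0 : msub_measurable set0.
Proof. by rewrite /msub_measurable /= image_set0; exact: measurable0. Qed.

Lemma msub_image_setC A :
  msub_val @` (~` A) = (X : set T) `\` (msub_val @` A).
Proof.
apply/seteqP; split=> [_ [x Ax <-]|t [Xt nAt]].
  split; first exact: set_mem (svalP x).
  by move=> [y Ay /msub_val_inj yx]; apply: Ax; rewrite -yx.
by exists (exist _ t (mem_set Xt)) => //= At; apply: nAt; eexists; first exact: At.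
Qed.

Lemma msub_measurableC A : msub_measurable A -> msub_measurable (~` A).
Proof.
move=> mA; rewrite /msub_measurable /= msub_image_setC.
by apply: measurableD => //; exact: msubset_measurable.
Qed.

Lemma msub_measurable_bigcup (F : (set (msub X))^nat) :
  (forall i, msub_measurable (F i)) -> msub_measurable (\bigcup_i F i).
Proof.
move=> mF; rewrite /msub_measurable /= image_bigcup.
by apply: bigcup_measurable => i _; exact: mF.
Qed.

HB.instance Definition _ := @isMeasurable.Build (msub_display X) (msub X)
  msub_measurable msub_measurable0 msub_measurableC msub_measurable_bigcup.

End msub.

Section msub_measure.
Context d (T : measurableType d) (R : realType).
Variables (m : {measure set T -> \bar R}) (X : msubset T).

Definition msub_measure (A : set (msub X)) : \bar R := m (@msub_val _ _ X @` A).

Let msub_measure0 : msub_measure set0 = 0%E.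
Proof. by rewrite /msub_measure image_set0 measure0. Qed.

Let msub_measure_ge0 A : (0 <= msub_measure A)%E.
Proof. exact: measure_ge0. Qed.

Let msub_measure_sigma_additive : semi_sigma_additive msub_measure.
Proof.
move=> F mF tF mUF; rewrite /msub_measure image_bigcup.
apply: measure_semi_sigma_additive => //.
- apply/trivIsetP => i j _ _ ij; apply/seteqP; split=> // t [[x Fx <-] [y Fy]].
  move=> /msub_val_inj yx; move/trivIsetP : tF => /(_ i j I I ij).
  by move=> /seteqP[/(_ x) + _]; apply; split=> //; rewrite -yx.
- by rewrite -image_bigcup.
Qed.

HB.instance Definition _ := isMeasure.Build _ _ _ msub_measure
  msub_measure0 msub_measure_ge0 msub_measure_sigma_additive.

End msub_measure.
Arguments msub_measure {d T R} m X _.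

Section Perron_Frobenius_lemmas.
Context d (T : measurableType d) (R : realType).
Variables (m : {sigma_finite_measure set T -> \bar R}) (g : T -> T).
Local Open Scope charge_scope.

Lemma is_PF_uniq (phi psi1 psi2 : L1 m) :
  is_PF g phi psi1 -> is_PF g phi psi2 -> psi1 = psi2.
Proof.
move=> h1 h2; apply/L1_aeP.
have : ae_eq m setT (EFin \o L1_fun psi1) (EFin \o L1_fun psi2).
  apply: integral_ae_eq => //; first exact: integrable_L1.
    exact/measurable_EFinP/measurable_L1.
  by move=> A _ mA; rewrite h1// h2.
by apply: filterS => x + _ => /(_ I) [].
Qed.

Lemma is_PF_exists (phi : L1 m) : nonsingular m g -> exists psi, is_PF g phi psi.
Proof.
move=> [mg g0].
pose nu := induced_charge (integrable_L1 phi).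
have num : nu `<< m.
  apply/null_content_dominatesP => A mA mA0.
  apply: null_set_integral => //; apply: measurable_funTS.
  exact/measurable_EFinP/measurable_L1.
pose nug := measure_function_pushforward__canonical__charge_Charge nu mg.
have nugm : nug `<< m.
  apply/null_content_dominatesP => A mA mA0.
  move/null_content_dominatesP : num; apply; last exact: g0.
  by have := mg measurableT A mA; rewrite setTI.
have psi_int := Radon_Nikodym_integrable nugm.
have psiE : EFin \o (fine \o 'd nug '/d m) = 'd nug '/d m.
  by apply/funext => x /=; rewrite fineK//; exact: Radon_Nikodym_fin_num.
have psiL : (fine \o 'd nug '/d m) \in Lfun m 1%E.
  by apply/Lfun1_integrable; rewrite psiE.
exists (L1_class (Lfun_Sub (@lexx _ _ 1%E) psiL)) => A mA.
rewrite -[RHS]/(nug A) (Radon_Nikodym_integral nugm mA).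
apply: ae_eq_integral => //.
- exact/measurable_funTS/measurable_EFinP/measurable_L1.
- by apply: measurable_funTS; exact: (measurable_int m psi_int).
- move: (L1_class_ae (Lfun_Sub (@lexx _ _ 1%E) psiL)); apply: filterS.
  by move=> x + _ => /(_ I) -> /=; rewrite fineK//; exact: Radon_Nikodym_fin_num.
Qed.

Lemma PFP (phi : L1 m) : nonsingular m g -> is_PF g phi (PF g phi).
Proof. by move=> /(is_PF_exists phi)/getPex. Qed.
End Perron_Frobenius_lemmas.

Definition msub_mk d (T : measurableType d) (X : msubset T) (t : T)
  (Xt : (X : set T) t) : msub X := exist _ t (mem_set Xt).

Definition msub_map d (T : measurableType d) (X : msubset T) (g : T -> T)
  (gX : g @` X `<=` X) (x : msub X) : msub X :=
  msub_mk (gX _ (ex_intro2 _ _ (msub_val x) (set_mem (svalP x)) erefl)).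

(* The last argument of mnormalize is its value when m X is 0 or +oo. *)
Definition normalized_restriction d (T : measurableType d) (R : realType)
  (m : {measure set T -> \bar R}) (X : msubset T) : set (msub X) -> \bar R :=
  mnormalize (msub_measure m X) (dirac point).

Arguments normalized_restriction {d T R} m X _.

HB.instance Definition _ d (T : measurableType d) (R : realType)
    (m : {measure set T -> \bar R}) (X : msubset T) :=
  Probability.on (@normalized_restriction d T R m X).

Section maps.
Context (R : realType).

Lemma cc01_nonempty : (`[0, 1]%classic : set R) !=set0.
Proof. by exists 0; rewrite /= in_itv /= lexx ler01. Qed.

Lemma co01_nonempty : (`[0, 1[%classic : set R) !=set0.
Proof. by exists 0; rewrite /= in_itv /= lexx ltr01. Qed.

Definition cc01 : msubset (measurableTypeR R) :=
  @MSubset _ (measurableTypeR R) `[0, 1]%classic (measurable_itv _) cc01_nonempty.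

Definition co01 : msubset (measurableTypeR R) :=
  @MSubset _ (measurableTypeR R) `[0, 1[%classic (measurable_itv _) co01_nonempty.

Definition leb_cc01 : set (msub cc01) -> \bar R := msub_measure lebesgue_measure cc01.
Definition leb_co01 : set (msub co01) -> \bar R := msub_measure lebesgue_measure co01.

HB.instance Definition _ := Measure.on leb_cc01.
HB.instance Definition _ := Measure.on leb_co01.

Lemma msub_val_image_setT d (T : measurableType d) (X : msubset T) :
  @msub_val _ _ X @` setT = X.
Proof.
apply/seteqP; split=> [_ [x _ <-]|t Xt]; first exact: set_mem (svalP x).
by exists (msub_mk Xt).
Qed.

Lemma leb_cc01T : leb_cc01 setT = 1%E.
Proof.
by rewrite /leb_cc01 /msub_measure msub_val_image_setT /= lebesgue_measure_itv/= lte01 oppr0 adde0.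
Qed.

Lemma leb_co01T : leb_co01 setT = 1%E.
Proof.
by rewrite /leb_co01 /msub_measure msub_val_image_setT /= lebesgue_measure_itv/= lte01 oppr0 adde0.
Qed.

HB.instance Definition _ := Measure_isProbability.Build _ _ _ leb_cc01 leb_cc01T.
HB.instance Definition _ := Measure_isProbability.Build _ _ _ leb_co01 leb_co01T.

Definition baker_fst (x : R) : R := if x < 2^-1 then 2 * x else 2 * x - 1.
Definition baker_snd (x y : R) : R := if x < 2^-1 then y / 2 else y / 2 + 2^-1.

Lemma baker_fst_in (x : msub cc01) : (cc01 : set R) (baker_fst (msub_val x)).
Proof.
have /= := set_mem (svalP x); rewrite !in_itv /= /baker_fst -/(msub_val x).
by case: ltP => ? /andP[? ?]; apply/andP; split; lra.
Qed.

Lemma baker_snd_in (x y : msub cc01) :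
  (cc01 : set R) (baker_snd (msub_val x) (msub_val y)).
Proof.
have /= := set_mem (svalP y); rewrite !in_itv /= /baker_snd -/(msub_val y).
by case: ltP => ? /andP[? ?]; apply/andP; split; lra.
Qed.

Definition baker (p : msub cc01 * msub cc01) : msub cc01 * msub cc01 :=
  (msub_mk (baker_fst_in p.1), msub_mk (baker_snd_in p.1 p.2)).

Definition frac_part (t : R) : R := t - (Num.floor t)%:~R.

Lemma frac_part_in (t : R) : (co01 : set R) (frac_part t).
Proof.
rewrite /= in_itv /= /frac_part subr_ge0 ltrBlDl.
by have /andP[-> ] := floor_itv t; rewrite intrD.
Qed.

(* R/Z is represented by the fundamental domain [0, 1[. *)
Definition rotation (alpha : R) (x : msub co01) : msub co01 :=
  msub_mk (frac_part_in (msub_val x + alpha)).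

(* f is C^2 on the closed interval closure I, with first and second derivatives
   f' and f'' (one-sided at the endpoints): f, f', f'' are continuous on
   closure I and are successive derivatives in the interior. *)
Definition C2_on_closure (I : set R) (f f' f'' : R -> R) : Prop :=
  [/\ {within closure I, continuous f}, {within closure I, continuous f'},
      {within closure I, continuous f''},
      forall x, I° x -> is_derive x 1 f (f' x) &
      forall x, I° x -> is_derive x 1 f' (f'' x)].

Definition piecewise_C2 (g : msub cc01 -> msub cc01) (n : nat)
    (I : 'I_n -> set R) (f f' f'' : 'I_n -> R -> R) : Prop :=
  [/\ partition [set: 'I_n] I (cc01 : set R), forall i, is_interval (I i) &
   forall i, C2_on_closure (I i) (f i) (f' i) (f'' i) /\
     forall x : msub cc01, (I i)° (msub_val x) -> msub_val (g x) = f i (msub_val x)].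

End maps.

(* Main.v *)
(** Everything is read off the identity [\int_A L^n h = \int_(g^-n A) h].

    A compact subset of L^1 is equi-integrable. If it attracted all densities
    uniformly, the uniform densities on the sets [g^-n G] would force [G] to have a
    null preimage as soon as [G] is small; the same equi-integrability excludes
    (MC) in the presence of invariant sets of small positive measure.

    (1) With [theta = sup 1/|g'| < 1], integration by parts on each branch gives,
    for [u] with [|\int_a^b u| <= 1] for all [a, b], the estimate
    [|\int_s^t u o g^n| <= theta^n + C (t - s)] as long as [[s, t]] avoids a finite
    set. Hence, on a fine grid, [u o g^n] is the sum of a bounded function and of a
    function whose integrals over intervals are at most 1/2, which is the
    Lasota-Yorke inequality [V (L^n h) <= V h / 2 + C |h|] for the dual norm [V] of
    BV; balls of [V] are compact in L^1 and functions of bounded variation are dense.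

    (2) Pulling back a rectangle [E x [0, a[] halves [E] and replaces [a] by [2a] or
    [2a - 1], which reduces the mixing of the baker map to that of doubling; mixing
    gives (AC). The images of the lower half square stay at distance 1/2.

    (3) For [u(x) = x], the function [L^k u - u + c] is the indicator of [[0, c[], where
    [c] is the fractional part of [k alpha]; these [c] are dense, so the Cesaro means
    of all [h] converge to constants, whereas an arc returns near itself infinitely
    often.

    (4) The orbits of densities are finite, and there are small invariant sets.

    (5) Under (WAP) the orbit is equi-integrable, so an ultrafilter limit of its
    Cesaro means is an invariant density; start from the uniform density on [X_-]. *)

Require Import Defs.
From HB Require Import structures.
From mathcomp Require Import all_boot all_order all_algebra.
From mathcomp Require Import all_classical all_reals all_analysis.
From mathcomp Require Import measurable_realfun lra.

Set Implicit Arguments.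
Unset Strict Implicit.
Unset Printing Implicit Defensive.

Import Order.TTheory GRing.Theory Num.Theory.
Import numFieldNormedType.Exports.
Import HBSimple.

Local Open Scope classical_set_scope.
Local Open Scope ring_scope.

(** * Functions and integrals in L1 *)

(** Elements of L1 are classes and [PF] is chosen through its defining relation, so almost nothing
    is computed pointwise: equality, positivity, norm bounds and invariance are tested on the
    numbers [L1_int A x], and pushforwards, ultrafilter means and limits of Cauchy filters are
    obtained from set functions by Radon-Nikodym. In (1) the dual norm makes the operator disappear:
    pairing [P^n h] with [u] is pairing [h] with [u o g^n]. An iterate of [g] is needed for the
    following reason. An interval shorter than the least gap between cuts contains at most one cut,
    and splitting there doubles the bound on its integral; the grid decomposition costs a further
    factor 4. The contraction has to beat the total loss 8, which [theta] need not do but a high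
    power does. The constants are [theta^(p+1) <= 1/64], then [2/64 + 1/32 <= 1/8], then
    [4/8 = 1/2]. Integrals are never differentiated: change of variables and integration by parts
    come from increments known up to a quadratic error. *)

Section L1_integrals.
Context d (T : measurableType d) (R : realType).
Variable m : {measure set T -> \bar R}.
Implicit Types (f : T -> R) (x y : L1 m) (A : set T).

(* Junk value 0 when f is not integrable. *)
Definition L1_mk f : L1 m :=
  match pselect (m.-integrable setT (EFin \o f)) with
  | left h => L1_class (Lfun_Sub (@lexx _ _ 1%E) (proj2 (Lfun1_integrable m f) h))
  | right _ => 0
  end.

Definition L1_int A x : R := \int[m]_(t in A) x t.

Lemma L1_mk_ae f : m.-integrable setT (EFin \o f) -> L1_mk f = f %[ae m].
Proof. by move=> h; rewrite /L1_mk; case: pselect => // h'; exact: L1_class_ae. Qed.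

Lemma integrable_L1S A x : measurable A -> m.-integrable A (EFin \o x).
Proof.
by move=> mA; apply: (integrableS measurableT) => //; exact: integrable_L1.
Qed.

Lemma L1_int_EFin A x : measurable A ->
  (\int[m]_(t in A) (x t)%:E = (L1_int A x)%:E)%E.
Proof.
move=> mA; rewrite fineK//; apply: integrable_fin_num => //.
exact: integrable_L1S.
Qed.

Lemma ae_eq_Rintegral A f g : measurable A -> measurable_fun A f ->
  measurable_fun A g -> f = g %[ae m] ->
  \int[m]_(t in A) f t = \int[m]_(t in A) g t.
Proof.
move=> mA mf mg fg; congr fine; apply: ae_eq_integral => //.
- exact/measurable_EFinP.
- exact/measurable_EFinP.
- by move: fg; apply: filterS => t /= /(_ I) -> _.
Qed.

Lemma measurable_L1S A x : measurable_fun A x.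
Proof. exact/measurable_funTS/measurable_L1. Qed.

Lemma L1_int_mk A f : measurable A -> m.-integrable setT (EFin \o f) ->
  L1_int A (L1_mk f) = \int[m]_(t in A) f t.
Proof.
move=> mA fi; apply: ae_eq_Rintegral => //.
- exact: measurable_L1S.
- by apply/measurable_funTS/measurable_EFinP; exact: measurable_int fi.
- exact: L1_mk_ae.
Qed.

Lemma L1_intD A x y : measurable A -> L1_int A (x + y) = L1_int A x + L1_int A y.
Proof.
move=> mA; rewrite /L1_int -RintegralD//; [|exact: integrable_L1S..].
apply: ae_eq_Rintegral => //.
- exact: measurable_L1S.
- by apply: measurable_funD; exact: measurable_L1S.
- exact: L1_add_ae.
Qed.

Lemma L1_intZ A a x : measurable A -> L1_int A (a *: x) = a * L1_int A x.
Proof.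
move=> mA; rewrite /L1_int -RintegralZl//; last exact: integrable_L1S.
apply: ae_eq_Rintegral => //.
- exact: measurable_L1S.
- by apply: measurable_funM => //; exact: measurable_L1S.
- exact: L1_scale_ae.
Qed.

Lemma L1_intN A x : measurable A -> L1_int A (- x) = - L1_int A x.
Proof. by move=> mA; rewrite -scaleN1r L1_intZ// mulN1r. Qed.

Lemma L1_intB A x y : measurable A -> L1_int A (x - y) = L1_int A x - L1_int A y.
Proof. by move=> mA; rewrite L1_intD// L1_intN. Qed.

Lemma L1_int0 A : measurable A -> L1_int A 0 = 0.
Proof. by move=> mA; rewrite -(scale0r 0) L1_intZ// mul0r. Qed.

Lemma L1_int_sum A I (r : seq I) (P : pred I) (F : I -> L1 m) : measurable A ->
  L1_int A (\sum_(i <- r | P i) F i) = \sum_(i <- r | P i) L1_int A (F i).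
Proof.
move=> mA; elim/big_rec2: _ => [|i y1 y2 _ <-]; first exact: L1_int0.
exact: L1_intD.
Qed.

Lemma L1_norm_Rint x : `|x| = \int[m]_t `|x t|.
Proof.
apply: EFin_inj; rewrite L1_normE fineK//=; apply: integrable_fin_num => //.
by have := integrable_norm (integrable_L1 x).
Qed.

Lemma integrable_L1norm A x : measurable A ->
  m.-integrable A (EFin \o (fun t => `|x t|)).
Proof.
by move=> mA; have := integrable_norm (integrable_L1S x mA).
Qed.

Lemma le_L1_int_norm A x : measurable A -> `|L1_int A x| <= `|x|.
Proof.
move=> mA; apply: (le_trans (le_normr_Rintegral mA (integrable_L1S x mA))).
rewrite L1_norm_Rint; apply: fine_le.
- by apply: integrable_fin_num => //; exact: integrable_L1norm.
- by apply: integrable_fin_num => //; exact: integrable_L1norm.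
- apply: ge0_subset_integral => //; apply/measurable_EFinP.
  by apply: measurableT_comp => //; exact: measurable_L1.
Qed.

Lemma L1_int_setU A B x : measurable A -> measurable B -> [disjoint A & B] ->
  L1_int (A `|` B) x = L1_int A x + L1_int B x.
Proof.
move=> mA mB AB; rewrite /L1_int Rintegral_setU//; apply: integrable_L1S.
exact: measurableU.
Qed.

Lemma L1_int_setC A x : measurable A ->
  L1_int setT x = L1_int A x + L1_int (~` A) x.
Proof.
move=> mA; rewrite -(setUv A) L1_int_setU//; first exact: measurableC.
by apply/disj_setPS; rewrite setICr.
Qed.

Definition L1_pos x : set T := [set t | 0 <= x t].

Lemma measurable_L1_pos x : measurable (L1_pos x).
Proof.
rewrite (_ : L1_pos x = x @^-1` `[0, +oo[); last first.
  by apply/seteqP; split=> t /=; rewrite in_itv/= andbT.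
by rewrite -[X in measurable X]setTI; exact: measurable_L1.
Qed.

(** Splitting by the sign of [x] turns the norm into two set integrals, the quantities on which [PF]
    acts by preimage. *)
Lemma L1_norm_pos x : `|x| = L1_int (L1_pos x) x - L1_int (~` L1_pos x) x.
Proof.
have mP := measurable_L1_pos x; have mN := measurableC mP.
rewrite L1_norm_Rint -(setUv (L1_pos x)) Rintegral_setU//; last 2 first.
- by rewrite setUv; exact: integrable_L1norm.
- by apply/disj_setPS; rewrite setICr.
congr (_ + _).
  by apply: eq_Rintegral => t /set_mem; rewrite /L1_pos/= => t0; rewrite ger0_norm.
rewrite -L1_intN//; transitivity (\int[m]_(t in ~` L1_pos x) - x t).
  apply: eq_Rintegral => t /set_mem; rewrite /L1_pos/= => /negP; rewrite -ltNge => t0.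
  by rewrite ltr0_norm.
apply: ae_eq_Rintegral => //.
- by apply: measurableT_comp => //; exact: measurable_L1S.
- exact: measurable_L1S.
- exact/ae_eq_sym/L1_opp_ae.
Qed.

Lemma ae_ge0_L1_int x A : {ae m, forall t, 0 <= x t} -> measurable A ->
  0 <= L1_int A x.
Proof.
move=> x0 mA; rewrite (_ : L1_int A x = \int[m]_(t in A) `|x t|).
  exact: Rintegral_ge0.
apply: ae_eq_Rintegral => //.
- exact: measurable_L1S.
- by apply: measurableT_comp => //; exact: measurable_L1S.
- by move: x0; apply: filterS => t x0 _; rewrite ger0_norm.
Qed.

(** On the set where [x] is negative, a nonnegative integral forces the integral of [|x|] to vanish.
    Positivity tested on sets survives pushforwards and limits of set functions. *)
Lemma ae_ge0_L1_intP x : {ae m, forall t, 0 <= x t} <->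
  (forall A, measurable A -> 0 <= L1_int A x).
Proof.
split=> [x0 A mA|x0]; first exact: ae_ge0_L1_int.
have mN : measurable (~` L1_pos x) by apply/measurableC/measurable_L1_pos.
have : (\int[m]_(t in ~` L1_pos x) `|(x t)%:E| = 0)%E.
  apply/eqP; rewrite eq_le integral_ge0 ?andbT//.
  rewrite -oppe_ge0 -integral_ge0N//.
  have := x0 _ mN; rewrite -lee_fin -L1_int_EFin//; congr (_ <= _)%E.
  apply: eq_integral => t /set_mem; rewrite /L1_pos/= => /negP; rewrite -ltNge => t0.
  by rewrite ltr0_norm// opprK.
have mx : measurable_fun (~` L1_pos x) (EFin \o x).
  exact/measurable_EFinP/measurable_L1S.
move=> /(proj1 (ae_eq_integral_abs m mN mx)); apply: filterS => t /= h; rewrite leNgt; apply/negP => t0.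
have /h [xt0] : (~` L1_pos x) t by rewrite /L1_pos/=; apply/negP; rewrite -ltNge.
by rewrite xt0 ltxx in t0.
Qed.

Lemma L1_norm_ge0E x : {ae m, forall t, 0 <= x t} -> `|x| = L1_int setT x.
Proof.
move=> x0; rewrite L1_norm_Rint; apply: ae_eq_Rintegral => //.
- by apply: measurableT_comp => //; exact: measurable_L1S.
- by move: x0; apply: filterS => t x0 _; rewrite ger0_norm.
Qed.

Lemma densitiesP x : densities x <->
  (forall A, measurable A -> 0 <= L1_int A x) /\ L1_int setT x = 1.
Proof.
split=> [[x0 x1]|[/ae_ge0_L1_intP x0 x1]].
  by split; [exact/ae_ge0_L1_intP|rewrite -L1_norm_ge0E].
by split=> //; rewrite L1_norm_ge0E.
Qed.

Lemma L1_int_mono x A B : densities x -> measurable A -> measurable B ->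
  A `<=` B -> L1_int A x <= L1_int B x.
Proof.
move=> /densitiesP[x0 _] mA mB AB; rewrite -(setDUK AB) L1_int_setU//.
- by rewrite lerDl x0//; exact: measurableD.
- exact: measurableD.
- by apply/disj_setPS; rewrite setDIK.
Qed.

Lemma L1_int_null x A : measurable A -> m A = 0%E -> L1_int A x = 0.
Proof.
move=> mA A0; rewrite /L1_int /Rintegral null_set_integral//.
exact/measurable_EFinP/measurable_L1S.
Qed.

End L1_integrals.

Section L1_ext.
Context d (T : measurableType d) (R : realType).
Variable m : {sigma_finite_measure set T -> \bar R}.
Implicit Types x y : L1 m.

(** Both [x] and [y] are images of [y] under the transfer operator of the identity map, so the
    uniqueness of Perron-Frobenius images applies. *)
Lemma L1_ext x y : (forall A, measurable A -> L1_int A x = L1_int A y) -> x = y.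
Proof.
move=> xy; apply: (@is_PF_uniq _ _ _ m id y) => A mA //.
by rewrite /preimage/= -[X in integral _ X _]/A !L1_int_EFin// xy.
Qed.

End L1_ext.

Section L1_indicators.
Context d (T : measurableType d) (R : realType).
Variable m : {finite_measure set T -> \bar R}.
Implicit Types (f : T -> R) (x y : L1 m) (A : set T).

Lemma bounded_integrable f M : measurable_fun setT f ->
  (forall t, `|f t| <= M) -> m.-integrable setT (EFin \o f).
Proof.
move=> mf fM; apply: (@measurable_bounded_integrable _ _ _ m) => //.
  by rewrite -ge0_fin_numE//; exact: fin_num_measure.
by exists M; split=> [|r Mr t _ /=]; [exact: num_real|exact: le_trans (ltW Mr)].
Qed.

Lemma integrable_indic A : measurable A ->
  m.-integrable setT (EFin \o (\1_A : T -> R)).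
Proof.
move=> mA; apply: (@bounded_integrable _ 1) => [|t]; first exact: measurable_indic.
by rewrite indicE ger0_norm// lern1 leq_b1.
Qed.

Definition L1_indic A : L1 m := L1_mk m \1_A.

Lemma L1_int_indic A B : measurable A -> measurable B ->
  L1_int B (L1_indic A) = fine (m (A `&` B)).
Proof.
move=> mA mB; rewrite L1_int_mk//; last exact: integrable_indic.
by rewrite /Rintegral integral_indic.
Qed.

Lemma L1_indic_ge0 A : measurable A -> {ae m, forall t, 0 <= L1_indic A t}.
Proof.
move=> mA; apply/ae_ge0_L1_intP => B mB; rewrite L1_int_indic//.
exact: fine_ge0.
Qed.

Lemma norm_L1_indic A : measurable A -> `|L1_indic A| = fine (m A).
Proof.
move=> mA; rewrite L1_norm_ge0E//; last exact: L1_indic_ge0.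
by rewrite L1_int_indic// setIT.
Qed.

Definition uniform_density A : L1 m := (fine (m A))^-1 *: L1_indic A.

Lemma L1_int_uniform A B : measurable A -> measurable B ->
  L1_int B (uniform_density A) = fine (m (A `&` B)) / fine (m A).
Proof. by move=> mA mB; rewrite L1_intZ// L1_int_indic// mulrC. Qed.

Lemma fine_measure_gt0 A : measurable A -> (0 < m A)%E -> 0 < fine (m A).
Proof.
move=> mA mA0; rewrite fine_gt0// mA0/= -ge0_fin_numE//.
exact: fin_num_measure.
Qed.

Lemma uniform_density_density A : measurable A -> (0 < m A)%E ->
  densities (uniform_density A).
Proof.
move=> mA /(fine_measure_gt0 mA) mA0; apply/densitiesP; split=> [B mB|].
  by rewrite L1_int_uniform// divr_ge0 ?fine_ge0.
by rewrite L1_int_uniform// setIT divff// gt_eqF.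
Qed.

End L1_indicators.

(** * The Perron-Frobenius operator read on preimages *)

Section PF_properties.
Context d (T : measurableType d) (R : realType).
Variables (m : {sigma_finite_measure set T -> \bar R}) (g : T -> T).
Hypothesis gns : nonsingular m g.
Implicit Types (x y : L1 m) (A : set T).

Lemma measurable_iter n : measurable_fun setT (iter n g).
Proof.
case: gns => mg _; elim: n => [|n ih]; first exact: measurable_id.
exact: measurableT_comp.
Qed.

Lemma measurable_iter_preimage n A : measurable A -> measurable (iter n g @^-1` A).
Proof. by move=> mA; rewrite -[X in measurable X]setTI; exact: measurable_iter. Qed.

Lemma measurable_ns_preimage A : measurable A -> measurable (g @^-1` A).
Proof. exact: (@measurable_iter_preimage 1). Qed.

Lemma PF_int x A : measurable A -> L1_int A (PF g x) = L1_int (g @^-1` A) x.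
Proof.
move=> mA; apply: EFin_inj; rewrite -!L1_int_EFin//; first exact: PFP.
exact: measurable_ns_preimage.
Qed.

Lemma PF_eq x y : (forall A, measurable A -> L1_int A y = L1_int (g @^-1` A) x) ->
  PF g x = y.
Proof. by move=> xy; apply: L1_ext => A mA; rewrite PF_int// xy. Qed.

Lemma PF_iter_int n x A : measurable A ->
  L1_int A (iter n (PF g) x) = L1_int (iter n g @^-1` A) x.
Proof.
elim: n A => [|n ih] A mA //=; rewrite PF_int// ih//.
exact: measurable_ns_preimage.
Qed.

Lemma PF_iter_scaleD n a x y : iter n (PF g) (a *: x + y) =
  a *: iter n (PF g) x + iter n (PF g) y.
Proof.
apply: L1_ext => A mA; have mnA := measurable_iter_preimage n mA.
by rewrite L1_intD// L1_intZ// !PF_iter_int// L1_intD// L1_intZ.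
Qed.

Lemma PF_iterB n x y : iter n (PF g) (x - y) = iter n (PF g) x - iter n (PF g) y.
Proof.
by rewrite addrC -scaleN1r PF_iter_scaleD scaleN1r addrC.
Qed.

(** The two sign sets of [PF g x] pull back to a measurable set and its complement, over which the
    integrals of [|x|] add up to the norm of [x]. *)
Lemma norm_PF_le x : `|PF g x| <= `|x|.
Proof.
set P := L1_pos (PF g x).
have mP : measurable P := measurable_L1_pos _.
have mNP : measurable (~` P) by exact: measurableC.
have gNP : g @^-1` (~` P) = ~` (g @^-1` P) by [].
rewrite L1_norm_pos -/P !PF_int// gNP.
have mgP := measurable_ns_preimage mP.
apply: (@le_trans _ _ (\int[m]_(t in g @^-1` P) `|x t| +
   \int[m]_(t in ~` (g @^-1` P)) `|x t|)).
  apply: lerD.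
    apply: le_trans (ler_norm _) _; apply: le_normr_Rintegral => //.
    exact: integrable_L1S.
  apply: le_trans (ler_norm _) _; rewrite normrN.
  apply: le_normr_Rintegral => //; first exact: measurableC.
  by apply: integrable_L1S; exact: measurableC.
rewrite L1_norm_Rint -Rintegral_setU ?setUv//.
- exact: measurableC.
- exact: integrable_L1norm.
- by apply/disj_setPS; rewrite setICr.
Qed.

Lemma norm_PF_iter_le n x : `|iter n (PF g) x| <= `|x|.
Proof. by elim: n => //= n ih; exact: le_trans (norm_PF_le _) ih. Qed.

Lemma PF_iter_densities n x : densities x -> densities (iter n (PF g) x).
Proof.
move=> /densitiesP[x0 x1]; apply/densitiesP; split=> [A mA|].
  by rewrite PF_iter_int// x0//; exact: measurable_iter_preimage.
by rewrite PF_iter_int.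
Qed.

Lemma cesaro_mean_int n x A : measurable A ->
  L1_int A (cesaro_mean (PF g) n x) =
  n%:R^-1 * \sum_(i < n) L1_int (iter i g @^-1` A) x.
Proof.
move=> mA; rewrite L1_intZ// L1_int_sum//; congr (_ * _).
by apply: eq_bigr => i _; rewrite PF_iter_int.
Qed.

Lemma cesaro_mean_scaleD n a x y : cesaro_mean (PF g) n (a *: x + y) =
  a *: cesaro_mean (PF g) n x + cesaro_mean (PF g) n y.
Proof.
rewrite /cesaro_mean scalerA mulrC -scalerA -scalerDr; congr (_ *: _).
rewrite scaler_sumr -big_split/=; apply: eq_bigr => i _.
exact: PF_iter_scaleD.
Qed.

Lemma norm_cesaro_mean_le n x : `|cesaro_mean (PF g) n x| <= `|x|.
Proof.
rewrite normrZ ger0_norm ?invr_ge0//.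
(* For [n = 0] the convention [0^-1 = 0] makes the mean zero. *)
case: n => [|n]; first by rewrite invr0 mul0r.
rewrite mulrC ler_pdivrMr// mulr_natr.
apply: le_trans (ler_norm_sum _ _ _) _.
rewrite -[X in _ *+ X]card_ord -sumr_const; apply: ler_sum => i _.
exact: norm_PF_iter_le.
Qed.

End PF_properties.

(** * Compactness and equi-integrability in L1 *)

Section compact_L1.
Context d (T : measurableType d) (R : realType).
Variable m : {measure set T -> \bar R}.
Implicit Types (x y h : L1 m) (A : set T) (F : set (L1 m)).

Lemma dist_to_ge c h F : (forall psi, F psi -> c <= `|h - psi|) ->
  (c%:E <= dist_to h F)%E.
Proof. by move=> cF; apply: le_ereal_inf_tmp => _ [psi Fpsi <-]; rewrite lee_fin cF. Qed.

Lemma dist_to_ge0 h F : (0 <= dist_to h F)%E.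
Proof. by apply: dist_to_ge. Qed.

Lemma dist_to_le h psi F : F psi -> (dist_to h F <= `|h - psi|%:E)%E.
Proof. by move=> Fpsi; apply: ereal_inf_lbound; exists psi. Qed.

Lemma dist_to_lt h F e : (dist_to h F < e%:E)%E -> exists2 psi, F psi & `|h - psi| < e.
Proof. by move=> /ereal_inf_lt[_ [psi Fpsi <-]]; rewrite lte_fin; exists psi. Qed.

(** Points of [F] close to [u n] also make the extended distance finite, which its convergence to a
    real limit requires. *)
Lemma dist_to_cvg0 (u : nat -> L1 m) F :
  (forall e : R, 0 < e -> \forall n \near \oo, exists2 psi, F psi & `|u n - psi| <= e) ->
  dist_to (u n) F @[n --> \oo] --> 0%E.
Proof.
move=> uF; apply/fine_cvgP; split.
  have := uF 1 ltr01; apply: filterS => n [psi Fpsi h].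
  rewrite ge0_fin_numE; last exact: dist_to_ge0.
  exact: le_lt_trans (dist_to_le _ Fpsi) (ltry _).
apply/cvgrPdist_le => e e0; have := uF e e0; apply: filterS => n [psi Fpsi h].
rewrite sub0r normrN ger0_norm; last exact/fine_ge0/dist_to_ge0.
rewrite -lee_fin fineK; last first.
  rewrite ge0_fin_numE; last exact: dist_to_ge0.
  exact: le_lt_trans (dist_to_le _ Fpsi) (ltry _).
by apply: le_trans (dist_to_le _ Fpsi) _; rewrite lee_fin.
Qed.

Lemma cvg0_near_lt (u : nat -> \bar R) (e : R) : 0 < e -> u n @[n --> \oo] --> 0%E ->
  \forall n \near \oo, (u n < e%:E)%E.
Proof.
move=> e0 u0; have /(_ _) := u0 [set y | (y < e%:E)%E]; apply.
by apply: open_nbhs_nbhs; split; [exact: open_ereal_lt_ereal|rewrite /= lte_fin].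
Qed.

Lemma compact_totally_bounded F (e : R) : compact F -> 0 < e ->
  exists s : seq (L1 m), forall psi, F psi -> exists2 y, y \in s & `|psi - y| < e.
Proof.
rewrite compact_cover => cF e0.
have [||D DF FD] := cF (L1 m) F (fun y => ball y e).
- by move=> y _; exact: ball_open.
- by move=> y Fy; exists y => //; exact: ballxx.
exists (finmap.enum_fset D) => psi /FD[y /= Dy]; rewrite -ball_normE/= => h.
by exists y => //; rewrite distrC.
Qed.

End compact_L1.

Section equiintegrable.
Context d (T : measurableType d) (R : realType).
Variable m : {finite_measure set T -> \bar R}.
Implicit Types (f : T -> R) (x y h : L1 m) (A : set T) (F : set (L1 m)).

Lemma L1_mkD f1 f2 : m.-integrable setT (EFin \o f1) ->
  m.-integrable setT (EFin \o f2) ->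
  L1_mk m (f1 \+ f2) = L1_mk m f1 + L1_mk m f2.
Proof.
move=> i1 i2; apply: L1_ext => A mA.
have i12 : m.-integrable setT (EFin \o (f1 \+ f2)) by exact: (integrableD measurableT i1 i2).
rewrite L1_intD// !L1_int_mk// RintegralD//.
- exact: integrableS i1.
- exact: integrableS i2.
Qed.

Lemma L1_mkZ a f : m.-integrable setT (EFin \o f) ->
  L1_mk m (a \*: f) = a *: L1_mk m f.
Proof.
move=> fi; apply: L1_ext => A mA.
have afi : m.-integrable setT (EFin \o (a \*: f)) by exact: (integrableZl measurableT a fi).
rewrite L1_intZ// !L1_int_mk// RintegralZl//.
exact: integrableS fi.
Qed.

Lemma L1_mk0 : L1_mk m (cst 0) = 0.
Proof.
apply: L1_ext => A mA; rewrite L1_int0// L1_int_mk//; last exact: integrable0.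
by rewrite Rintegral_cst// mul0r.
Qed.

Lemma L1_mk_sum I (s : seq I) (F : I -> T -> R) :
  (forall i, m.-integrable setT (EFin \o F i)) ->
  m.-integrable setT (EFin \o (fun t => \sum_(i <- s) F i t)) /\
  L1_mk m (fun t => \sum_(i <- s) F i t) = \sum_(i <- s) L1_mk m (F i).
Proof.
move=> iF; elim: s => [|i s [ih1 ih2]].
  rewrite big_nil -[RHS]L1_mk0; split; last first.
    by congr L1_mk; apply/funext => t; rewrite big_nil.
  apply: (eq_integrable measurableT (cst 0%E)); last exact: integrable0.
  by move=> t _ /=; rewrite big_nil.
rewrite big_cons -ih2 -L1_mkD//.
have -> : (fun t => \sum_(j <- i :: s) F j t) = F i \+ (fun t => \sum_(j <- s) F j t).
  by apply/funext => t; rewrite big_cons.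
by split=> //; exact: (integrableD measurableT (iF i) ih1).
Qed.

Lemma norm_L1_mkB x f : m.-integrable setT (EFin \o f) ->
  `|x - L1_mk m f| = \int[m]_t `|x t - f t|.
Proof.
move=> fi; rewrite L1_norm_Rint.
have mf : measurable_fun setT f by apply/measurable_EFinP; exact: measurable_int fi.
apply: ae_eq_Rintegral => //.
- by apply: measurableT_comp => //; exact: measurable_L1S.
- apply: measurableT_comp => //; apply: measurable_funB => //.
- move: (L1_mk_ae fi); apply: filter_app.
  move: (L1_opp_ae (L1_mk m f)); apply: filter_app.
  move: (L1_add_ae x (- L1_mk m f)); apply: filterS => t /= e1 e2 e3 _.
  by rewrite e1// e2//= e3.
Qed.

Lemma fine_measureU A B : measurable A -> measurable B -> A `&` B = set0 ->
  fine (m (A `|` B)) = fine (m A) + fine (m B).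
Proof. by move=> mA mB AB; rewrite measureU// fineD//; exact: fin_num_measure. Qed.

Lemma L1_sfun_dense x (e : R) : 0 < e -> exists2 f : {sfun T >-> R},
  m.-integrable setT (EFin \o (f : T -> R)) & `|x - L1_mk m f| < e.
Proof.
move=> e0; have [g_ [gi _ g0]] :=
  approximation_sfun_integrable measurableT (integrable_L1 x).
have [n hn] : exists n,
    (\int[m]_(z in setT) `|(EFin \o x) z - (g_ n z)%:E| < e%:E)%E.
  by have [N _ hN] := cvg0_near_lt e0 g0; exists N; apply: hN => /=.
exists (g_ n) => //; rewrite norm_L1_mkB// -lte_fin fineK//.
apply: integrable_fin_num => //.
apply: (@integrable_norm _ _ _ m setT (fun t => x t - g_ n t)).
exact: (integrableB measurableT (integrable_L1 x) (gi n)).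
Qed.

(** Up to [e / 2] in norm, [x] is a simple function bounded by [K], whose integral over [A] is at
    most [K] times the measure of [A]. *)
Lemma L1_abs_continuous x (e : R) : 0 < e -> exists2 delta : R, 0 < delta &
  forall A, measurable A -> (m A < delta%:E)%E -> `|L1_int A x| < e.
Proof.
move=> e0; have e20 : 0 < e / 2 by rewrite divr_gt0.
have [f fi xf] := L1_sfun_dense x e20.
have [M [_ hM]] := simple_bounded f.
pose K := `|M| + 1.
have K0 : 0 < K by rewrite ltr_wpDl.
have fK t : `|f t| <= K.
  by apply: hM => //; rewrite /K (le_lt_trans (ler_norm M))// ltrDl.
exists (e / 2 / K); first exact: divr_gt0.
move=> A mA Ad; have -> : x = x - L1_mk m f + L1_mk m f by rewrite subrK.
rewrite L1_intD//; apply: le_lt_trans (ler_normD _ _) _.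
rewrite [e]splitr; apply: ltrD.
  exact: le_lt_trans (le_L1_int_norm _ mA) xf.
rewrite L1_int_mk//.
have fiA : m.-integrable A (EFin \o f) by exact: integrableS fi.
apply: le_lt_trans (le_normr_Rintegral mA fiA) _.
apply: (@le_lt_trans _ _ (\int[m]_(t in A) K)).
  apply: le_Rintegral => //.
    exact: (@integrable_norm _ _ _ m A f).
  by apply: integrableS (bounded_integrable m (@measurable_cst _ _ _ _ setT K) (M := K) _) => // t; rewrite ger0_norm// ltW.
rewrite Rintegral_cst// mulrC -ltr_pdivlMr// -lte_fin fineK//.
exact: fin_num_measure.
Qed.

(** A finite [e / 2]-net reduces the bound to the absolute continuity of finitely many elements. *)
Lemma compact_equiintegrable F (e : R) : compact F -> 0 < e ->
  exists2 delta : R, 0 < delta & forall psi A, F psi -> measurable A ->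
    (m A < delta%:E)%E -> `|L1_int A psi| < e.
Proof.
move=> cF e0; have e20 : 0 < e / 2 by rewrite divr_gt0.
have [s Fs] := compact_totally_bounded cF e20.
have [delta d0 hd] : exists2 delta : R, 0 < delta & forall y A, y \in s ->
    measurable A -> (m A < delta%:E)%E -> `|L1_int A y| < e / 2.
  elim: s {Fs} => [|y s [d1 d10 h1]]; first by exists 1.
  have [d2 d20 h2] := L1_abs_continuous y e20.
  exists (Num.min d1 d2); first by rewrite lt_min d10.
  move=> z A; rewrite inE => /orP[/eqP-> mA|zs mA] Ad.
    by apply: h2 => //; apply: lt_le_trans Ad _; rewrite lee_fin ge_min lexx orbT.
  by apply: h1 => //; apply: lt_le_trans Ad _; rewrite lee_fin ge_min lexx.
exists delta => // psi A Fpsi mA Ad; have [y ys py] := Fs _ Fpsi.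
have -> : psi = psi - y + y by rewrite subrK.
rewrite L1_intD//; apply: le_lt_trans (ler_normD _ _) _.
rewrite [e]splitr; apply: ltrD; last exact: hd.
exact: le_lt_trans (le_L1_int_norm _ mA) py.
Qed.

(** A monotone class principle for a closed linear subspace [W]: Dynkin's induction brings in the
    indicators of all measurable sets, linearity the simple functions, and closedness the rest. *)
Lemma L1_dense (G : set (set T)) (W : set (L1 m)) :
  @measurable _ T = <<s G >> -> setI_closed G ->
  (forall a x y, W x -> W y -> W (a *: x + y)) ->
  (forall x, (forall e : R, 0 < e -> exists2 y, W y & `|x - y| < e) -> W x) ->
  W (L1_indic m setT) -> (forall A, G A -> W (L1_indic m A)) ->
  forall x, W x.
Proof.
move=> GE GI WD Wcl WT WG.
have W0 : W 0 by rewrite -(subrr (L1_indic m setT)) addrC -scaleN1r; exact: WD.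
have WZ a x : W x -> W (a *: x) by move=> Wx; rewrite -[_ *: _]addr0; exact: WD.
have Wadd x y : W x -> W y -> W (x + y) by rewrite -{2}[x]scale1r; exact: WD.
have WI A : measurable A -> W (L1_indic m A).
  rewrite GE; apply: (@dynkin_induction _ T G (fun A => W (L1_indic m A)) GE GI) => // [B mB WB|F mF tF WF].
    have -> : L1_indic m (~` B) = -1 *: L1_indic m B + L1_indic m setT; last exact: WD.
    apply: L1_ext => C mC; rewrite L1_intD// L1_intZ// !L1_int_indic//; last exact: measurableC.
    rewrite setTI mulN1r -[in X in _ = _ + fine (m X)](setIT C) -(setUv B) setIUr.
    rewrite fine_measureU; [|exact: measurableI| |].
    - by rewrite (setIC B) (setIC (~` B)) addKr.
    - by apply: measurableI => //; exact: measurableC.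
    - by rewrite setIACA setICr setI0.
  (* A disjoint countable union is the L1-limit of its finite unions: the measure of the remainder
     is the tail of a convergent series. *)
  apply: Wcl => e e0.
  have mU : measurable (\bigcup_k F k) by exact: bigcup_measurable.
  have : (fun n => \sum_(0 <= i < n) m (F i))%E @ \oo --> (fine (m (\bigcup_k F k)))%:E.
    by rewrite fineK ?fin_num_measure//; exact: measure_semi_sigma_additive.
  move=> /fine_cvgP[_ /cvgrPdist_lt /(_ e e0) [N _ /(_ N (leqnn N))/=]] hN.
  have mUN n : measurable (\big[setU/set0]_(i < n) F i) by exact: bigsetU_measurable.
  exists (L1_indic m (\big[setU/set0]_(i < N) F i)).
    elim: N {hN} => [|n ihn].
      rewrite big_ord0; have -> // : L1_indic m set0 = 0.
      apply: L1_ext => C mC; rewrite L1_int0// L1_int_indic//.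
      by rewrite set0I measure0.
    rewrite big_ord_recr/=.
    have -> : L1_indic m (\big[setU/set0]_(i < n) F i `|` F n) =
      L1_indic m (\big[setU/set0]_(i < n) F i) + L1_indic m (F n); last exact: Wadd.
    have dis : \big[setU/set0]_(i < n) F i `&` F n = set0.
      rewrite -bigcup_mkord; apply/seteqP; split=> // t [[i /= lti Fit] Fnt].
      by have := tF i n I I (ex_intro _ t (conj Fit Fnt)) => ein; rewrite ein ltnn in lti.
    apply: L1_ext => C mC; rewrite L1_intD// !L1_int_indic//; last exact: measurableU.
    rewrite setIUl fine_measureU//; [exact: measurableI..|].
    by rewrite setIACA dis set0I.
  have sub : \big[setU/set0]_(i < N) F i `<=` \bigcup_k F k.
    by rewrite -bigcup_mkord => t [i _ Fit]; exists i.
  have -> : L1_indic m (\bigcup_k F k) - L1_indic m (\big[setU/set0]_(i < N) F i) =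
      L1_indic m (\bigcup_k F k `\` \big[setU/set0]_(i < N) F i).
    have mD : measurable (\bigcup_k F k `\` \big[setU/set0]_(i < N) F i).
      exact: measurableD.
    apply: L1_ext => C mC; rewrite L1_intB// !L1_int_indic//.
    rewrite -{1}(setDUK sub) setIUl fine_measureU//; [|exact: measurableI..|].
      by rewrite addrAC subrr add0r.
    by rewrite setIACA setDIK set0I.
  rewrite norm_L1_indic; last exact: measurableD.
  rewrite measureD//; last first.
    by rewrite -ge0_fin_numE//; exact: fin_num_measure.
  rewrite setIidr// fineB; [|exact: fin_num_measure..].
  apply: le_lt_trans hN; rewrite big_mkord -measure_bigsetU// ?ler_norm//.
move=> x; apply: Wcl => e e0; have [f fi xf] := L1_sfun_dense x e0.
exists (L1_mk m f) => //.
have -> : (f : T -> R) = fun t => \sum_(y <- finmap.enum_fset (fset_set (range f))) (y \*: \1_(f @^-1` [set y]) : T -> R) t.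
  by apply/funext => t; rewrite {1}(fimfunE f) fsbig_finite.
have mfy (y : R) : measurable (f @^-1` [set y]).
  by rewrite -[X in measurable X]setTI; exact: measurable_funPT.
have iy (y : R) : m.-integrable setT (EFin \o (\1_(f @^-1` [set y]) : T -> R)).
  exact: integrable_indic.
rewrite (proj2 (L1_mk_sum _ _)); last first.
  by move=> y; exact: (integrableZl measurableT y (iy y)).
elim/big_ind: _ => // y _; rewrite L1_mkZ//; apply: WZ; exact: WI.
Qed.

End equiintegrable.

(** * Elements of L1 built from set functions *)

Section real_Radon_Nikodym.
Context d (T : measurableType d) (R : realType).
Variables (m : {sigma_finite_measure set T -> \bar R}) (nu : set T -> R).
Hypothesis nu_sigma : forall F : (set T)^nat, (forall i, measurable (F i)) ->
  trivIset setT F -> \sum_(0 <= i < n) nu (F i) @[n --> \oo] --> nu (\bigcup_k F k).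
Hypothesis nu_null : forall A, measurable A -> m A = 0%E -> nu A = 0.

Let nuE (A : set T) : \bar R := (nu A)%:E.

Let nuE0 : nuE set0 = 0%E.
Proof. by rewrite /nuE nu_null. Qed.

Let nuE_fin A : measurable A -> nuE A \is a fin_num.
Proof. by []. Qed.

Let nuE_sigma : semi_sigma_additive nuE.
Proof.
move=> F mF tF mUF; have := nu_sigma mF tF => h.
have -> : (fun n => \sum_(0 <= i < n) nuE (F i))%E =
    EFin \o (fun n => \sum_(0 <= i < n) nu (F i)).
  by apply/funext => n /=; rewrite /nuE sumEFin.
exact: cvg_comp h _.
Qed.

HB.instance Definition _ := isCharge.Build _ _ _ nuE nuE0 nuE_fin nuE_sigma.

(** The source of the elements that have no formula: pushforwards, ultrafilter means and limits of
    Cauchy filters. *)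
Lemma L1_Radon_Nikodym : exists x : L1 m, forall A, measurable A -> L1_int A x = nu A.
Proof.
have num : nuE `<< m.
  by apply/null_content_dominatesP => A mA A0; rewrite /= /nuE nu_null.
pose f := Radon_Nikodym (nuE : {charge set T -> \bar R}) m.
have ffin t : f t \is a fin_num by exact: Radon_Nikodym_fin_num.
have fi : m.-integrable setT (EFin \o (fine \o f)).
  have := Radon_Nikodym_integrable num; apply: eq_integrable => // t _ /=.
  by rewrite fineK.
exists (L1_mk m (fine \o f)) => A mA; rewrite L1_int_mk//.
rewrite -[RHS]/(fine (nuE A)) (Radon_Nikodym_integral num mA); congr fine.
by apply: eq_integral => t _ /=; rewrite fineK.
Qed.

End real_Radon_Nikodym.

Section L1_sigma_additive.
Context d (T : measurableType d) (R : realType).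
Variable m : {measure set T -> \bar R}.

Lemma L1_int_sigma (x : L1 m) (F : (set T)^nat) : (forall i, measurable (F i)) ->
  trivIset setT F ->
  \sum_(0 <= i < n) L1_int (F i) x @[n --> \oo] --> L1_int (\bigcup_k F k) x.
Proof.
move=> mF tF; have mU : measurable (\bigcup_k F k) by exact: bigcup_measurable.
have : ((fun n => \sum_(0 <= i < n) \int[m]_(t in F i) (x t)%:E) @ \oo -->
    (L1_int (\bigcup_k F k) x)%:E)%E.
  rewrite -L1_int_EFin//.
  exact: (@charge_semi_sigma_additive _ _ _ (induced_charge (integrable_L1 x))).
move=> /fine_cvgP[_]; apply: cvg_trans; apply: near_eq_cvg; near=> n => /=.
transitivity (fine (\sum_(0 <= i < n) (L1_int (F i) x)%:E)%E).
  by congr fine; apply: eq_bigr => i _; exact: L1_int_EFin.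
by rewrite sumEFin.
Unshelve. all: by end_near. Qed.

Lemma L1_int_bigsetU (x : L1 m) (G : (set T)^nat) n : (forall i, measurable (G i)) ->
  trivIset setT G ->
  L1_int (\big[setU/set0]_(i < n) G i) x = \sum_(0 <= i < n) L1_int (G i) x.
Proof.
move=> mG tG; elim: n => [|n ih]; first by rewrite big_ord0 big_nil /L1_int Rintegral_set0.
rewrite big_nat_recr//= -ih big_ord_recr/= L1_int_setU//; first exact: bigsetU_measurable.
apply/disj_setPS => t; rewrite -bigcup_mkord => -[[i /= lti Git] Gnt].
by have := tG i n I I (ex_intro _ t (conj Git Gnt)) => ein; rewrite ein ltnn in lti.
Qed.

End L1_sigma_additive.

(** The image ultrafilter contains the compact interval [[-M, M]], hence clusters at one of its
    points; an ultrafilter converges to each of its cluster points. *)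
Lemma ultra_bounded_cvg (R : realType) (T : Type) (U : set_system T) (f : T -> R) (M : R) :
  UltraFilter U -> (\forall t \near U, `|f t| <= M) -> exists l : R, f t @[t --> U] --> l.
Proof.
move=> UU fM; have PU : ProperFilter U := ultra_proper.
have [|l [_ al]] := @segment_compact R (- M) M (f t @[t --> U]) _.
  by apply: filterS fM => t; rewrite /preimage/= in_itv/= -ler_norml.
exists l => V lV; have [//|h] := in_ultra_setVsetC (f @^-1` V) UU.
by have [r [/=]] := al (~` V) V h lV.
Qed.

Lemma trivIset_preimage T1 T2 (r : T1 -> T2) (F : (set T2)^nat) :
  trivIset setT F -> trivIset setT (fun i => r @^-1` F i).
Proof.
move=> /trivIsetP tF; apply/trivIsetP => i j iT jT ij.
by rewrite -preimage_setI tF// preimage_set0.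
Qed.

(** Integrating [x] over preimages under [r] is a charge; the second hypothesis is its absolute
    continuity with respect to [m2]. *)
Lemma L1_transfer d1 d2 (T1 : measurableType d1) (T2 : measurableType d2)
    (R : realType) (m1 : {measure set T1 -> \bar R})
    (m2 : {sigma_finite_measure set T2 -> \bar R}) (r : T1 -> T2) (x : L1 m1) :
  measurable_fun setT r ->
  (forall B, measurable B -> m2 B = 0%E -> L1_int (r @^-1` B) x = 0) ->
  exists y : L1 m2, forall B, measurable B -> L1_int B y = L1_int (r @^-1` B) x.
Proof.
move=> mr r0; apply: (@L1_Radon_Nikodym _ _ _ m2 (fun B => L1_int (r @^-1` B) x)) => // F mF tF.
rewrite preimage_bigcup; apply: L1_int_sigma.
  by move=> i; rewrite -[X in measurable X]setTI; exact: mr.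
exact: trivIset_preimage.
Qed.

(** * Obstructions to compact attractors *)

Section attractor_failures.
Context d (T : measurableType d) (R : realType).
Variables (m : probability T R) (g : T -> T).
Hypothesis gns : nonsingular m g.
Implicit Types (h psi : L1 m) (A : set T) (F : set (L1 m)).

Let L1_int_far h psi A : measurable A -> L1_int A h = 1 -> `|L1_int A psi| < 2^-1 ->
  2^-1 <= `|h - psi|.
Proof.
move=> mA h1 p; apply: le_trans (le_L1_int_norm (h - psi) mA).
rewrite L1_intB// h1; apply: le_trans (ler_norm _).
by have := ler_norm (L1_int A psi); lra.
Qed.

(** A single time [n] suffices: all images of densities are then within 1/2 of [F], whose elements
    put less than 1/2 on each small set, whereas a density carried by the preimage of such a set
    ends up entirely on it. *)
Lemma not_propUC :
  (forall delta : R, 0 < delta -> exists F : (set T)^nat,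
     [/\ forall k, measurable (F k), forall k, (m (F k) < delta%:E)%E &
         \bigcup_k F k = setT]) ->
  ~ propUC (PF (m := m) g).
Proof.
move=> div [F cF UC].
have [delta d0 Fd] := compact_equiintegrable cF (ltac:(by rewrite invr_gt0) : 0 < 2^-1 :> R).
have [G [mG Gd GT]] := div _ d0.
have [n _ /(_ n (leqnn n)) hn] := cvg0_near_lt (ltac:(by rewrite invr_gt0) : 0 < 2^-1 :> R) UC.
have mnG k : measurable (iter n g @^-1` G k) by exact: (measurable_iter_preimage gns).
have G0 k : m (iter n g @^-1` G k) = 0%E.
  apply/eqP; rewrite eq_le measure_ge0 andbT leNgt; apply/negP => Gk0.
  pose h : L1 m := uniform_density m (iter n g @^-1` G k).
  have dh : densities h by exact: uniform_density_density.
  have : (dist_to (iter n (PF g) h) F < (2^-1)%:E)%E.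
    by apply: le_lt_trans hn; apply: ereal_sup_ubound; exists h.
  apply/negP; rewrite -leNgt; apply: dist_to_ge => psi Fpsi.
  apply: (@L1_int_far _ _ (G k)) => //; last exact: (Fd psi (G k) Fpsi (mG k) (Gd k)).
  rewrite PF_iter_int// L1_int_uniform// setIid divff// gt_eqF//.
  exact: fine_measure_gt0.
(* The null preimages of the countably many small sets still cover the space. *)
have : m setT = 0%E.
  have : (m setT <= \sum_(k <oo) m (iter n g @^-1` G k))%E.
    by apply: measure_sigma_subadditive => //; rewrite -preimage_bigcup GT.
  by rewrite eseries0// measure_le0 => /eqP.
by rewrite probability_setT => /eqP; rewrite onee_eq0.
Qed.

Lemma not_propMC :
  (forall delta : R, 0 < delta -> exists A, [/\ measurable A, (0 < m A)%E,
     (m A < delta%:E)%E & g @^-1` A = A]) ->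
  ~ propMC (PF (m := m) g).
Proof.
move=> inv [F cF MC].
have [delta d0 Fd] := compact_equiintegrable cF (ltac:(by rewrite invr_gt0) : 0 < 2^-1 :> R).
have [A [mA A0 Ad gA]] := inv _ d0.
pose h : L1 m := uniform_density m A.
have dh : densities h by exact: uniform_density_density.
have [N _ hN] := cvg0_near_lt (ltac:(by rewrite invr_gt0) : 0 < 2^-1 :> R) (MC h dh).
(* Time [N.+1] rather than [N]: a mean over zero terms would be 0 instead of keeping mass 1 on
   [A]. *)
have := hN N.+1 (leqnSn N) => /=; apply/negP; rewrite -leNgt; apply: dist_to_ge => psi Fpsi.
apply: (@L1_int_far _ _ A) => //; last exact: Fd.
have itA i : iter i g @^-1` A = A.
  by elim: i => // i ih; rewrite -[RHS]ih -[in RHS]gA.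
rewrite cesaro_mean_int//; under eq_bigr do rewrite itA.
rewrite sumr_const card_ord L1_int_uniform// setIid divff ?gt_eqF//; last exact: fine_measure_gt0.
by rewrite mulVf.
Qed.

(** Beyond some time the orbit stays within [c / 2] of a finite [c / 4]-net of the attractor; among
    more times than centers, two share a center and come closer than [c]. *)
Lemma not_propC h (c : R) : 0 < c -> densities h ->
  (forall n k, c <= `|iter n (PF g) h - iter (n + k.+1) (PF g) h|) ->
  ~ propC (PF (m := m) g).
Proof.
move=> c0 dh hc [F cF C].
have c40 : 0 < c / 4 by rewrite divr_gt0.
have [s Fs] := compact_totally_bounded cF c40.
have [N _ hN] := cvg0_near_lt c40 (C h dh).
have near_s n : exists i : 'I_(size s), `|iter (N + n) (PF g) h - s`_i| < c / 2.
  have := hN (N + n)%N (leq_addr n N) => /dist_to_lt[psi Fpsi h1].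
  have [y ys h2] := Fs _ Fpsi.
  have iy : (index y s < size s)%N by rewrite index_mem.
  exists (Ordinal iy) => /=; rewrite nth_index//.
  have -> : iter (N + n) (PF g) h - y = (iter (N + n) (PF g) h - psi) + (psi - y).
    by rewrite addrA subrK.
  by apply: le_lt_trans (ler_normD _ _) _; lra.
pose phi (n : 'I_(size s).+1) : 'I_(size s) := sval (cid (near_s n)).
have [n1 [n2 [n12 e12]]] : exists n1 n2 : 'I_(size s).+1, (n1 < n2)%N /\ phi n1 = phi n2.
  have : ~ injective phi.
    by move=> /leq_card; rewrite !card_ord ltnn.
  move=> /existsNP[a /existsNP[b /not_implyP[ab /eqP anb]]].
  have [lt|gt|/val_inj eq] := ltngtP a b.
  - by exists a, b.
  - by exists b, a.
  - by rewrite eq eqxx in anb.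
have h1 := svalP (cid (near_s n1)); have h2 := svalP (cid (near_s n2)).
rewrite -/(phi n1) in h1; rewrite -/(phi n2) -e12 in h2.
have := hc (N + n1)%N (n2 - n1).-1; rewrite prednK ?subn_gt0//.
have -> : (N + n1 + (n2 - n1) = N + n2)%N by rewrite -addnA subnKC// ltnW.
apply/negP; rewrite -ltNge.
set y := s`_(phi n1) in h1 h2 *.
rewrite (_ : _ - _ = (iter (N + n1) (PF g) h - y) - (iter (N + n2) (PF g) h - y)); last first.
  by rewrite opprB addrA subrK.
by apply: le_lt_trans (ler_normB _ _) _; lra.
Qed.

End attractor_failures.

(** * Set integrals as weakly continuous forms *)

Section weak_compactness.
Context d (T : measurableType d) (R : realType).
Variable m : probability T R.
Implicit Types (x y : L1 m) (A : set T).

Definition L1_functional A (x : L1 m) : R^o := L1_int A x.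

Lemma L1_functional_scaleD A : measurable A ->
  forall a x y, L1_functional A (a *: x + y) = a *: L1_functional A x + L1_functional A y.
Proof. by move=> mA a x y; rewrite /L1_functional L1_intD// L1_intZ. Qed.

Lemma L1_functional_continuous A : measurable A -> continuous (L1_functional A).
Proof.
move=> mA x.
apply: (@cvgrPdist_lt R R^o (L1 m) (nbhs x) (nbhs_filter x) (L1_functional A) (L1_functional A x)).2 => e e0.
near=> y.
rewrite /L1_functional -L1_intB//; apply: le_lt_trans (le_L1_int_norm _ mA) _.
near: y; exact: cvgr_dist_lt.
Unshelve. all: by end_near. Qed.

Lemma L1_dual A : measurable A ->
  exists l : cont_dual (L1 m), forall x, sval l x = L1_int A x.
Proof.
move=> mA.
have lin : linear (L1_functional A) by move=> a x y; exact: L1_functional_scaleD.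
pose l : {linear (L1 m) -> R^o} := HB.pack (L1_functional A)
  (GRing.isLinear.Build R (L1 m) R^o *:%R (L1_functional A) lin).
have cl : [set l : {linear (L1 m) -> R^o} | continuous l] l.
  exact: L1_functional_continuous.
by exists (exist _ l (mem_set cl)).
Qed.

(** The initial topology makes the evaluation map continuous, and [L1_int A] is one coordinate of
    it. *)
Lemma weak_continuous_L1_int A : measurable A ->
  continuous (L1_int A : initial_topology (@dual_eval R (L1 m)) -> R).
Proof.
move=> mA; have [l lE] := L1_dual mA.
have -> : (L1_int A : initial_topology (@dual_eval R (L1 m)) -> R) =
    (fun f : {ptws cont_dual (L1 m) -> R^o} => f l) \o @dual_eval R (L1 m).
  by apply/funext => x; rewrite /= -lE.
move=> x; apply: (@cvg_comp _ _ _ (@dual_eval R (L1 m)) (fun f => f l)).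
  exact: initial_continuous.
exact: (@proj_continuous (cont_dual (L1 m)) (fun=> R^o) l (@dual_eval R (L1 m) x)).
Qed.

End weak_compactness.

(** * Weak almost periodicity and invariant densities *)

Section weakly_precompact_orbit.
Context d (T : measurableType d) (R : realType).
Variable m : probability T R.

(** Dini's argument: the sets where the integral over [B k] is below [e] are weakly open and, by
    absolute continuity, cover the weakly compact closure of [O]. This uniform bound on tails is
    what weak compactness contributes to the invariant density. *)
Lemma weakly_precompact_tail (O : set (L1 m)) (B : (set T)^nat) (e : R) :
  weakly_precompact O -> O `<=` (@densities _ _ _ m) -> (forall k, measurable (B k)) ->
  (forall i j, (i <= j)%N -> B j `<=` B i) -> \bigcap_k B k = set0 -> 0 < e ->
  exists k, forall x, O x -> L1_int (B k) x < e.
Proof.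
move=> wO Od mB Bd B0 e0; pose W := initial_topology (@dual_eval R (L1 m)).
pose K := closure (O : set W).
have : compact K by rewrite -precompactE.
rewrite compact_cover => /(_ nat setT (fun k => [set x | L1_int (B k) x < e])).
case.
- move=> k _; have /continuousP := weak_continuous_L1_int (m := m) (mB k).
  by move=> /(_ [set r | r < e]); apply; exact: open_lt.
- move=> x _; have [delta d0 hd] := L1_abs_continuous (x : L1 m) e0.
  have : m \o B @ \oo --> m (\bigcap_k B k).
    apply: nonincreasing_cvg_mu => //.
    - by rewrite -ge0_fin_numE//; exact: fin_num_measure.
    - by rewrite B0.
    - by move=> i j ij; apply/subsetPset; exact: Bd.
  rewrite B0 measure0 => /(cvg0_near_lt d0)[k _ /(_ k (leqnn k))/= hk].
  by exists k => //=; apply: le_lt_trans (ler_norm _) _; exact: hd.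
(* Densities are monotone in the set and the [B k] decrease, so the largest index of the finite
   subcover serves all of [O]. *)
move=> D _ KD; exists (\max_(i <- finmap.enum_fset D) i) => x Ox.
have [i /= Di h] := KD x (subset_closure Ox).
apply: le_lt_trans h; apply: L1_int_mono => //; first exact: Od.
by apply: Bd; exact: (@leq_bigmax_seq _ _ xpredT id).
Qed.

End weakly_precompact_orbit.

Section invariant_density.
Context d (T : measurableType d) (R : realType).
Variables (m : probability T R) (g : T -> T) (phi : L1 m).
Hypotheses (gns : nonsingular m g) (dphi : densities phi).
Hypothesis wphi : weakly_precompact [set iter n (PF g) phi | n in [set n | (1 <= n)%N]].
Variable U : set_system nat.
Hypotheses (UU : UltraFilter U) (infU : \oo `<=` U).
Implicit Types A B : set T.

(** The orbit is read from time 1 on, as in [wphi], and [a n] averages [n.+1] of its terms, so that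
    no mean is empty. *)
Let b i A := L1_int A (iter i.+1 (PF g) phi).
Let a n A := n.+1%:R^-1 * \sum_(i < n.+1) b i A.

Let bd i : densities (iter i.+1 (PF g) phi).
Proof. exact: PF_iter_densities. Qed.

Let b_ge0 i A : measurable A -> 0 <= b i A.
Proof. by move=> mA; have /densitiesP[+ _] := bd i; exact. Qed.

Let bT i : b i setT = 1.
Proof. by have /densitiesP[] := bd i. Qed.

Let b_le1 i A : measurable A -> b i A <= 1.
Proof. by move=> mA; rewrite -(bT i); apply: L1_int_mono. Qed.

Let bU i A B : measurable A -> measurable B -> A `&` B = set0 ->
  b i (A `|` B) = b i A + b i B.
Proof. by move=> mA mB AB; apply: L1_int_setU => //; apply/disj_setPS; rewrite AB. Qed.

Let bg i A : measurable A -> b i (g @^-1` A) = b i.+1 A.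
Proof. by move=> mA; rewrite /b -PF_int. Qed.

Let a_le n A c : (forall i, b i A <= c) -> a n A <= c.
Proof.
move=> bc; rewrite /a mulrC ler_pdivrMr// mulr_natr -[X in _ *+ X]card_ord -sumr_const.
by apply: ler_sum => i _; exact: bc.
Qed.

Let a_ge0 n A : measurable A -> 0 <= a n A.
Proof. by move=> mA; rewrite mulr_ge0// sumr_ge0// => i _; exact: b_ge0. Qed.

Let PU : ProperFilter U := ultra_proper.

Let nu A := lim (a n A @[n --> U]).

Let nuP A : measurable A -> a n A @[n --> U] --> nu A.
Proof.
move=> mA; have [|l al] := @ultra_bounded_cvg R nat U (a^~ A) 1 UU; last first.
  by apply/cvg_ex; exists l.
apply: filterS (@filterT _ U _) => n _; rewrite ger0_norm ?a_ge0//.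
by apply: a_le => i; exact: b_le1.
Qed.

Let nu_le A c : measurable A -> (forall i, b i A <= c) -> nu A <= c.
Proof.
move=> mA bc; apply: limr_le; first by apply/cvg_ex; exists (nu A); exact: nuP.
by apply: filterS (@filterT _ U _) => n _; exact: a_le.
Qed.

Let nu_ge0 A : measurable A -> 0 <= nu A.
Proof.
move=> mA; apply: limr_ge; first by apply/cvg_ex; exists (nu A); exact: nuP.
by apply: filterS (@filterT _ U _) => n _; exact: a_ge0.
Qed.

Let nu_T : nu setT = 1.
Proof.
rewrite /nu (_ : a^~ setT = fun=> 1); first exact: lim_cst.
apply/funext => n; rewrite /a; under eq_bigr do rewrite bT.
by rewrite sumr_const card_ord mulVf.
Qed.

Let nu_setU A B : measurable A -> measurable B -> A `&` B = set0 ->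
  nu (A `|` B) = nu A + nu B.
Proof.
move=> mA mB AB; apply/cvg_lim => //.
have -> : a^~ (A `|` B) = (fun n => a n A + a n B).
  apply/funext => n; rewrite /a -mulrDr -big_split/=; congr (_ * _).
  by apply: eq_bigr => i _; exact: bU.
by apply: cvgD; exact: nuP.
Qed.

Let nu_null A : measurable A -> (forall i, b i A = 0) -> nu A = 0.
Proof.
move=> mA b0; apply/eqP; rewrite eq_le nu_ge0// andbT.
by apply: nu_le => // i; rewrite b0.
Qed.

(** The difference of the two sums telescopes to [b n.+1 A - b 0 A], at most 1 in absolute value, so
    the means differ by at most [1 / (n + 1)]. [U] refines the filter at infinity, hence inherits
    this limit. *)
Let nu_g A : measurable A -> nu (g @^-1` A) = nu A.
Proof.
move=> mA; apply/eqP; rewrite -subr_eq0; apply/eqP.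
have mgA : measurable (g @^-1` A) by exact: (measurable_ns_preimage gns).
have h1 : (a n (g @^-1` A) - a n A) @[n --> U] --> nu (g @^-1` A) - nu A.
  by apply: cvgB; exact: nuP.
have h2 : (a n (g @^-1` A) - a n A) @[n --> U] --> (0 : R).
  apply: (@cvg_trans _ ((a n (g @^-1` A) - a n A) @[n --> \oo])).
    by move=> P; exact: infU.
  apply: (@squeeze_cvgr _ _ _ _ (fun n => - n.+1%:R^-1) (fun n => n.+1%:R^-1)); last 2 first.
  - by rewrite -oppr0; apply: cvgN; exact: cvg_harmonic.
  - exact: cvg_harmonic.
  apply: nearW => n; rewrite -ler_norml /a -mulrBr normrM ger0_norm//.
  rewrite ler_piMr// -sumrB.
  have -> : \sum_(i < n.+1) (b i (g @^-1` A) - b i A) = b n.+1 A - b 0%N A.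
    under eq_bigr do rewrite bg//.
    by rewrite -(big_mkord xpredT (fun i => b i.+1 A - b i A)) telescope_sumr.
  have := b_ge0 n.+1 mA; have := b_le1 n.+1 mA; have := b_ge0 0%N mA; have := b_le1 0%N mA.
  by move: (b _ _) (b _ _) => u v; rewrite ler_norml; lra.
exact: cvg_unique h1 h2.
Qed.

(** A limit along [U] is a priori only finitely additive; the missing tail [nu (B n)] is small
    because the tail integrals are small uniformly along the orbit. *)
Let nu_sigma (F : (set T)^nat) : (forall i, measurable (F i)) ->
  trivIset setT F -> \sum_(0 <= i < n) nu (F i) @[n --> \oo] --> nu (\bigcup_k F k).
Proof.
move=> mF tF; pose B n := \bigcup_(k in [set k | (n <= k)%N]) F k.
have mB n : measurable (B n) by exact: bigcup_measurable.
have nuB n : nu (B 0%N) = \sum_(0 <= i < n) nu (F i) + nu (B n).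
  elim: n => [|n ->]; first by rewrite big_nil add0r.
  rewrite big_nat_recr//= -addrA; congr (_ + _); rewrite -nu_setU//.
    congr nu; apply/seteqP; split=> t.
      move=> [k /= nk Fkt]; have [kn|kn] := eqVneq k n; first by left; rewrite -kn.
      by right; exists k => //=; rewrite ltn_neqAle eq_sym kn.
    by case=> [Fnt|[k /= nk Fkt]]; [exists n => /=|exists k => //=; exact: ltnW].
  apply/seteqP; split=> // t [Fnt [k /= nk Fkt]].
  have := tF n k I I (ex_intro _ t (conj Fnt Fkt)) => nkE.
  by rewrite nkE ltnn in nk.
have B0 : \bigcup_k F k = B 0%N by apply: eq_bigcupl; split.
rewrite B0; apply/cvgrPdist_le => e e0.
have [k hk] : exists k, forall x,
    [set iter n (PF g) phi | n in [set n | (1 <= n)%N]] x -> L1_int (B k) x < e.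
  apply: weakly_precompact_tail => //.
  - by move=> _ [n _ <-]; exact: PF_iter_densities.
  - by move=> i j ij t [k /= jk Fkt]; exists k => //=; exact: leq_trans jk.
  - apply/seteqP; split=> // t Bt; have [k _ Fkt] := Bt 0%N I.
    have [l /= kl Flt] := Bt k.+1 I.
    have := tF k l I I (ex_intro _ t (conj Fkt Flt)) => klE.
    by rewrite klE ltnn in kl.
exists k => // n /= kn; rewrite (nuB n) addrAC subrr add0r ger0_norm ?nu_ge0//.
apply: nu_le => // i; apply: (@le_trans _ _ (b i (B k))).
  by apply: L1_int_mono => // t [l /= nl Flt]; exists l => //=; exact: leq_trans nl.
by apply/ltW/hk; exists i.+1.
Qed.

(** The last clause controls the support: it keeps the invariant density obtained from a start on
    [X_-] inside [X_-]. *)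
Lemma invariant_density_along : exists H : L1 m, [/\ densities H, PF g H = H &
  forall A, measurable A -> (forall i, L1_int A (iter i.+1 (PF g) phi) = 0) ->
    L1_int A H = 0].
Proof.
have [|H HE] := L1_Radon_Nikodym (m := m) nu_sigma.
  by move=> A mA A0; apply: nu_null => // i; exact: L1_int_null.
exists H; split.
- by apply/densitiesP; split=> [A mA|]; rewrite HE// nu_ge0.
- apply: PF_eq => // A mA; rewrite !HE ?nu_g//; exact: (measurable_ns_preimage gns).
- by move=> A mA b0; rewrite HE// nu_null.
Qed.

End invariant_density.

Lemma WAP_invariant_density d (T : measurableType d) (R : realType)
    (m : probability T R) (g : T -> T) (phi : L1 m) :
  nonsingular m g -> densities phi -> propWAP (PF (m := m) g) ->
  exists H : L1 m, [/\ densities H, PF g H = H &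
    forall A, measurable A -> (forall i, L1_int A (iter i.+1 (PF g) phi) = 0) ->
      L1_int A H = 0].
Proof.
move=> gns dphi wap; have [U [UU infU]] := ultraFilterLemma (eventually_filter).
exact: (invariant_density_along gns dphi (wap phi) UU infU).
Qed.

Lemma mnormalizeE d (T : measurableType d) (R : realType)
    (mu : {measure set T -> \bar R}) (P : probability T R) (A : set T) :
  (0 < mu setT)%E -> mu setT \is a fin_num ->
  mnormalize mu P A = (mu A * (fine (mu setT))^-1%:E)%E.
Proof.
by move=> m0 mfin; rewrite /mnormalize gt_eqF//=; case: (mu setT) mfin.
Qed.

(** * Measurable subspaces and splittings *)

Section msub_lemmas.
Context d (T : measurableType d) (X : msubset T).

Lemma measurable_msub_val : measurable_fun setT (@msub_val _ _ X).
Proof.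
move=> _ B mB; rewrite setTI.
have E : @msub_val _ _ X @` (@msub_val _ _ X @^-1` B) = (X : set T) `&` B.
  apply/seteqP; split=> [_ [x Bx <-]|t [Xt Bt]].
    by split => //; exact: set_mem (svalP x).
  by exists (msub_mk Xt).
rewrite /measurable/= /msub_measurable/= E; apply: measurableI => //.
exact: msubset_measurable.
Qed.

Lemma msub_val_in (x : msub X) : (X : set T) (msub_val x).
Proof. exact: set_mem (svalP x). Qed.

Lemma measurable_msub_image A : measurable A -> measurable (@msub_val _ _ X @` A).
Proof. by []. Qed.

Lemma msub_val_preimage_image A : @msub_val _ _ X @^-1` (@msub_val _ _ X @` A) = A.
Proof.
by apply/seteqP; split=> [x [y Ay /msub_val_inj <-]|x Ax]; [|exists x].
Qed.

Lemma measurable_to_msub d' (S : measurableType d') (f : S -> msub X) :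
  measurable_fun setT (@msub_val _ _ X \o f) -> measurable_fun setT f.
Proof.
move=> mf _ A mA; have := mf measurableT _ (measurable_msub_image mA).
by rewrite comp_preimage msub_val_preimage_image.
Qed.

(** A total measurable left inverse of the inclusion. The arbitrary value outside [X] is harmless:
    the element of L1 that gets transferred by it has zero integral over every set outside [X]. *)
Definition msub_retract (t : T) : msub X :=
  if pselect ((X : set T) t) is left Xt then msub_mk Xt else point.

Lemma msub_retractK x : msub_retract (msub_val x) = x.
Proof.
rewrite /msub_retract; case: pselect => [Xx|]; last by have := msub_val_in x.
exact: msub_val_inj.
Qed.

Lemma msub_val_retract t : (X : set T) t -> msub_val (msub_retract t) = t.
Proof. by move=> Xt; have <- : msub_val (msub_mk Xt) = t by []; rewrite msub_retractK. Qed.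

Lemma msub_retract_preimage B :
  msub_retract @^-1` B `&` X = @msub_val _ _ X @` B.
Proof.
apply/seteqP; split=> [t [/= Bt Xt]|_ [x Bx <-]].
  by exists (msub_retract t) => //; exact: msub_val_retract.
by split; [rewrite /= msub_retractK|exact: msub_val_in].
Qed.

Lemma measurable_msub_retract : measurable_fun setT msub_retract.
Proof.
move=> _ B mB; rewrite setTI -(setUIDK (msub_retract @^-1` B) X) msub_retract_preimage.
apply: measurableU => //.
have [Bp|nBp] := pselect (B point).
  rewrite (_ : _ `\` _ = ~` X); first exact/measurableC/msubset_measurable.
  apply/seteqP; split=> [t []//|t Xt]; split=> //=.
  by rewrite /msub_retract; case: pselect.
rewrite (_ : _ `\` _ = set0)//; apply/seteqP; split=> // t [/= + Xt].
by rewrite /msub_retract; case: pselect.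
Qed.

Lemma measurable_msub_map (g : T -> T) (gX : g @` X `<=` X) :
  measurable_fun setT g -> measurable_fun setT (msub_map gX).
Proof.
move=> mg; apply: measurable_to_msub.
rewrite (_ : _ \o _ = g \o @msub_val _ _ X)//.
by apply: measurableT_comp => //; exact: measurable_msub_val.
Qed.

Context (R : realType) (m : probability T R).
Hypothesis X0 : (0 < m X)%E.

Lemma normalized_restrictionE A :
  normalized_restriction m X A = (m (@msub_val _ _ X @` A) * (fine (m X))^-1%:E)%E.
Proof.
have E : msub_measure m X setT = m X by rewrite /msub_measure msub_val_image_setT.
have E0 : (0 < msub_measure m X setT)%E by rewrite E.
have Efin : msub_measure m X setT \is a fin_num.
  by rewrite E; apply: fin_num_measure; exact: msubset_measurable.
rewrite /normalized_restriction mnormalizeE; [|exact: E0|exact: Efin].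
by congr (_ * (fine _)^-1%:E)%E; exact: E.
Qed.

Lemma normalized_restriction_eq0 A : measurable A ->
  normalized_restriction m X A = 0%E <-> m (@msub_val _ _ X @` A) = 0%E.
Proof.
move=> mA; rewrite normalized_restrictionE; split=> [/eqP|->]; last by rewrite mul0e.
rewrite mule_eq0 => /orP[/eqP//|]; rewrite eqe invr_eq0 gt_eqF//.
by apply: fine_measure_gt0 => //; exact: msubset_measurable.
Qed.

(** Seen in [T], the preimage of a null set under the restricted map lies in its preimage under
    [g]. *)
Lemma nonsingular_msub_map (g : T -> T) (gX : g @` X `<=` X) :
  nonsingular m g -> nonsingular (normalized_restriction m X) (msub_map gX).
Proof.
move=> gns; split; first by apply: measurable_msub_map; case: gns.
move=> A mA /normalized_restriction_eq0 => /(_ mA) A0.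
have mgA : measurable (msub_map gX @^-1` A).
  rewrite -[X in measurable X]setTI; apply: measurable_msub_map => //.
  by case: gns.
apply/normalized_restriction_eq0 => //.
apply/eqP; rewrite -measure_le0; have [_ /(_ _ mA A0) <-] := gns.
apply: le_measure; rewrite ?inE//.
  exact: (measurable_ns_preimage gns).
by move=> _ [x Ax <-]; exists (msub_map gX x).
Qed.

End msub_lemmas.

Section splitting.
Context (R : realType) d (X : measurableType d) (m : probability X R).
Variables (g : X -> X) (Xm Xp : msubset X).
Hypotheses (gXm : g @` Xm `<=` Xm) (gXp : g @` Xp `<=` Xp).
Hypothesis gns : nonsingular m g.
Hypotheses (XU : (Xm : set X) `|` Xp = setT) (XI : (Xm : set X) `&` Xp = set0).
Hypotheses (Xm0 : (0 < m Xm)%E) (Xp0 : (0 < m Xp)%E).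

(** The inclusion intertwines the restricted map with [g], and null sets of [m] have null trace on
    [Xp]; so the pushforward of [h] by the inclusion exists and is invariant. *)
Lemma propS_extend : propS (PF (m := normalized_restriction m Xp) (msub_map gXp)) ->
  propS (PF (m := m) g).
Proof.
move=> [h dh hE]; have pns := nonsingular_msub_map Xp0 gXp gns.
have mv := @measurable_msub_val _ _ Xp.
have mpre B : measurable B -> measurable (@msub_val _ _ Xp @^-1` B).
  by move=> mB; rewrite -[X in measurable X]setTI; exact: mv.
have [B mB B0|y yE] := @L1_transfer _ _ _ _ _ (normalized_restriction m Xp) m _ h mv.
  apply: L1_int_null; first exact: mpre.
  apply/normalized_restriction_eq0 => //; first exact: mpre.
  apply/eqP; rewrite -measure_le0 -B0; apply: le_measure; rewrite ?inE//.
    exact/measurable_msub_image/mpre.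
  by move=> _ [x Bx <-].
exists y; last first.
  apply: PF_eq => // A mA; rewrite yE// yE; last exact: (measurable_ns_preimage gns).
  by rewrite -{1}hE (PF_int pns)//; exact: mpre.
move/densitiesP : dh => [h0 h1]; apply/densitiesP; split=> [A mA|].
  by rewrite yE// h0//; exact: mpre.
by rewrite yE.
Qed.

Lemma WAP_propS_restrict : propWAP (PF (m := m) g) ->
  propS (PF (m := normalized_restriction m Xm) (msub_map gXm)).
Proof.
move=> wap; have mns := nonsingular_msub_map Xm0 gXm gns.
have mXm : measurable (Xm : set X) by exact: msubset_measurable.
have mXp : measurable (Xp : set X) by exact: msubset_measurable.
have XpC : (Xp : set X) = ~` Xm.
  apply/seteqP; split=> t.
    by move=> pt mt; have : ((Xm : set X) `&` Xp) t by []; rewrite XI.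
  move=> mt; have : ((Xm : set X) `|` Xp) t by rewrite XU.
  by case.
have [H [dH HE H0]] := WAP_invariant_density gns (uniform_density_density mXm Xm0) wap.
(* [Xm] is mapped into itself, so none of its points ever reaches [Xp] and the orbit never charges
   [Xp]. *)
have Hp : L1_int Xp H = 0.
  apply: H0 => // i; rewrite (PF_iter_int gns)// L1_int_uniform//; last first.
    exact: (measurable_iter_preimage gns).
  rewrite (_ : _ `&` _ = set0) ?measure0 ?mul0r//.
  apply/seteqP; split=> // t [mt]; rewrite XpC; apply.
  by elim: i.+1 => //= j ih; apply: gXm; exists (iter j g t).
(* Hence [H] only sees traces on [Xm], and the values of the retraction elsewhere do not matter. *)
have HI A : measurable A -> L1_int A H = L1_int (A `&` Xm) H.
  move=> mA; rewrite -[in LHS](setUIDK A Xm) L1_int_setU.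
  - rewrite [X in _ + X](_ : _ = 0) ?addr0//; apply/eqP; rewrite eq_le.
    have mD : measurable (A `\` Xm) by exact: measurableD.
    have [Hge0 _] := (densitiesP H).1 dH.
    rewrite Hge0// andbT -Hp; apply: L1_int_mono => //.
    by rewrite XpC => t [].
  - exact: measurableI.
  - exact: measurableD.
  - by apply/disj_setPS => t [[_ +] [_]].
have mr := @measurable_msub_retract _ _ Xm.
have mpre B : measurable B -> measurable (@msub_retract _ _ Xm @^-1` B).
  by move=> mB; rewrite -[X in measurable X]setTI; exact: mr.
have [B mB B0|y yE] := @L1_transfer _ _ _ _ _ m (normalized_restriction m Xm) _ H mr.
  rewrite HI; last exact: mpre.
  rewrite msub_retract_preimage; apply: L1_int_null => //.
  exact/normalized_restriction_eq0.
exists y.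
  move/densitiesP : dH => [h0 h1]; apply/densitiesP; split=> [A mA|].
    by rewrite yE// h0//; exact: mpre.
  by rewrite yE.
apply: PF_eq => // B mB; rewrite yE// yE; last exact: (measurable_ns_preimage mns).
rewrite -{1}HE (PF_int gns); last exact: mpre.
have mg A : measurable A -> measurable (g @^-1` A) by exact: (measurable_ns_preimage gns).
rewrite (HI (g @^-1` (msub_retract Xm @^-1` B)) (mg _ (mpre _ mB))).
rewrite (HI (msub_retract Xm @^-1` (msub_map gXm @^-1` B)) (mpre _ (measurable_ns_preimage mns mB))).
(* The retraction intertwines the two maps on [Xm]; [HI] has cut both sets down to [Xm]. *)
congr L1_int; apply/seteqP; split=> t [/= Bt mt]; split=> //; move: Bt => /=.
  have -> // : msub_retract Xm (g t) = msub_map gXm (msub_retract Xm t).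
  apply: msub_val_inj; rewrite msub_val_retract; last by apply: gXm; exists t.
  by rewrite /= msub_val_retract.
have -> // : msub_retract Xm (g t) = msub_map gXm (msub_retract Xm t).
apply: msub_val_inj; rewrite msub_val_retract; last by apply: gXm; exists t.
by rewrite /= msub_val_retract.
Qed.

End splitting.

(** Dynkin's theorem for signed integrals: the pushforward of [x] by [r] is recognized on a
    pi-system. It serves both for the invariance of measures and for changes of variables. *)
Lemma L1_int_ext_pi d1 d2 (T1 : measurableType d1) (T2 : measurableType d2)
    (R : realType) (m1 : {measure set T1 -> \bar R}) (m2 : {measure set T2 -> \bar R})
    (r : T1 -> T2) (x : L1 m1) (y : L1 m2) (G : set (set T2)) :
  measurable_fun setT r -> @measurable _ T2 = <<s G >> -> setI_closed G ->
  L1_int setT x = L1_int setT y ->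
  (forall B, G B -> L1_int (r @^-1` B) x = L1_int B y) ->
  forall B, measurable B -> L1_int (r @^-1` B) x = L1_int B y.
Proof.
move=> mr GE GI hT hG B; rewrite GE.
have mpre C : measurable C -> measurable (r @^-1` C).
  by move=> mC; rewrite -[X in measurable X]setTI; exact: mr.
apply: (@dynkin_induction _ T2 G (fun C => L1_int (r @^-1` C) x = L1_int C y) GE GI) => //.
- move=> C mC hC; have := L1_int_setC x (mpre _ mC); have := L1_int_setC y mC.
  by rewrite hT hC -preimage_setC => -> /addrI.
- move=> F mF tF hF.
  have h1 := @L1_int_sigma _ _ _ _ y F mF tF.
  have h2 : \sum_(0 <= i < n) L1_int (F i) y @[n --> \oo] -->
      L1_int (r @^-1` (\bigcup_k F k)) x.
    under eq_fun do under eq_bigr do rewrite -hF.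
    rewrite preimage_bigcup; apply: L1_int_sigma => [i|]; first exact: mpre.
    exact: trivIset_preimage.
  exact: cvg_unique h2 h1.
Qed.

Lemma fine_probability_setC d (T : measurableType d) (R : realType)
    (m : probability T R) (A : set T) : measurable A ->
  fine (m (~` A)) = 1 - fine (m A).
Proof.
move=> mA; rewrite probability_setC// fineB//; exact: fin_num_measure.
Qed.

(** * Lebesgue measure on the unit interval *)

Section real_subspaces.
Context (R : realType).
Variable X : msubset (measurableTypeR R).

Definition below (b : R) : set (msub X) := [set x : msub X | (msub_val x : R) < b].

Definition belows : set (set (msub X)) := [set below b | b in setT].

Lemma belows_setI : setI_closed belows.
Proof.
move=> _ _ [b _ <-] [c _ <-]; exists (Num.min b c) => //.
by apply/seteqP; split=> x; rewrite /below/= lt_min => /andP.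
Qed.

Lemma measurable_belows : @measurable _ (msub X) = <<s belows >>.
Proof.
have -> : belows = preimage_set_system setT (@msub_val _ _ X) (@RGenInftyO.G R).
  apply/seteqP; split=> [_ [b _ <-]|_ [_ [b ->] <-]].
    exists `]-oo, b[%classic; first by exists b.
    by rewrite setTI; apply/seteqP; split=> x; rewrite /below/= in_itv.
  exists b => //; rewrite setTI.
  by apply/seteqP; split=> x; rewrite /below/= in_itv.
rewrite g_sigma_preimageE -RGenInftyO.measurableE; apply/seteqP; split=> A.
  move=> mA; exists (@msub_val _ _ X @` A); last by rewrite setTI msub_val_preimage_image.
  exact: (measurable_msub_image mA).
move=> [B mB <-]; rewrite setTI -[X in measurable X]setTI.
exact: (@measurable_msub_val _ _ X).
Qed.

Lemma measurable_below b : measurable (below b).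
Proof. by rewrite measurable_belows; apply: sub_sigma_algebra; exists b. Qed.

Lemma measurable_above b : measurable (~` below b).
Proof. by apply: measurableC; exact: measurable_below. Qed.

(** Half-open, so that adjacent intervals concatenate without overlap. In [cc01] the interval from 0
    to 1 therefore misses the null point 1. *)
Definition between (a b : R) : set (msub X) := below b `\` below a.

Lemma measurable_between a b : measurable (between a b).
Proof. by apply: measurableD; exact: measurable_below. Qed.

End real_subspaces.
Arguments below {R} X b.
Arguments between {R} X a b.
Arguments belows {R} X.

Section lebesgue_unit_interval.
Context (R : realType).
Notation lc := (@leb_cc01 R).
Notation lo := (@leb_co01 R).

Lemma cc01_ge0 (x : msub (cc01 R)) : 0 <= (msub_val x : R).
Proof. by have := msub_val_in x; rewrite /= in_itv/= => /andP[]. Qed.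

Lemma cc01_le1 (x : msub (cc01 R)) : (msub_val x : R) <= 1.
Proof. by have := msub_val_in x; rewrite /= in_itv/= => /andP[]. Qed.

Lemma co01_ge0 (x : msub (co01 R)) : 0 <= (msub_val x : R).
Proof. by have := msub_val_in x; rewrite /= in_itv/= => /andP[]. Qed.

Lemma co01_lt1 (x : msub (co01 R)) : (msub_val x : R) < 1.
Proof. by have := msub_val_in x; rewrite /= in_itv/= => /andP[]. Qed.

Lemma leb_cc01_between (a b : R) : 0 <= a -> a <= b -> b <= 1 ->
  fine (lc (between (cc01 R) a b)) = b - a.
Proof.
move=> a0 ab b1; rewrite /leb_cc01 /msub_measure.
have -> : @msub_val _ _ (cc01 R) @` between (cc01 R) a b = `[a, b[%classic.
  apply/seteqP; split=> [_ [x [/= xb /negP xa] <-]|t /=].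
    by rewrite in_itv/=; apply/andP; split; [rewrite leNgt|exact: xb].
  rewrite in_itv/= => /andP[at_ tb].
  have t01 : (cc01 R : set R) t by rewrite /= in_itv/=; apply/andP; split; lra.
  by exists (msub_mk t01) => //; split=> //=; apply/negP; rewrite -leNgt.
rewrite /= lebesgue_measure_itv/= lte_fin; case: ltP => //= ba.
by apply/esym/eqP; rewrite subr_eq0 eq_le ba ab.
Qed.

Lemma leb_co01_between (a b : R) : 0 <= a -> a <= b -> b <= 1 ->
  fine (lo (between (co01 R) a b)) = b - a.
Proof.
move=> a0 ab b1; rewrite /leb_co01 /msub_measure.
have -> : @msub_val _ _ (co01 R) @` between (co01 R) a b = `[a, b[%classic.
  apply/seteqP; split=> [_ [x [/= xb /negP xa] <-]|t /=].
    by rewrite in_itv/=; apply/andP; split; [rewrite leNgt|exact: xb].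
  rewrite in_itv/= => /andP[at_ tb].
  have t01 : (co01 R : set R) t by rewrite /= in_itv/=; apply/andP; split; lra.
  by exists (msub_mk t01) => //; split=> //=; apply/negP; rewrite -leNgt.
rewrite /= lebesgue_measure_itv/= lte_fin; case: ltP => //= ba.
by apply/esym/eqP; rewrite subr_eq0 eq_le ba ab.
Qed.

Lemma below_ge1 (b : R) : 1 < b -> below (cc01 R) b = setT.
Proof.
move=> b1; apply/seteqP; split=> // x _.
by rewrite /below/=; exact: le_lt_trans (cc01_le1 x) b1.
Qed.

Lemma below_cc01_le0 (b : R) : b <= 0 -> below (cc01 R) b = set0.
Proof.
move=> b0; apply/seteqP; split=> // x; rewrite /below/= ltNge.
by rewrite (le_trans b0 (cc01_ge0 x)).
Qed.

Lemma below_co01_le0 (b : R) : b <= 0 -> below (co01 R) b = set0.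
Proof.
move=> b0; apply/seteqP; split=> // x; rewrite /below/= ltNge.
by rewrite (le_trans b0 (co01_ge0 x)).
Qed.

Lemma below_co01_ge1 (b : R) : 1 <= b -> below (co01 R) b = setT.
Proof.
move=> b1; apply/seteqP; split=> // x _.
by rewrite /below/=; exact: lt_le_trans (co01_lt1 x) b1.
Qed.

Lemma leb_cc01_below (b : R) : 0 <= b -> b <= 1 -> fine (lc (below (cc01 R) b)) = b.
Proof.
move=> b0 b1; rewrite -[RHS]subr0 -leb_cc01_between//; congr (fine (lc _)).
by rewrite /between (below_cc01_le0 (lexx 0)) setD0.
Qed.

Lemma leb_co01_below (b : R) : 0 <= b -> b <= 1 -> fine (lo (below (co01 R) b)) = b.
Proof.
move=> b0 b1; rewrite -[RHS]subr0 -leb_co01_between//; congr (fine (lo _)).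
by rewrite /between (below_co01_le0 (lexx 0)) setD0.
Qed.

Lemma leb_cc01_divisible (delta : R) : 0 < delta -> exists F : (set (msub (cc01 R)))^nat,
  [/\ forall k, measurable (F k), forall k, (lc (F k) < delta%:E)%E &
      \bigcup_k F k = setT].
Proof.
move=> d0; have [N hN] : exists N : nat, (N.+1%:R^-1 : R) < delta.
  by have [N] := ltr_add_invr d0; rewrite add0r => h; exists N.
have N0 : 0 < (N.+1%:R : R) by rewrite ltr0n.
(* The half-open cells miss the point 1; every index beyond [N] supplies the null set made of that
   point. *)
pose F (k : nat) := if (k <= N)%N then
  between (cc01 R) (k%:R / N.+1%:R) (k.+1%:R / N.+1%:R)
  else ~` below (cc01 R) 1.
exists F.
have mF k : measurable (F k).
  by rewrite /F; case: ifP => _; [exact: measurable_between|exact: measurable_above].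
split=> //.
- move=> k; rewrite -(fineK (fin_num_measure lc _ (mF k))) lte_fin /F; case: leqP => kN.
    rewrite leb_cc01_between ?divr_ge0//.
    + by rewrite -mulrBl -natrB// subSnn mul1r.
    + by rewrite ler_pM2r ?invr_gt0// ler_nat.
    + by rewrite ler_pdivrMr// mul1r ler_nat.
  suff -> : fine (lc (~` below (cc01 R) 1)) = 0 by [].
  have := fine_probability_setC lc (measurable_below (cc01 R) 1).
  by rewrite leb_cc01_below// subrr.
- apply/seteqP; split=> // x _.
  have [x1|x1] := ltP (msub_val x : R) 1; last first.
    by exists N.+1 => //; rewrite /F ltnn/= /below/=; apply/negP; rewrite -leNgt.
  have x0 : 0 <= (msub_val x : R) * N.+1%:R by rewrite mulr_ge0// cc01_ge0.
  have /andP[h1 h2] := truncn_itv x0.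
  have kN : (Num.truncn ((msub_val x : R) * N.+1%:R) <= N)%N.
    rewrite -ltnS -(ltr_nat R); apply: le_lt_trans h1 _.
    by rewrite gtr_pMl.
  exists (Num.truncn ((msub_val x : R) * N.+1%:R)) => //; rewrite /F kN.
  split; rewrite /below/=; first by rewrite ltr_pdivlMr.
  by apply/negP; rewrite -leNgt ler_pdivrMr.
Qed.

End lebesgue_unit_interval.

(** * Rotations *)

Section fractional_parts.
Context (R : realType).
Implicit Types (s t : R) (n : int).

Lemma frac_partE t n : 0 <= t - n%:~R -> t - n%:~R < 1 -> frac_part t = t - n%:~R.
Proof.
move=> h0 h1; rewrite /frac_part; congr (_ - _%:~R); apply: floor_def.
by rewrite intrD; apply/andP; split; lra.
Qed.

Lemma frac_part_ge0 t : 0 <= frac_part t.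
Proof. by have := frac_part_in t; rewrite /= in_itv/= => /andP[]. Qed.

Lemma frac_part_lt1 t : frac_part t < 1.
Proof. by have := frac_part_in t; rewrite /= in_itv/= => /andP[]. Qed.

Lemma frac_part_id t : 0 <= t -> t < 1 -> frac_part t = t.
Proof. by move=> t0 t1; rewrite (@frac_partE t 0) ?subr0. Qed.

Lemma frac_partDint t n : frac_part (t + n%:~R) = frac_part t.
Proof.
have h0 := frac_part_ge0 t; have h1 := frac_part_lt1 t.
have E : t + n%:~R - (n + Num.floor t)%:~R = frac_part t.
  by rewrite intrD /frac_part; lra.
by rewrite (@frac_partE _ (n + Num.floor t)) E.
Qed.

Lemma frac_partDl s t : frac_part (frac_part s + t) = frac_part (s + t).
Proof.
rewrite /frac_part -[X in X = _]/(frac_part _).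
have -> : s - (Num.floor s)%:~R + t = s + t + (- Num.floor s)%:~R.
  by rewrite intrN addrAC.
exact: frac_partDint.
Qed.

Lemma frac_partD t (a : R) : 0 <= t -> t < 1 ->
  frac_part (t + a) = if t + frac_part a < 1 then t + frac_part a else t + frac_part a - 1.
Proof.
move=> t0 t1; rewrite addrC -frac_partDl addrC.
have a0 := frac_part_ge0 a; have a1 := frac_part_lt1 a.
have [h|h] := ltP (t + frac_part a) 1.
  by rewrite frac_part_id//; lra.
by rewrite (@frac_partE _ 1)//; lra.
Qed.

End fractional_parts.

Section rotation_basics.
Context (R : realType).
Notation lo := (@leb_co01 R).
Notation X := (msub (co01 R)).
Implicit Types (alpha beta : R) (x : X).

Lemma rotationE alpha x : msub_val (rotation alpha x) = frac_part ((msub_val x : R) + alpha).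
Proof. by []. Qed.

Lemma rotation_eq alpha x (y : X) :
  frac_part ((msub_val x : R) + alpha) = (msub_val y : R) ->
  rotation alpha x = y.
Proof. by move=> h; apply: msub_val_inj. Qed.

Lemma rotation_comp alpha beta x :
  rotation alpha (rotation beta x) = rotation (alpha + beta) x.
Proof.
by apply: msub_val_inj; rewrite !rotationE frac_partDl -addrA (addrC beta).
Qed.

Lemma rotation_int (n : int) x : rotation n%:~R x = x.
Proof.
by apply: rotation_eq; rewrite frac_partDint frac_part_id ?co01_ge0 ?co01_lt1.
Qed.

Lemma rotationK alpha x : rotation (- alpha) (rotation alpha x) = x.
Proof. by rewrite rotation_comp addNr (rotation_int 0). Qed.

Lemma iter_rotation alpha n x : iter n (rotation alpha) x = rotation (n%:R * alpha) x.
Proof.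
elim: n => [|n /= ->]; first by rewrite mul0r (rotation_int 0).
by rewrite rotation_comp -nat1r mulrDl mul1r.
Qed.

Lemma measurable_rotation alpha : measurable_fun setT (rotation alpha).
Proof.
apply: measurable_to_msub.
pose a : R := frac_part alpha.
have mv : measurable_fun setT (fun x : X => (msub_val x : R)).
  exact: (@measurable_msub_val _ _ (co01 R)).
rewrite (_ : _ \o _ = fun x : X => if (msub_val x : R) + a < 1 then (msub_val x : R) + a else (msub_val x : R) + a - 1).
  apply: measurable_fun_ifT.
  - by apply: measurable_fun_ltr => //; apply: measurable_funD.
  - exact: measurable_funD.
  - by apply: measurable_funB => //; exact: measurable_funD.
by apply/funext => x /=; rewrite frac_partD ?co01_ge0 ?co01_lt1.
Qed.

Lemma leb_rotation alpha A : measurable A -> lo (rotation alpha @^-1` A) = lo A.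
Proof.
move=> mA; have mr := @measurable_rotation alpha.
have mpre B : measurable B -> measurable (rotation alpha @^-1` B).
  by move=> mB; rewrite -[X in measurable X]setTI; exact: mr.
rewrite -(fineK (fin_num_measure lo _ (mpre _ mA))) -[RHS](fineK (fin_num_measure lo _ mA)).
congr EFin; rewrite -[in LHS](setTI (_ @^-1` _)) -[in RHS](setTI A) -!L1_int_indic//; last first.
  exact: mpre.
apply: (L1_int_ext_pi mr (measurable_belows (co01 R)) (@belows_setI _ _)) => //.
move=> _ [b _ <-]; rewrite !L1_int_indic//; last 2 first.
- exact: measurable_below.
- by apply: mpre; exact: measurable_below.
rewrite !setTI.
have [b0|b0] := leP b 0; first by rewrite (below_co01_le0 b0) preimage_set0.
have [b1|b1] := leP 1 b; first by rewrite (below_co01_ge1 b1) preimage_setT.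
rewrite leb_co01_below ?(ltW b0) ?(ltW b1)//.
pose a : R := frac_part alpha.
have a0 : 0 <= a := frac_part_ge0 _; have a1 : a < 1 := frac_part_lt1 _.
have rE x : (msub_val (rotation alpha x) : R) =
    if (msub_val x : R) + a < 1 then (msub_val x : R) + a else (msub_val x : R) + a - 1.
  by rewrite rotationE frac_partD ?co01_ge0 ?co01_lt1.
(* The preimage of [[0, b[] is the single arc [[1 - a, 1 - a + b[] when [b <= a]; otherwise it wraps
   around 0 as [[0, b - a[] and [[1 - a, 1[]. *)
have [ba|ab] := leP b a.
  rewrite (_ : rotation alpha @^-1` _ = between (co01 R) (1 - a) (1 - a + b)).
    by rewrite leb_co01_between; lra.
  apply/seteqP; split=> x; rewrite /preimage /between /setD /below /mkset rE;
    have x0 := co01_ge0 x; have x1 := co01_lt1 x.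
    case: (ltP ((msub_val x : R) + a) 1) => h1 h2; first by exfalso; lra.
    by split; [lra|apply/negP; rewrite -leNgt; lra].
  by move=> [h1 /negP]; rewrite -leNgt => h2; case: (ltP ((msub_val x : R) + a) 1); lra.
rewrite (_ : rotation alpha @^-1` _ =
    below (co01 R) (b - a) `|` between (co01 R) (1 - a) 1).
  rewrite fine_measureU; last 3 first.
  - exact: measurable_below.
  - exact: measurable_between.
  - by apply/seteqP; split=> // x [h1 [_ h2]]; apply: h2; rewrite /below/= in h1 *; lra.
  by rewrite leb_co01_below ?leb_co01_between; lra.
apply/seteqP; split=> x; rewrite /preimage /between /setD /below /mkset rE;
    have x0 := co01_ge0 x; have x1 := co01_lt1 x.
  case: (ltP ((msub_val x : R) + a) 1) => h1 h2; first by left; lra.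
  by right; split=> //; apply/negP; rewrite -leNgt; lra.
by case=> [h1|[_ /negP]]; rewrite -?leNgt; case: (ltP ((msub_val x : R) + a) 1); lra.
Qed.

Lemma nonsingular_rotation alpha : nonsingular lo (rotation alpha).
Proof.
split; [exact: measurable_rotation|move=> A mA <-; exact: leb_rotation].
Qed.

End rotation_basics.

(** Dirichlet's pigeonhole gives [q * alpha = delta + p] with [0 < |delta| < 1 / M]; the multiples
    of [q * alpha] then move around the circle by steps too short to jump over []a, b[]. *)
Lemma irrational_frac_dense (R : realType) (alpha a b : R) (N : nat) :
  irrational alpha -> 0 < a -> a < b -> b < 1 ->
  exists2 k, (N <= k)%N & a < frac_part (k%:R * alpha) < b.
Proof.
move=> ialpha a0 ab b1.
(* The first term makes a step shorter than [b - a]; the other two force more than [N] steps before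
   []a, b[] is reached, upwards from 0 or downwards from 1. *)
have [M hM] : exists M : nat, (b - a)^-1 + N%:R / a + N%:R / (1 - b) < M%:R.
  by eexists; exact: truncnS_gt.
have b10 : 0 < 1 - b by lra.
have ba0 : 0 < b - a by lra.
have p1 : 0 < (b - a)^-1 by rewrite invr_gt0.
have p2 : 0 <= N%:R / a by rewrite divr_ge0// ltW.
have p3 : 0 <= N%:R / (1 - b) by rewrite divr_ge0// ltW.
have M0 : 0 < (M%:R : R) by lra.
have hba : M%:R^-1 < b - a.
  by rewrite -[ltRHS]invrK ltf_pV2 ?posrE//; lra.
have hNa : N%:R < M%:R * a by rewrite -ltr_pdivrMr//; lra.
have hNb : N%:R < M%:R * (1 - b) by rewrite -ltr_pdivrMr//; lra.
have cell (i : 'I_M.+1) : (Num.truncn (frac_part (i%:R * alpha) * M%:R) < M)%N.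
  have h0 : 0 <= frac_part (i%:R * alpha) * M%:R.
    by rewrite mulr_ge0 ?frac_part_ge0// ltW.
  have /andP[h _] := truncn_itv h0.
  rewrite -(ltr_nat R); apply: le_lt_trans h _.
  by rewrite gtr_pMl// frac_part_lt1.
have [i [j [ij eij]]] : exists i j : 'I_M.+1, (i < j)%N /\ Ordinal (cell i) = Ordinal (cell j).
  have : ~ injective (fun i => Ordinal (cell i)) by move=> /leq_card; rewrite !card_ord ltnn.
  move=> /existsNP[i /existsNP[j /not_implyP[eij /eqP inj]]].
  have [lt|gt|/val_inj eq] := ltngtP i j.
  - by exists i, j.
  - by exists j, i.
  - by rewrite eq eqxx in inj.
pose delta : R := frac_part (j%:R * alpha) - frac_part (i%:R * alpha).
have dM : `|delta| < M%:R^-1.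
  have h0 (l : 'I_M.+1) : 0 <= frac_part (l%:R * alpha) * M%:R.
    by rewrite mulr_ge0 ?frac_part_ge0// ltW.
  have /andP[hi1 hi2] := truncn_itv (h0 i); have /andP[hj1 hj2] := truncn_itv (h0 j).
  have e : Num.truncn (frac_part (i%:R * alpha) * M%:R) =
           Num.truncn (frac_part (j%:R * alpha) * M%:R) by case: eij.
  rewrite e -natr1 in hi1 hi2; rewrite -natr1 in hj2.
  rewrite -(ltr_pM2r M0) mulVf ?gt_eqF// -[X in _ * X]ger0_norm ?(ltW M0)// -normrM mulrBl ltr_norml.
  by apply/andP; split; lra.
pose q := (j - i)%N.
have q0 : (0 < q)%N by rewrite subn_gt0.
pose p : int := Num.floor (j%:R * alpha) - Num.floor (i%:R * alpha).
have qE : q%:R * alpha = delta + p%:~R.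
  rewrite /q natrB ?(ltnW ij)// mulrBl /delta /p /frac_part intrB; lra.
have d0 : delta != 0.
  apply/eqP => d0; apply: ialpha; apply/rationalP; exists p, q.
  by rewrite -[p%:~R]add0r -d0 -qE mulrAC divff ?mul1r// pnatr_eq0 -lt0n.
have frackq k (n : int) : 0 <= k%:R * delta - n%:~R -> k%:R * delta - n%:~R < 1 ->
    frac_part ((k * q)%:R * alpha) = k%:R * delta - n%:~R.
  move=> h0 h1; rewrite natrM -mulrA qE mulrDr.
  have -> : k%:R * p%:~R = (k%:Z * p)%:~R :> R by rewrite intrM.
  by rewrite frac_partDint (frac_partE h0 h1).
have kq k : (k <= k * q)%N by rewrite leq_pmulr.
move: d0; rewrite neq_lt => /orP[d0|d0].
  (* For negative [delta] the fractional parts descend from 1, and [k] is the first index with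
     [1 - k |delta| < b]. *)
  have e0 : 0 < - delta by lra.
  have eM : - delta < M%:R^-1 by rewrite -(ltr0_norm d0).
  have h0 : 0 <= (1 - b) / - delta by rewrite divr_ge0// ltW.
  have /andP[k1 k2] := truncn_itv h0.
  set k := (Num.truncn _).+1 in k2.
  have k1' : (k%:R - 1) * - delta <= 1 - b.
    by rewrite -ler_pdivlMr// /k -natr1 addrK.
  have k2' : 1 - b < k%:R * - delta by rewrite -ltr_pdivrMr.
  exists (k * q)%N.
    apply: leq_trans (kq k); rewrite -(ler_nat R); apply: ltW; apply: lt_le_trans hNb _.
    apply: le_trans (ltW k2); rewrite mulrC ler_pM2l//.
    by rewrite -[leLHS]invrK lef_pV2 ?posrE ?invr_gt0// ltW.
  by rewrite (frackq k (-1)%Z) ?intrN; [apply/andP; split| |]; lra.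
have eM : delta < M%:R^-1 by rewrite -(gtr0_norm d0).
have h0 : 0 <= a / delta by rewrite divr_ge0// ltW.
have /andP[k1 k2] := truncn_itv h0.
set k := (Num.truncn _).+1 in k2.
have k1' : (k%:R - 1) * delta <= a.
  by rewrite -ler_pdivlMr// /k -natr1 addrK.
have k2' : a < k%:R * delta by rewrite -ltr_pdivrMr.
exists (k * q)%N.
  apply: leq_trans (kq k); rewrite -(ler_nat R); apply: ltW; apply: lt_le_trans hNa _.
  apply: le_trans (ltW k2); rewrite mulrC ler_pM2l//.
  by rewrite -[leLHS]invrK lef_pV2 ?posrE ?invr_gt0// ltW.
by rewrite (frackq k 0%Z); [apply/andP; split| |]; lra.
Qed.

(** * Cesaro means and coboundaries *)

Section cesaro_convergence.
Context d (T : measurableType d) (R : realType).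
Variables (m : probability T R) (g : T -> T).
Hypothesis gns : nonsingular m g.
Hypothesis gm : forall A, measurable A -> m (g @^-1` A) = m A.
Notation P := (PF (m := m) g).
Notation one := (L1_indic m setT).
Implicit Types x y v : L1 m.

(** The elements for which the mean ergodic theorem holds with a constant limit. They form a closed
    subspace, since Cesaro means are contractions, and it contains the constants and the
    coboundaries; for an irrational rotation this is enough to fill L1. *)
Definition cesaro_cvg x : Prop := forall e : R, 0 < e ->
  exists N : nat, forall n, (N <= n)%N -> `|cesaro_mean P n x - L1_int setT x *: one| <= e.

Lemma norm_L1_one : `|one| = 1.
Proof. by rewrite norm_L1_indic//; exact: (congr1 fine (probability_setT m)). Qed.

Lemma cesaro_meanB n x y :
  cesaro_mean P n (x - y) = cesaro_mean P n x - cesaro_mean P n y.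
Proof.
by rewrite addrC -scaleN1r (cesaro_mean_scaleD gns) scaleN1r addrC.
Qed.

Lemma cesaro_cvg_scaleD a x y : cesaro_cvg x -> cesaro_cvg y -> cesaro_cvg (a *: x + y).
Proof.
move=> Wx Wy e e0; pose e1 := e / 2 / (`|a| + 1).
have a0 : 0 < `|a| + 1 by rewrite ltr_wpDl.
have e10 : 0 < e1 by rewrite !divr_gt0.
have [N1 h1] := Wx _ e10; have [N2 h2] := Wy (e / 2) (divr_gt0 e0 (ltr0n _ 2)).
exists (maxn N1 N2) => n; rewrite geq_max => /andP[n1 n2].
rewrite (cesaro_mean_scaleD gns) L1_intD// L1_intZ// scalerDl -scalerA opprD addrACA -scalerBr.
apply: le_trans (ler_normD _ _) _; rewrite normrZ [leRHS]splitr; apply: lerD; last exact: h2.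
apply: (@le_trans _ _ ((`|a| + 1) * e1)).
  by apply: ler_pM => //; [rewrite lerDl|exact: h1].
by rewrite /e1 mulrC divfK// gt_eqF.
Qed.

Lemma cesaro_cvg_closed x :
  (forall e : R, 0 < e -> exists2 y, cesaro_cvg y & `|x - y| < e) -> cesaro_cvg x.
Proof.
move=> hx e e0; have e30 : 0 < e / 3 by rewrite divr_gt0.
have [y Wy xy] := hx _ e30; have [N hN] := Wy _ e30; exists N => n Nn.
have -> : cesaro_mean P n x - L1_int setT x *: one =
    cesaro_mean P n (x - y) + (cesaro_mean P n y - L1_int setT y *: one)
    - (L1_int setT (x - y)) *: one.
  by rewrite L1_intB// cesaro_meanB scalerBl addrA subrK opprB addrA subrK.
apply: le_trans (ler_normB _ _) _; apply: le_trans (lerD (ler_normD _ _) (lexx _)) _.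
have -> : `|L1_int setT (x - y) *: one| = `|L1_int setT (x - y)|.
  by rewrite normrZ norm_L1_one mulr1.
have := norm_cesaro_mean_le gns n (x - y); have := le_L1_int_norm (x - y) measurableT.
have := hN n Nn; lra.
Qed.

Lemma cesaro_cvg_one : cesaro_cvg one.
Proof.
have P1 : P one = one.
  apply: (PF_eq gns) => A mA; rewrite !L1_int_indic//.
    by rewrite !setTI; exact/esym/(congr1 fine (gm mA)).
  exact: (measurable_ns_preimage gns).
have Pi i : iter i P one = one by elim: i => //= i ->.
(* Starting at 1 discards the empty mean, which is 0 and not [one]. *)
move=> e e0; exists 1%N => n n1; rewrite /cesaro_mean; under eq_bigr do rewrite Pi.
rewrite sumr_const card_ord -[one *+ n]scaler_nat scalerA mulVf; last by rewrite pnatr_eq0 -lt0n.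
rewrite L1_int_indic// setTI (_ : fine _ = 1); last exact: (congr1 fine (probability_setT m)).
by rewrite subrr normr0 ltW.
Qed.

Lemma cesaro_cvg0 : cesaro_cvg 0.
Proof.
rewrite -(subrr one) addrC -scaleN1r.
by apply: cesaro_cvg_scaleD; exact: cesaro_cvg_one.
Qed.

(** The orbit sum telescopes to [iter n P v - v], of norm at most twice that of [v] whatever [n]. *)
Lemma cesaro_cvg_coboundary v : cesaro_cvg (P v - v).
Proof.
move=> e e0.
have -> : L1_int setT (P v - v) = 0.
  by rewrite L1_intB// (PF_int gns)// preimage_setT subrr.
have sumE n : \sum_(i < n) iter i P (P v - v) = iter n P v - v.
  rewrite -(big_mkord xpredT (fun i => iter i P (P v - v))).
  rewrite (eq_bigr (fun i => iter i.+1 P v - iter i P v)) ?telescope_sumr// => i _.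
  by rewrite (PF_iterB gns) -iterSr.
exists (Num.truncn (2 * `|v| / e)).+1 => n Nn; rewrite scale0r subr0 /cesaro_mean sumE.
have n0 : 0 < (n%:R : R) by rewrite ltr0n; exact: leq_trans Nn.
have h : 2 * `|v| / e <= n%:R.
  by apply: le_trans (ltW (truncnS_gt _)) _; rewrite ler_nat.
rewrite ler_pdivrMr// in h.
rewrite normrZ ger0_norm ?invr_ge0// mulrC ler_pdivrMr// [e * _]mulrC.
apply: le_trans (ler_normB _ _) _; apply: le_trans h.
by rewrite mulrC mulr_natr mulr2n lerD2r; exact: norm_PF_iter_le.
Qed.

Lemma cesaro_cvg_coboundary_iter k v : cesaro_cvg (iter k P v - v).
Proof.
elim: k => [|k ih]; first by rewrite subrr; exact: cesaro_cvg0.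
have -> : iter k.+1 P v - v = 1 *: (P (iter k P v) - iter k P v) + (iter k P v - v).
  by rewrite scale1r addrA subrK.
by apply: cesaro_cvg_scaleD => //; exact: cesaro_cvg_coboundary.
Qed.

Lemma cesaro_cvg_propMC : (forall x, cesaro_cvg x) -> propMC P.
Proof.
move=> W; exists [set one]; first exact: compact_set1.
move=> h /densitiesP[_ h1]; apply: dist_to_cvg0 => e e0.
have [N hN] := W h e e0; exists N => // n /= Nn; exists one => //.
by have := hN n Nn; rewrite h1 scale1r.
Qed.

End cesaro_convergence.

Section rotation_PF.
Context (R : realType).
Notation lo := (@leb_co01 R).
Notation X := (msub (co01 R)).
Variable alpha : R.
Notation P := (PF (m := lo) (rotation alpha)).

(** The rotation preserves [lo], so substituting the inverse rotation is a change of variables along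
    a pushforward. The upper bound gives integrability, the lower one allows the formula for
    nonnegative functions. *)
Lemma PF_rotation_mk beta (f : X -> R) M : measurable_fun setT f ->
  (forall x, 0 <= f x <= M) ->
  PF (rotation beta) (L1_mk lo f) = L1_mk lo (f \o rotation (- beta)).
Proof.
move=> mf fM; have ns := nonsingular_rotation beta.
have mr := @measurable_rotation R (- beta).
have fi : lo.-integrable setT (EFin \o f).
  apply: (@bounded_integrable _ _ _ _ _ M) => // x.
  by have /andP[f0 f1] := fM x; rewrite ger0_norm.
have mfr : measurable_fun setT (f \o rotation (- beta)) by exact: measurableT_comp.
have fri : lo.-integrable setT (EFin \o (f \o rotation (- beta))).
  apply: (@bounded_integrable _ _ _ _ _ M) => // x /=.
  by have /andP[f0 f1] := fM (rotation (- beta) x); rewrite ger0_norm.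
apply: (PF_eq ns) => A mA; rewrite !L1_int_mk//; last exact: (measurable_ns_preimage ns).
congr fine.
transitivity (\int[pushforward lo (rotation beta)]_(x in A) (f (rotation (- beta) x))%:E)%E.
  apply: eq_measure_integral; first exact: measurable_rotation.
  by move=> mr' B mB _; rewrite -[LHS](leb_rotation beta mB).
rewrite ge0_integral_pushforward//.
- by apply: eq_integral => x _ /=; rewrite rotationK.
- exact: measurable_rotation.
- by apply/measurable_EFinP; exact: measurable_funTS.
- by move=> x _; rewrite lee_fin; have /andP[] := fM (rotation (- beta) x).
Qed.

Lemma PF_rotation_iter n x : iter n P x = PF (m := lo) (rotation (n%:R * alpha)) x.
Proof.
apply/esym/(PF_eq (nonsingular_rotation _)) => A mA.
rewrite (PF_iter_int (nonsingular_rotation alpha))//; congr L1_int.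
by apply/seteqP; split=> t /=; rewrite /preimage/= iter_rotation.
Qed.

Definition co01_id (x : X) : R := msub_val x.

Lemma measurable_co01_id : measurable_fun setT co01_id.
Proof. exact: (@measurable_msub_val _ _ (co01 R)). Qed.

Lemma co01_id01 x : 0 <= co01_id x <= 1.
Proof. by rewrite co01_ge0 ltW// co01_lt1. Qed.

Lemma co01_id_rotation beta x : co01_id (rotation beta x) = frac_part (co01_id x + beta).
Proof. by []. Qed.

(* x |-> x - c + 1_(x < c) is the fractional part of x - k alpha, where c is that of
   k alpha, so indicators of [0, c[ are coboundaries up to a constant. *)
Lemma indic_rotation_coboundary k : let c := frac_part (k%:R * alpha) in
  let u := L1_mk lo co01_id in
  L1_indic lo (below (co01 R) c) = iter k P u - u + c *: L1_indic lo setT.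
Proof.
move=> c u; rewrite PF_rotation_iter (PF_rotation_mk _ measurable_co01_id co01_id01).
have c0 : 0 <= c := frac_part_ge0 _; have c1 : c < 1 := frac_part_lt1 _.
have -> : co01_id \o rotation (- (k%:R * alpha)) =
    (co01_id \+ (- c) \*: (\1_setT : X -> R)) \+ \1_(below (co01 R) c).
  apply/funext => x; rewrite [LHS]co01_id_rotation.
  have -> : ((co01_id \+ (- c) \*: (\1_setT : X -> R)) \+ \1_(below (co01 R) c)) x =
      co01_id x - c + (x \in below (co01 R) c)%:R.
    by rewrite /= !indicE in_setT [_ *: _]mulr1.
  have /andP[x0 x1] : 0 <= co01_id x < 1 by rewrite co01_ge0 co01_lt1.
  have E (n : int) : co01_id x + - (k%:R * alpha) - (n - Num.floor (k%:R * alpha))%:~R =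
      co01_id x - c - n%:~R by rewrite /c /frac_part intrB; lra.
  have m1 : (-1)%:~R = -1 :> R by rewrite intrN.
  have [xc|xc] := ltP (co01_id x) c.
    rewrite mem_set// (@frac_partE _ _ (- 1 - Num.floor (k%:R * alpha))) E m1 ?mulr1n; lra.
  rewrite memNset; last by apply/negP; rewrite -leNgt.
  rewrite (@frac_partE _ _ (0 - Num.floor (k%:R * alpha))) E ?mulr0n ?mulr0z; lra.
have idi : lo.-integrable setT (EFin \o co01_id).
  apply: (@bounded_integrable _ _ _ _ _ 1) => [|x]; first exact: measurable_co01_id.
  by have /andP[? ?] := co01_id01 x; rewrite ger0_norm.
have i1 : lo.-integrable setT (EFin \o (\1_setT : X -> R)) by exact: integrable_indic.
have i2 : lo.-integrable setT (EFin \o (\1_(below (co01 R) c) : X -> R)).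
  by apply: integrable_indic; exact: measurable_below.
have i3 : lo.-integrable setT (EFin \o ((- c) \*: (\1_setT : X -> R))).
  exact: (integrableZl measurableT (- c) i1).
have i4 := integrableD measurableT idi i3.
rewrite L1_mkD// L1_mkD// L1_mkZ// -/u -/(L1_indic lo setT) -/(L1_indic lo (below (co01 R) c)).
by rewrite scaleNr addrAC [_ - _ + _ + _]addrAC subrK addrAC subrr add0r.
Qed.

Lemma irrational_rotation_propMC : irrational alpha -> propMC P.
Proof.
move=> ialpha; have ns := nonsingular_rotation alpha.
have gm A : measurable A -> lo (rotation alpha @^-1` A) = lo A by exact: leb_rotation.
apply: (cesaro_cvg_propMC (m := lo)) => x.
have Wfrac k : cesaro_cvg (m := lo) (rotation alpha) (L1_indic lo (below (co01 R) (frac_part (k%:R * alpha)))).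
  rewrite indic_rotation_coboundary addrC; apply: cesaro_cvg_scaleD => //.
    exact: cesaro_cvg_one.
  exact: cesaro_cvg_coboundary_iter.
apply: (L1_dense (measurable_belows (co01 R)) (@belows_setI _ _)).
- by move=> a y z; exact: cesaro_cvg_scaleD.
- by move=> y; exact: cesaro_cvg_closed.
- exact: cesaro_cvg_one.
move=> _ [b _ <-].
have [b0|b0] := leP b 0.
  rewrite (below_co01_le0 b0) (_ : L1_indic lo set0 = 0); first exact: cesaro_cvg0.
  by apply: L1_ext => A mA; rewrite L1_int0// L1_int_indic// set0I measure0.
have [b1|b1] := leP 1 b; first by rewrite (below_co01_ge1 b1); exact: cesaro_cvg_one.
(* Fractional parts of [k * alpha] occur just above [b], so [[0, b[] is an L1-limit of segments
   already treated; [b'] keeps them below 1 and below [b + e]. *)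
apply: cesaro_cvg_closed => // e e0; pose b' := Num.min ((b + 1) / 2) (b + e).
have bb' : b < b' by rewrite lt_min; apply/andP; split; lra.
have b'1 : b' < 1 by rewrite gt_min; apply/orP; left; lra.
have b'e : b' <= b + e by rewrite ge_min lexx orbT.
have [k _ /andP[k1 k2]] := irrational_frac_dense 0 ialpha b0 bb' b'1.
set c := frac_part _ in k1 k2.
exists (L1_indic lo (below (co01 R) c)); first exact: Wfrac.
have -> : L1_indic lo (below (co01 R) b) - L1_indic lo (below (co01 R) c) =
    - L1_indic lo (between (co01 R) b c).
  have mb := @measurable_below R (co01 R) b; have mc := @measurable_below R (co01 R) c.
  have mbc := @measurable_between R (co01 R) b c.
  apply: L1_ext => A mA; rewrite L1_intB// L1_intN// !L1_int_indic//.
  have sub : below (co01 R) b `<=` below (co01 R) c.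
    by move=> t; rewrite /below/= => h; exact: lt_trans k1.
  have -> : below (co01 R) c = below (co01 R) b `|` between (co01 R) b c.
    by rewrite /between setDUK.
  rewrite setIUl fine_measureU; [|exact: measurableI|exact: measurableI|].
    by rewrite opprD addrA subrr add0r.
  by rewrite setIACA /between setDIK set0I.
rewrite normrN norm_L1_indic; last exact: measurable_between.
by rewrite leb_co01_between; lra.
Qed.

Lemma irrational_rotation_not_propAC : irrational alpha -> ~ propAC P.
Proof.
move=> ialpha /(_ 2^-1); rewrite invr_gt0 => /(_ (ltr0n _ 2))[delta d0 hd].
have ns := nonsingular_rotation alpha.
pose c := Num.min (delta / 2) 2^-1.
have c0 : 0 < c by rewrite lt_min; apply/andP; split; lra.
have cd : c < delta by rewrite gt_min; apply/orP; left; lra.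
have c1 : c < 1 by rewrite gt_min; apply/orP; right; lra.
pose A := below (co01 R) c; have mA : measurable A by exact: measurable_below.
have mAc : fine (lo A) = c by rewrite leb_co01_below// ltW.
have mAE : lo A = c%:E by rewrite -mAc fineK//; exact: fin_num_measure.
have A0 : (0 < lo A)%E by rewrite mAE lte_fin.
have Ad : (lo A < delta%:E)%E by rewrite mAE lte_fin.
have := hd _ A (uniform_density_density mA A0) mA Ad.
move=> /ereal_inf_lt[_ [V [N _ NV] <-]]; apply/negP; rewrite -leNgt.
have c40 : 0 < c / 4 by lra.
have c42 : c / 4 < c / 2 by lra.
have c21 : c / 2 < 1 by lra.
(* When [k * alpha] exceeds an integer by less than [c / 2], the arc and its preimage overlap in
   more than half of the arc. Such times are unbounded, so the limsup is at least 1/2. The lower end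
   [c / 4] is there to be positive. *)
have [k Nk /andP[k1 k2]] := irrational_frac_dense N ialpha c40 c42 c21.
apply: (@le_trans _ _ (\int[lo]_(x in A) (iter k P (uniform_density lo A) x)%:E)%E); last first.
  by apply: ereal_sup_ubound; exists k => //; exact: NV.
rewrite L1_int_EFin// (PF_iter_int ns)// L1_int_uniform//; last first.
  exact: (measurable_iter_preimage ns).
rewrite mAc lee_fin ler_pdivlMr//.
set t := frac_part _ in k1 k2.
have mB : measurable (below (co01 R) (c - t)) by exact: measurable_below.
apply: (@le_trans _ _ (fine (lo (below (co01 R) (c - t))))).
  by rewrite leb_co01_below; lra.
apply: fine_le; rewrite ?fin_num_measure//.
- by apply: measurableI => //; exact: (measurable_iter_preimage ns).
- apply: le_measure; rewrite ?inE//.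
    by apply: measurableI => //; exact: (measurable_iter_preimage ns).
  move=> x; rewrite /below/= => xt; split; rewrite /A /below/=; first by lra.
  have := co01_id_rotation (k%:R * alpha) x; rewrite /co01_id iter_rotation => ->.
  by rewrite frac_partD ?co01_ge0 ?co01_lt1//; rewrite -/t; case: (ltP ((msub_val x : R) + t) 1); lra.
Qed.

End rotation_PF.

Section finite_weakly_precompact.
Context d (T : measurableType d) (R : realType).
Variable m : probability T R.

(** Set integrals are weakly continuous and separate the elements of L1, so the weak topology is T1
    and a finite set is its own closure. *)
Lemma finite_weakly_precompact (O : set (L1 m)) : finite_set O -> weakly_precompact O.
Proof.
move=> fO; pose W := initial_topology (@dual_eval R (L1 m)).
have acc : accessible_space W.
  move=> x y /eqP xy.
  have [A [mA hA]] : exists A, measurable A /\ L1_int A (x : L1 m) <> L1_int A (y : L1 m).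
    apply: contra_notP xy => /forallNP h; apply: L1_ext => A mA.
    by have /not_andP[//|/contrapT] := h A.
  exists [set z : W | L1_int A (z : L1 m) != L1_int A (y : L1 m)]; split.
  - have /continuousP := weak_continuous_L1_int (m := m) mA.
    by move=> /(_ [set r | r != L1_int A (y : L1 m)]); apply; exact: open_neq.
  - by rewrite inE /=; apply/eqP.
  - by rewrite inE /= eqxx.
have clO : closed (O : set W) by exact: (proj1 (@accessible_finite_set_closed W) acc O fO).
rewrite /weakly_precompact precompactE.
have -> : closure (O : set W) = O by exact/esym/closure_id.
exact: finite_compact.
Qed.

End finite_weakly_precompact.

Section rational_rotation.
Context (R : realType).
Notation lo := (@leb_co01 R).
Notation X := (msub (co01 R)).
Variable alpha : R.
Hypothesis ralpha : rational alpha.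
Notation P := (PF (m := lo) (rotation alpha)).

Lemma rational_rotation_period : exists2 q, (0 < q)%N & forall x, iter q (rotation alpha) x = x.
Proof.
have /rationalP[a [b ab]] := ralpha.
(* [rationalP] allows the denominator 0; then [alpha = 0] and the period is 1. *)
have [b0|b0] := posnP b.
  exists 1%N => // x; rewrite iter_rotation ab b0 invr0 !mulr0.
  exact: (rotation_int 0).
exists b => // x; rewrite iter_rotation ab mulrCA divff ?mulr1; first exact: rotation_int.
by rewrite pnatr_eq0 -lt0n.
Qed.

Lemma rational_rotation_propWAP : propWAP P.
Proof.
move=> phi; apply: finite_weakly_precompact.
have [q q0 qE] := rational_rotation_period.
have ns := nonsingular_rotation alpha.
have Pq x : iter q P x = x.
  apply: L1_ext => A mA; rewrite (PF_iter_int ns)//; congr L1_int.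
  by apply/seteqP; split=> t /=; rewrite /preimage/= qE.
have Pmod n : iter n P phi = iter (n %% q) P phi.
  rewrite {1}(divn_eq n q) addnC iterD; congr (iter _ _ _).
  by elim: (n %/ q)%N => // k ih; rewrite mulSn iterD ih Pq.
apply: (@sub_finite_set _ _ [set iter n P phi | n in `I_q]).
  by move=> _ [n _ <-]; exists (n %% q)%N; [exact: ltn_pmod|rewrite -Pmod].
exact/finite_image/finite_II.
Qed.

Lemma rational_rotation_not_propMC : ~ propMC P.
Proof.
have ns := nonsingular_rotation alpha.
apply: (not_propMC ns) => delta d0.
have [q q0 qE] := rational_rotation_period.
have q0R : 0 < (q%:R : R) by rewrite ltr0n.
(* So small that [q] copies of [[0, c[] have total measure below [delta]; the second bound keeps the
   arc inside the circle. *)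
pose c := Num.min (delta / q%:R / 2) 2^-1.
have dq0 : 0 < delta / q%:R by exact: divr_gt0.
have c0 : 0 < c by rewrite lt_min; apply/andP; split; lra.
have cd : c < delta / q%:R by rewrite gt_min; apply/orP; left; lra.
have c1 : c < 1 by rewrite gt_min; apply/orP; right; lra.
pose B := below (co01 R) c; have mB : measurable B by exact: measurable_below.
have mBE : lo B = c%:E.
  by rewrite -(fineK (fin_num_measure lo _ mB)) leb_co01_below// ltW.
have mBi i : measurable (iter i (rotation alpha) @^-1` B).
  exact: (measurable_iter_preimage ns).
have BiE i : lo (iter i (rotation alpha) @^-1` B) = c%:E.
  rewrite -mBE -[RHS](leb_rotation (i%:R * alpha) mB); congr (lo _).
  by apply/seteqP; split=> t /=; rewrite /preimage/= iter_rotation.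
pose A := \big[setU/set0]_(i < q) (iter i (rotation alpha) @^-1` B).
have mA : measurable A by exact: bigsetU_measurable.
have AP x : A x <-> exists2 i, (i < q)%N & B (iter i (rotation alpha) x).
  by rewrite /A -(bigcup_mkord q (fun i => iter i (rotation alpha) @^-1` B)); split=> [[i /= iq Bi]|[i iq Bi]]; exists i.
exists A; split=> //.
- apply: (@lt_le_trans _ _ c%:E); first by rewrite lte_fin.
  rewrite -mBE; apply: le_measure; rewrite ?inE// => x Bx.
  by apply/AP; exists 0%N.
- apply: (@le_lt_trans _ _ (\sum_(i < q) lo (iter i (rotation alpha) @^-1` B))%E).
    exact: (Boole_inequality lo (A := fun i => iter i (rotation alpha) @^-1` B) (fun i _ => mBi i)).
  under eq_bigr do rewrite BiE.
  rewrite sumEFin lte_fin sumr_const card_ord -mulr_natl -ltr_pdivlMl//.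
  by rewrite mulrC.
(* Shifting time permutes the [q] copies cyclically: index [q] is index 0 again, by periodicity. *)
- apply/seteqP; split=> x /=; rewrite /preimage/= => /AP[i iq Bi]; apply/AP.
    rewrite -iterSr in Bi; have [iq1|qi] := ltnP i.+1 q; first by exists i.+1.
    have iqE : i.+1 = q by apply/eqP; rewrite eqn_leq iq.
    by exists 0%N => //=; rewrite -(qE x) -iqE.
  case: i iq Bi => [_ Bx|i iq Bi]; last first.
    by exists i; [exact: ltnW|rewrite -iterSr].
  by exists q.-1; [rewrite prednK|rewrite -iterSr prednK// qE].
Qed.

End rational_rotation.

(** * The baker map *)

Section mixing.
Context d (T : measurableType d) (R : realType).
Variables (m : probability T R) (g : T -> T) (G : set (set T)).
Hypothesis gns : nonsingular m g.
Hypothesis gm : forall A, measurable A -> m (g @^-1` A) = m A.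
Hypotheses (GE : @measurable _ T = <<s G >>) (GI : setI_closed G).
Hypothesis mixG : forall A B, G A -> G B ->
  fine (m (B `&` iter n g @^-1` A)) @[n --> \oo] --> fine (m B) * fine (m A).

Let G_measurable A : G A -> measurable A.
Proof. by rewrite GE; exact: sub_sigma_algebra. Qed.

Let m_iter n A : measurable A -> m (iter n g @^-1` A) = m A.
Proof.
elim: n A => // n ih A mA; rewrite -[RHS]gm// -[RHS]ih//.
exact: (measurable_ns_preimage gns).
Qed.

Let mT : fine (m setT) = 1.
Proof. exact: (congr1 fine (probability_setT m)). Qed.

(** First extension, in the density: the convergence is linear in [x] and stable in norm uniformly
    in [n], so it passes from indicators of sets of [G] to all of L1. *)
Let mix_L1 A (x : L1 m) : G A ->
  L1_int (iter n g @^-1` A) x @[n --> \oo] --> L1_int setT x * fine (m A).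
Proof.
move=> GA; have mA := G_measurable GA.
have mAn n := measurable_iter_preimage gns n mA.
have mA1 : fine (m A) <= 1.
  by rewrite -mT; apply: fine_le; rewrite ?fin_num_measure//; apply: le_measure; rewrite ?inE.
pose W (x : L1 m) := L1_int (iter n g @^-1` A) x @[n --> \oo] --> L1_int setT x * fine (m A).
apply: (L1_dense (W := W) GE GI).
- move=> a y z Wy Wz; rewrite /W L1_intD// L1_intZ// mulrDl -mulrA.
  under eq_fun do rewrite L1_intD// L1_intZ//.
  by apply: cvgD => //; apply: cvgM => //; exact: cvg_cst.
- move=> y hy; apply/cvgrPdist_le => e e0.
  have e30 : 0 < e / 3 by rewrite divr_gt0.
  have [z Wz yz] := hy _ e30; have /cvgrPdist_le /(_ _ e30) := Wz.
  apply: filterS => n hn.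
  rewrite (_ : _ - _ = L1_int setT (y - z) * fine (m A) +
    (L1_int setT z * fine (m A) - L1_int (iter n g @^-1` A) z) -
    L1_int (iter n g @^-1` A) (y - z)); last first.
    rewrite !L1_intB// mulrBl; move: (_ * _) (_ * _) => u v.
    by move: (L1_int _ _) (L1_int _ _) => w t; lra.
  apply: le_trans (ler_normB _ _) _; apply: le_trans (lerD (ler_normD _ _) (lexx _)) _.
  have h1 : `|L1_int setT (y - z) * fine (m A)| <= `|y - z|.
    rewrite normrM [X in _ * X]ger0_norm ?fine_ge0//.
    apply: le_trans (le_L1_int_norm _ measurableT); exact: ler_piMr.
  have := le_L1_int_norm (y - z) (mAn n); lra.
- rewrite /W L1_int_indic// setTI mT mul1r.
  under eq_fun do rewrite L1_int_indic// setTI.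
  apply: cvg_near_cst; apply: nearW => n; exact: (congr1 fine (m_iter n mA)).
- move=> B GB; rewrite /W L1_int_indic ?setIT//; last exact: G_measurable.
  have mB := G_measurable GB; under eq_fun do rewrite (L1_int_indic _ mB)//.
  exact: mixG.
Qed.

(** Second extension, in the set, by Dynkin's induction from [G]. *)
Lemma mixing_PF (x : L1 m) A : measurable A ->
  L1_int A (iter n (PF g) x) @[n --> \oo] --> L1_int setT x * fine (m A).
Proof.
move=> mA; under eq_fun do rewrite (PF_iter_int gns)//.
have mpre n B : measurable B -> measurable (iter n g @^-1` B).
  exact: (measurable_iter_preimage gns).
move: mA; rewrite GE.
apply: (@dynkin_induction _ T G (fun A =>
  L1_int (iter n g @^-1` A) x @[n --> \oo] --> L1_int setT x * fine (m A)) GE GI).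
- by under eq_fun do rewrite preimage_setT; rewrite mT mulr1; exact: cvg_cst.
- by move=> B GB; exact: mix_L1.
- move=> B mB hB; rewrite fine_probability_setC// mulrBr mulr1.
  have E n : L1_int (iter n g @^-1` (~` B)) x = L1_int setT x - L1_int (iter n g @^-1` B) x.
    by rewrite (L1_int_setC x (mpre n _ mB)) addrAC subrr add0r.
  by under eq_fun do rewrite E; apply: cvgB => //; exact: cvg_cst.
(* Invariance lets the limit in [n] pass through the infinite union: all preimages of the remainder
   have the measure of the remainder, so [x] puts less than [e / 4] on each of them. *)
move=> F mF tF hF.
have mU : measurable (\bigcup_k F k) by exact: bigcup_measurable.
apply/cvgrPdist_le => e e0; have e40 : 0 < e / 4 by rewrite divr_gt0.
have [delta d0 hd] := L1_abs_continuous x e40.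
pose S N := \big[setU/set0]_(i < N) F i.
have mS N : measurable (S N) by exact: bigsetU_measurable.
have subS N : S N `<=` \bigcup_k F k.
  by rewrite /S -bigcup_mkord => t [i _ Fit]; exists i.
pose K := `|L1_int setT x| + 1.
have K0 : 0 < K by rewrite ltr_wpDl.
have eK : 0 < e / 4 / K by rewrite divr_gt0.
have [N [hN1 hN2]] : exists N, (m (\bigcup_k F k `\` S N) < delta%:E)%E /\
    fine (m (\bigcup_k F k `\` S N)) < e / 4 / K.
  have : (fun n => \sum_(0 <= i < n) m (F i))%E @ \oo --> (fine (m (\bigcup_k F k)))%:E.
    by rewrite fineK ?fin_num_measure//; exact: measure_semi_sigma_additive.
  have md0 : 0 < Num.min delta (e / 4 / K) by rewrite lt_min d0.
  move=> /fine_cvgP[_ /cvgrPdist_lt /(_ _ md0) [N _ /(_ N (leqnn N))/=]] hN.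
  have mD : measurable (\bigcup_k F k `\` S N) by exact: measurableD.
  have h : fine (m (\bigcup_k F k `\` S N)) < Num.min delta (e / 4 / K).
    rewrite measureD//; last by rewrite -ge0_fin_numE//; exact: fin_num_measure.
    rewrite setIidr// fineB; [|exact: fin_num_measure..].
    by apply: le_lt_trans hN; rewrite big_mkord -measure_bigsetU// ?ler_norm.
  exists N; split; last by apply: lt_le_trans h _; rewrite ge_min lexx orbT.
  rewrite -(fineK (fin_num_measure m _ mD)) lte_fin.
  by apply: lt_le_trans h _; rewrite ge_min lexx.
have hS : L1_int (iter n g @^-1` S N) x @[n --> \oo] --> L1_int setT x * fine (m (S N)).
  have -> : L1_int setT x * fine (m (S N)) = \sum_(0 <= i < N) L1_int setT x * fine (m (F i)).
    rewrite -mulr_sumr; congr (_ * _).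
    have mE B : measurable B -> fine (m B) = L1_int B (L1_indic m setT).
      by move=> mB; rewrite L1_int_indic// setTI.
    by rewrite mE// L1_int_bigsetU//; apply: eq_bigr => i _; rewrite mE.
  have E n : L1_int (iter n g @^-1` S N) x = \sum_(0 <= i < N) L1_int (iter n g @^-1` F i) x.
    rewrite -L1_int_bigsetU//; last 2 first.
    - by move=> i; exact: mpre.
    - exact: trivIset_preimage.
    by rewrite /S -bigcup_mkord preimage_bigcup bigcup_mkord.
  under eq_fun do rewrite E.
  apply: cvg_big => [|i _]; [exact: add_continuous|].
  have mFi := mF i; exact: hF.
move/cvgrPdist_le : hS => /(_ _ e40); apply: filterS => n hn.
have mD : measurable (\bigcup_k F k `\` S N) by exact: measurableD.
have UE : \bigcup_k F k = S N `|` (\bigcup_k F k `\` S N) by rewrite setDUK.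
rewrite UE preimage_setU L1_int_setU; [|exact: mpre|exact: mpre|]; last first.
  by apply/disj_setPS; rewrite -preimage_setI setDIK preimage_set0.
rewrite fine_measureU//; last by rewrite setDIK.
have h1 : `|L1_int (iter n g @^-1` (\bigcup_k F k `\` S N)) x| < e / 4.
  by apply: hd; [exact: mpre|rewrite [X in (X < _)%E](m_iter n mD)].
have h2 : `|L1_int setT x * fine (m (\bigcup_k F k `\` S N))| <= e / 4.
  rewrite normrM [X in _ * X]ger0_norm ?fine_ge0//.
  apply: (@le_trans _ _ (K * (e / 4 / K))); last by rewrite mulrC divfK// gt_eqF.
  by apply: ler_pM => //; [exact: fine_ge0|rewrite lerDl|exact: ltW].
rewrite mulrDr opprD addrACA.
apply: le_trans (ler_normD _ _) _; apply: le_trans (lerD (lexx _) (ler_normB _ _)) _.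
lra.
Qed.

(** The masses on [A] converge to the measure of [A] itself, so the limsup is a limit and
    [delta = e] works. *)
Lemma mixing_propAC : propAC (PF (m := m) g).
Proof.
move=> e e0; exists e => // phi A dphi mA Ae.
have h : (\int[m]_(x in A) (iter n (PF g) phi x)%:E)%E @[n --> \oo] --> (fine (m A))%:E.
  under eq_fun do rewrite L1_int_EFin//.
  apply: cvg_EFin; first exact: nearW.
  have := mixing_PF (x := phi) mA; have /densitiesP[_ ->] := dphi; rewrite mul1r.
  exact.
have [_ ->] := cvg_limn_einf_sup h.
by rewrite fineK//; exact: fin_num_measure.
Qed.

End mixing.

(** * The doubling map inside the baker's transformation *)

Section baker_basics.
Context (R : realType).
Notation l := (@leb_cc01 R).
Notation X := (msub (cc01 R)).
Notation bel := (below (cc01 R)).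
Implicit Types (E F : set X) (b c : R).

(** The product measure of the statement, typed as a probability for the general lemmas. *)
Definition leb2 : probability (X * X)%type R := ((@leb_cc01 R) \x (@leb_cc01 R))%E.
Notation m2 := leb2.

Definition doubling (x : X) : X := msub_mk (baker_fst_in x).

Lemma doublingE (x : X) : (msub_val (doubling x) : R) = baker_fst (msub_val x).
Proof. by []. Qed.

Lemma baker_sndE (p : X * X) :
  (msub_val (baker p).2 : R) = baker_snd (msub_val p.1) (msub_val p.2).
Proof. by []. Qed.

Lemma measurable_cc01_val : measurable_fun setT (fun x : X => (msub_val x : R)).
Proof. exact: (@measurable_msub_val _ _ (cc01 R)). Qed.

Lemma measurable_doubling : measurable_fun setT doubling.
Proof.
apply: measurable_to_msub; rewrite (_ : _ \o _ = fun x : X =>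
  if (msub_val x : R) < 2^-1 then 2 * (msub_val x : R) else 2 * (msub_val x : R) - 1)//.
have mv := measurable_cc01_val.
apply: measurable_fun_ifT.
- exact: measurable_fun_ltr.
- exact: measurable_funM.
- by apply: measurable_funB => //; exact: measurable_funM.
Qed.

Lemma measurable_baker : measurable_fun setT (@baker R).
Proof.
have mv := measurable_cc01_val.
have m1 : measurable_fun setT (fun p : X * X => (msub_val p.1 : R)).
  by apply: (measurableT_comp mv); exact: measurable_fst.
have m2 : measurable_fun setT (fun p : X * X => (msub_val p.2 : R)).
  by apply: (measurableT_comp mv); exact: measurable_snd.
apply/measurable_fun_pairP; split.
  rewrite (_ : _ \o _ = doubling \o fst)//.
  by apply: measurableT_comp; [exact: measurable_doubling|exact: measurable_fst].
apply: measurable_to_msub; rewrite (_ : _ \o _ = fun p : X * X =>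
  if (msub_val p.1 : R) < 2^-1 then (msub_val p.2 : R) / 2 else (msub_val p.2 : R) / 2 + 2^-1)//.
apply: measurable_fun_ifT.
- exact: measurable_fun_ltr.
- exact: measurable_funM.
- by apply: measurable_funD => //; exact: measurable_funM.
Qed.

Lemma measurable_doubling_pre n E : measurable E -> measurable (iter n doubling @^-1` E).
Proof.
move=> mE; rewrite -[X in measurable X]setTI.
have mi : measurable_fun setT (iter n doubling).
  elim: n => [|n ih]; first exact: measurable_id.
  by apply: (@measurableT_comp _ _ _ _ _ _ doubling) => //; exact: measurable_doubling.
exact: mi.
Qed.

Definition lam E : R := fine (l E).

Lemma lam_below_le0 b : b <= 0 -> lam (bel b) = 0.
Proof. by move=> b0; rewrite /lam (below_cc01_le0 b0) measure0. Qed.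

Lemma lam_below_mid b : 0 <= b -> b <= 1 -> lam (bel b) = b.
Proof. exact: leb_cc01_below. Qed.

Lemma lamT : lam setT = 1.
Proof. by rewrite /lam leb_cc01T. Qed.

Lemma lam_ge0 E : 0 <= lam E.
Proof. exact: fine_ge0. Qed.

Lemma lamU E F : measurable E -> measurable F -> E `&` F = set0 ->
  lam (E `|` F) = lam E + lam F.
Proof. exact: fine_measureU. Qed.

Lemma lamS E F : measurable E -> measurable F -> E `<=` F -> lam E <= lam F.
Proof.
move=> mE mF EF; apply: fine_le; rewrite ?fin_num_measure//.
by apply: le_measure; rewrite ?inE.
Qed.

Lemma lam_below_ge1 b : 1 <= b -> lam (bel b) = 1.
Proof.
move=> b1; have mb := @measurable_below R (cc01 R).
apply/eqP; rewrite eq_le; apply/andP; split; first by rewrite -lamT; exact: lamS.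
rewrite -[leLHS](lam_below_mid ler01 (lexx 1)); apply: lamS => // x h.
exact: lt_le_trans h b1.
Qed.

(** The part of [[0, b[] in the left half, doubled, is [[0, 2b[], the part in the right half [[0, 2b
    - 1[]. [lam] truncates lengths to [[0, 1]], which makes the identity valid for every real
    [b]. *)
Lemma lam_below_halve b : lam (bel b) = (lam (bel (2 * b)) + lam (bel (2 * b - 1))) / 2.
Proof.
have [b0|b0] := leP b 0.
  by rewrite !lam_below_le0 ?addr0 ?mul0r//; lra.
have [b2|b2] := leP b 2^-1.
  by rewrite (@lam_below_le0 (2 * b - 1)) ?lam_below_mid; lra.
rewrite (@lam_below_ge1 (2 * b)); last by lra.
have [b1|b1] := leP b 1; first by rewrite !lam_below_mid; lra.
by rewrite !lam_below_ge1; lra.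
Qed.

Definition half0 : set X := bel 2^-1.
Definition half1 : set X := ~` bel 2^-1.

Lemma measurable_half0 : measurable half0.
Proof. exact: measurable_below. Qed.

Lemma measurable_half1 : measurable half1.
Proof. exact: measurable_above. Qed.

Lemma half0_doubling b : half0 `&` doubling @^-1` bel b = half0 `&` bel (b / 2).
Proof.
apply/seteqP; split=> x [x0 xb]; split=> //; move: x0 xb;
  by rewrite /half0 /below /preimage /mkset doublingE /baker_fst => -> h; lra.
Qed.

Lemma half1_doubling b : half1 `&` doubling @^-1` bel b = half1 `&` bel ((b + 1) / 2).
Proof.
apply/seteqP; split=> x [x0 xb]; split=> //; move: x0 xb;
  rewrite /half1 /setC /below /preimage /mkset doublingE /baker_fst => /negP/negbTE ->;
  by move=> h; lra.
Qed.

Lemma L1_int_indic_lam E F : measurable E -> measurable F ->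
  L1_int F (L1_indic l E) = lam (E `&` F).
Proof. exact: L1_int_indic. Qed.

(** The claim is that doubling pushes the indicator of [H] forward to the constant 1/2, and initial
    segments decide this. *)
Lemma lam_doubling_ext H : measurable H -> lam H = 2^-1 ->
  (forall b, lam (H `&` doubling @^-1` bel b) = lam (bel b) / 2) ->
  forall E, measurable E -> lam (H `&` doubling @^-1` E) = lam E / 2.
Proof.
move=> mH H2 Hb E mE.
have mpre C : measurable C -> measurable (doubling @^-1` C) := @measurable_doubling_pre 1 C.
have yE F : measurable F -> L1_int F (2^-1 *: L1_indic l setT) = lam F / 2.
  by move=> mF; rewrite L1_intZ// L1_int_indic_lam// setTI mulrC.
rewrite -yE// -L1_int_indic_lam//; last exact: mpre.
apply: (L1_int_ext_pi measurable_doubling (measurable_belows (cc01 R)) (@belows_setI _ _)) => //.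
- by rewrite L1_int_indic_lam// setIT yE// lamT mul1r.
move=> _ [b _ <-]; have mb := @measurable_below R (cc01 R) b.
by rewrite L1_int_indic_lam ?yE//; exact: mpre.
Qed.

Lemma lam_half0T : lam half0 = 2^-1.
Proof.
by rewrite lam_below_mid; lra.
Qed.

Lemma lam_half1T : lam half1 = 2^-1.
Proof.
have := lamU measurable_half0 measurable_half1 (setICr _).
by rewrite setUv lamT lam_half0T; lra.
Qed.

Lemma lam_half0 E : measurable E -> lam (half0 `&` doubling @^-1` E) = lam E / 2.
Proof.
apply: lam_doubling_ext => [||b]; [exact: measurable_half0|exact: lam_half0T|].
rewrite half0_doubling.
have -> : half0 `&` bel (b / 2) = bel (Num.min 2^-1 (b / 2)).
  by apply/seteqP; split=> x; rewrite /half0 /below/= lt_min => /andP.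
have [h|h] := leP 2^-1 (b / 2).
  by rewrite lam_below_mid ?lam_below_ge1; lra.
have [b0|b0] := leP b 0; first by rewrite !lam_below_le0; lra.
by rewrite !lam_below_mid; lra.
Qed.

Lemma lam_half1 E : measurable E -> lam (half1 `&` doubling @^-1` E) = lam E / 2.
Proof.
have mh := measurable_half1; have mh0 := measurable_half0.
apply: lam_doubling_ext => [||b]; [exact: measurable_half1|exact: lam_half1T|].
rewrite half1_doubling.
have [h|h] := leP b 0.
  rewrite (_ : _ `&` _ = set0) ?(lam_below_le0 h) ?mul0r.
    by rewrite /lam measure0.
  apply/seteqP; split=> // x []; rewrite /half1 /setC /below /mkset => /negP.
  by rewrite -leNgt; lra.
have h1 : 2^-1 <= (b + 1) / 2 by lra.
have sub : bel 2^-1 `<=` bel ((b + 1) / 2).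
  by move=> x; rewrite /below/= => hx; exact: lt_le_trans hx h1.
have mI : measurable (half1 `&` bel ((b + 1) / 2)).
  by apply: measurableI => //; exact: measurable_below.
have E0 : bel 2^-1 `&` (half1 `&` bel ((b + 1) / 2)) = set0 by rewrite setIA setICr set0I.
have := lamU mh0 mI E0.
have -> : half0 `|` (half1 `&` bel ((b + 1) / 2)) = bel ((b + 1) / 2).
  by rewrite /half1 setIC -/(bel ((b + 1) / 2) `\` bel 2^-1) setDUK.
rewrite lam_half0T; have [b1|b1] := leP 1 b.
  by rewrite !lam_below_ge1; lra.
by rewrite !lam_below_mid; lra.
Qed.

Lemma lam_doubling E : measurable E -> lam (doubling @^-1` E) = lam E.
Proof.
move=> mE; have mD := @measurable_doubling_pre 1 E mE.
have mh := measurable_half0; have mh1 := measurable_half1.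
have -> : doubling @^-1` E =
    (half0 `&` doubling @^-1` E) `|` (half1 `&` doubling @^-1` E).
  by rewrite -setIUl setUv setTI.
rewrite lamU; [by rewrite lam_half0// lam_half1//; lra|exact: measurableI|exact: measurableI|].
by rewrite setIACA setICr set0I.
Qed.

Lemma lam_doubling_iter n E : measurable E -> lam (iter n doubling @^-1` E) = lam E.
Proof.
elim: n E => // n ih E mE; rewrite -[RHS]lam_doubling// -[RHS]ih//.
exact: (@measurable_doubling_pre 1).
Qed.

Lemma lam_below_split b F : measurable F -> lam (bel b `&` doubling @^-1` F) =
  (lam (bel (2 * b) `&` F) + lam (bel (2 * b - 1) `&` F)) / 2.
Proof.
move=> mF; have mb c := @measurable_below R (cc01 R) c.
have mh := measurable_half0; have mh1 := measurable_half1.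
have mI c : measurable (bel c `&` F) by exact: measurableI.
have mD c : measurable (doubling @^-1` (bel c `&` F)) := @measurable_doubling_pre 1 _ (mI c).
rewrite mulrDl -lam_half0// -lam_half1// -lamU; last 3 first.
- exact: measurableI.
- exact: measurableI.
- by rewrite setIACA setICr set0I.
congr lam; rewrite !preimage_setI !setIA half0_doubling half1_doubling -setIUl; congr (_ `&` _).
rewrite -[LHS]setTI -(setUv half0) setIUl; congr (_ `|` (_ `&` bel _)); last by lra.
by congr (_ `&` bel _); lra.
Qed.

(** Rescaling the two halves of [bel b] gives two segments, one of which is trivial: empty if
    [b <= 1/2], everything otherwise. Only the other one carries an error, and it has weight 1/2. *)
Lemma doubling_mixing n b E : measurable E ->
  `|lam (bel b `&` iter n doubling @^-1` E) - lam (bel b) * lam E| <= 2^-1 ^+ n.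
Proof.
move=> mE; elim: n b => [|n ih] b.
  have mb := @measurable_below R (cc01 R) b.
  have h1 : lam (bel b `&` E) <= 1 by rewrite -lamT; apply: lamS => //; exact: measurableI.
  have h2 : lam (bel b) * lam E <= 1.
    by rewrite mulr_ile1 ?lam_ge0// -lamT; exact: lamS.
  have h3 : 0 <= lam (bel b) * lam E by rewrite mulr_ge0 ?lam_ge0.
  have h4 := lam_ge0 (bel b `&` E).
  rewrite expr0 /= -[X in lam (_ `&` X)]/E ler_norml; apply/andP; split; lra.
rewrite (_ : iter n.+1 doubling @^-1` E = doubling @^-1` (iter n doubling @^-1` E)); last first.
  by apply/seteqP; split=> x; rewrite /preimage/mkset -iterSr.
have mS := @measurable_doubling_pre n E mE.
rewrite lam_below_split// (lam_below_halve b).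
set S := iter n doubling @^-1` E in mS *.
have SE : lam S = lam E by exact: lam_doubling_iter.
rewrite exprS.
have halve (z t : R) : `|z| <= t -> `|z / 2| <= 2^-1 * t.
  by rewrite !ler_norml => /andP[z1 z2]; apply/andP; split; lra.
have [b2|b2] := leP b 2^-1.
  rewrite (_ : bel (2 * b - 1) = set0); last by apply: below_cc01_le0; lra.
  rewrite set0I (_ : lam set0 = 0); last by rewrite /lam measure0.
  have := ih (2 * b); rewrite -/S !addr0.
  rewrite (_ : _ / 2 - _ = (lam (bel (2 * b) `&` S) - lam (bel (2 * b)) * lam E) / 2); last by lra.
  exact: halve.
rewrite (_ : bel (2 * b) = setT); last by apply: below_ge1; lra.
have := ih (2 * b - 1); rewrite -/S setTI SE lamT.
rewrite (_ : _ / 2 - _ = (lam (bel (2 * b - 1) `&` S) - lam (bel (2 * b - 1)) * lam E) / 2); last by lra.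
exact: halve.
Qed.

Definition mu (A : set (X * X)) : R := fine (m2 A).

Lemma mu_rect E F : measurable E -> measurable F -> mu (E `*` F) = lam E * lam F.
Proof.
move=> mE mF.
have h : m2 (E `*` F) = (l E * l F)%E by exact: (product_measure1E l l mE mF).
rewrite /mu h fineM//.
  exact: fin_num_measure.
exact: fin_num_measure.
Qed.

Lemma mu_ge0 A : 0 <= mu A.
Proof. exact: fine_ge0. Qed.

Lemma muU (A B : set (X * X)%type) : measurable A -> measurable B -> A `&` B = set0 ->
  mu (A `|` B) = mu A + mu B.
Proof. exact: (@fine_measureU _ _ _ m2 A B). Qed.

Lemma muS (A B : set (X * X)%type) : measurable A -> measurable B -> A `<=` B -> mu A <= mu B.
Proof.
move=> mA mB AB; rewrite /mu; apply: fine_le.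
- exact: (fin_num_measure m2 A mA).
- exact: (fin_num_measure m2 B mB).
- by apply: (@le_measure _ _ _ m2); rewrite ?inE.
Qed.

Definition corners : set (set (X * X)) := [set bel b `*` bel c | b in setT & c in setT].

Lemma corners_setI : setI_closed corners.
Proof.
move=> _ _ [b _ [c _ <-]] [b' _ [c' _ <-]].
exists (Num.min b b') => //; exists (Num.min c c') => //.
by apply/seteqP; split=> p; rewrite /below/= !lt_min => -[];
  [move=> /andP[? ?] /andP[? ?]|move=> [? ?] [? ?]; split; apply/andP].
Qed.

Lemma corners_generate : @measurable _ (X * X)%type = <<s corners >>.
Proof.
have sC : <<s corners >> `<=` measurable.
  apply: smallest_sub; first exact: sigma_algebra_measurable.
  by move=> _ [b _ [c _ <-]]; apply: measurableX; exact: measurable_below.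
apply/seteqP; split=> [|//].
rewrite measurable_prod_measurableType.
pose T := g_sigma_algebraType corners.
have sT : <<s corners >> setT.
  (* [bel 2] is the whole interval, whereas [bel 1] misses its right end. *)
  apply: sub_sigma_algebra; exists 2 => //; exists 2 => //.
  by rewrite !below_ge1 ?setXTT//; lra.
have step1 b F : measurable F -> <<s corners >> (bel b `*` F).
  rewrite measurable_belows.
  apply: (@dynkin_induction _ X (belows (cc01 R)) (fun F => <<s corners >> (bel b `*` F))
     (measurable_belows _) (@belows_setI _ _)).
  - by apply: sub_sigma_algebra; exists b => //; exists 2 => //; rewrite (@below_ge1 _ 2)//; lra.
  - by move=> _ [c _ <-]; apply: sub_sigma_algebra; exists b => //; exists c.
  - move=> S _ hS; have -> : bel b `*` (~` S) = (bel b `*` setT) `\` (bel b `*` S).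
      by apply/seteqP; split=> p; rewrite /=; tauto.
    apply: (@measurableD _ T) => //.
    by apply: sub_sigma_algebra; exists b => //; exists 2 => //; rewrite (@below_ge1 _ 2)//; lra.
  - move=> S _ _ hS; have -> : bel b `*` (\bigcup_k S k) = \bigcup_k (bel b `*` S k).
      by apply/seteqP; split=> [p [? [k _ ?]]|p [k _ [? ?]]]; [exists k|split=> //; exists k].
    by apply: sigma_algebra_bigcup => i; exact: hS.
have step2 F E : measurable F -> measurable E -> <<s corners >> (E `*` F).
  move=> mF; have ET : <<s corners >> (setT `*` F).
    by have := step1 2 F mF; rewrite below_ge1//; lra.
  rewrite measurable_belows.
  apply: (@dynkin_induction _ X (belows (cc01 R)) (fun E => <<s corners >> (E `*` F))
     (measurable_belows _) (@belows_setI _ _)) => //.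
  - by move=> _ [c _ <-]; exact: step1.
  - move=> S _ hS; have -> : (~` S) `*` F = (setT `*` F) `\` (S `*` F).
      by apply/seteqP; split=> p; rewrite /=; tauto.
    exact: (@measurableD _ T).
  - move=> S _ _ hS; have -> : (\bigcup_k S k) `*` F = \bigcup_k (S k `*` F).
      by apply/seteqP; split=> [p [[k _ ?] ?]|p [k _ [? ?]]]; [exists k|split=> //; exists k].
    by apply: sigma_algebra_bigcup => i; exact: hS.
apply: smallest_sub; first exact: smallest_sigma_algebra.
by move=> _ [E mE [F mF <-]]; exact: step2.
Qed.

(** The image height is [y / 2] over the left half and [y / 2 + 1/2] over the right half; it is
    below [b] when [y < 2b], respectively [y < 2b - 1]. *)
Lemma baker_pre_rect E b : @baker R @^-1` (E `*` bel b) =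
  ((half0 `&` doubling @^-1` E) `*` bel (2 * b)) `|`
  ((half1 `&` doubling @^-1` E) `*` bel (2 * b - 1)).
Proof.
have sndE (p : X * X) : bel b (baker p).2 <->
    (if (msub_val p.1 : R) < 2^-1 then (msub_val p.2 : R) < 2 * b
     else (msub_val p.2 : R) < 2 * b - 1).
  have -> : bel b (baker p).2 = (baker_snd (msub_val p.1 : R) (msub_val p.2) < b) by [].
  by rewrite /baker_snd; case: ifP => _; split; lra.
apply/seteqP; split=> p.
  move=> [/= E1 /sndE]; have [h|h] := ltP (msub_val p.1 : R) 2^-1 => h2.
    by left; split=> //=; split.
  by right; split=> //=; split=> //; apply/negP; rewrite -leNgt.
case=> -[[h E1] h2]; split=> //=; apply/sndE; move: h; rewrite /half0 /half1 /setC /below /mkset.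
  by move=> ->.
by move=> /negP/negbTE ->.
Qed.

Lemma measurable_half_pre E : measurable E ->
  measurable (half0 `&` doubling @^-1` E) /\ measurable (half1 `&` doubling @^-1` E).
Proof.
move=> mE; have mD := @measurable_doubling_pre 1 E mE.
by split; apply: measurableI => //; [exact: measurable_half0|exact: measurable_half1].
Qed.

Lemma measurable_iter_baker_pre n A : measurable A -> measurable (iter n (@baker R) @^-1` A).
Proof.
move=> mA; rewrite -[X in measurable X]setTI.
have mi : measurable_fun setT (iter n (@baker R)).
  elim: n => [|n ih]; first exact: measurable_id.
  by apply: (@measurableT_comp _ _ _ _ _ _ (@baker R)) => //; exact: measurable_baker.
exact: mi.
Qed.

Lemma mu_baker A : measurable A -> mu (@baker R @^-1` A) = mu A.
Proof.
move=> mA; have mpre := @measurable_iter_baker_pre 1.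
have muI B C : measurable B -> measurable C -> L1_int C (L1_indic m2 B) = mu (B `&` C).
  exact: (@L1_int_indic _ _ _ m2).
rewrite -[in RHS](setTI A) -[in LHS](setTI (_ @^-1` _)) -!muI//; last exact: mpre.
apply: (L1_int_ext_pi measurable_baker corners_generate corners_setI) => //.
move=> _ [b _ [c _ <-]]; have mb := @measurable_below R (cc01 R).
have mbc : measurable (bel b `*` bel c) by exact: measurableX.
rewrite (muI _ _ measurableT (mpre _ mbc)) (muI _ _ measurableT mbc).
have [m1 m2'] := measurable_half_pre (mb b).
rewrite !setTI baker_pre_rect muU; [|exact: measurableX|exact: measurableX|]; last first.
  by apply/seteqP; split=> // p [[[h _] _] [[h' _] _]].
rewrite !mu_rect// lam_half0// lam_half1// (lam_below_halve c); lra.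
Qed.

Lemma leb2_baker A : measurable A -> m2 (@baker R @^-1` A) = m2 A.
Proof.
move=> mA; have mgA := @measurable_iter_baker_pre 1 A mA.
rewrite -(fineK (fin_num_measure m2 _ mgA)) -(fineK (fin_num_measure m2 _ mA)).
by congr EFin; exact: mu_baker.
Qed.

Lemma nonsingular_baker : nonsingular m2 (@baker R).
Proof. by split; [exact: measurable_baker|move=> A mA <-; exact: leb2_baker]. Qed.

Lemma mu_baker_iter n A : measurable A -> mu (iter n (@baker R) @^-1` A) = mu A.
Proof.
elim: n A => // n ih A mA; have mgA := @measurable_iter_baker_pre 1 A mA.
by rewrite -(mu_baker mA); exact: (ih _ mgA).
Qed.

Lemma baker_iter_fst n (p : X * X) : (iter n (@baker R) p).1 = iter n doubling p.1.
Proof. by elim: n => //= n <-. Qed.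

(** A vertical strip depends on the first coordinate only, which evolves by the doubling map. *)
Lemma baker_mixing_vertical b c E n : measurable E ->
  `|mu ((bel b `*` bel c) `&` iter n (@baker R) @^-1` (E `*` setT)) -
    mu (bel b `*` bel c) * lam E| <= 2^-1 ^+ n.
Proof.
move=> mE; have mb := @measurable_below R (cc01 R).
have mEn := @measurable_doubling_pre n E mE.
rewrite (_ : _ `&` _ = (bel b `&` iter n doubling @^-1` E) `*` bel c); last first.
  apply/seteqP; split=> p; rewrite /preimage/= baker_iter_fst; tauto.
rewrite !mu_rect//; last exact: measurableI.
rewrite mulrAC -mulrBl normrM [X in _ * X](ger0_norm (lam_ge0 _)).
apply: le_trans (doubling_mixing n b mE); rewrite ler_piMr// -lamT.
by apply: lamS.
Qed.

Lemma cvg_half_expr : (2^-1 ^+ n : R) @[n --> \oo] --> (0 : R).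
Proof. by apply: cvg_expr; rewrite ger0_norm ?invr_ge0//; lra. Qed.

(* The error carries the factor lam E, which every pull-back of a corner halves. *)
Lemma baker_mixing_corner b c E a p (e : R) : measurable E -> 0 < e ->
  exists N : nat, forall n, (N <= n)%N ->
  `|mu ((bel b `*` bel c) `&` iter n (@baker R) @^-1` (E `*` bel a)) -
    mu (bel b `*` bel c) * (lam E * lam (bel a))| <= lam E * 2^-1 ^+ p + e.
Proof.
set B := bel b `*` bel c; have mb := @measurable_below R (cc01 R).
have mB : measurable B by exact: measurableX.
have mu01 C : measurable C -> 0 <= mu C <= 1.
  move=> mC; rewrite mu_ge0/=; have <- : mu setT = 1 by exact: (congr1 fine (probability_setT m2)).
  exact: muS.
move=> mE; elim: p E mE a e => [|p ih] E mE a e e0.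
  (* For [p = 0] both quantities lie between 0 and [lam E], by invariance of [mu]. *)
  exists 0%N => n _; have mA : measurable (E `*` bel a) by exact: measurableX.
  have mAn := @measurable_iter_baker_pre n _ mA.
  have h1 : mu (B `&` iter n (@baker R) @^-1` (E `*` bel a)) <= lam E * lam (bel a).
    by rewrite -mu_rect// -(mu_baker_iter n mA); apply: muS => //; exact: measurableI.
  have h2 := mu_ge0 (B `&` iter n (@baker R) @^-1` (E `*` bel a)).
  have /andP[B0 B1] := mu01 _ mB.
  have a1 : lam (bel a) <= 1 by rewrite -lamT; exact: lamS.
  have Ea : lam E * lam (bel a) <= lam E by rewrite ler_piMr// lam_ge0.
  have Ea0 : 0 <= lam E * lam (bel a) by rewrite mulr_ge0// lam_ge0.
  have h3 : mu B * (lam E * lam (bel a)) <= lam E * lam (bel a) by rewrite ler_piMl.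
  have h4 : 0 <= mu B * (lam E * lam (bel a)) by rewrite mulr_ge0.
  rewrite expr0 mulr1; move: h1 h2 h3 h4 Ea; clear -e0.
  move: (lam E) (lam E * _) (mu B * _) (mu _) => k r q p.
  by move=> ? ? ? ? ?; rewrite ler_norml; apply/andP; split; lra.
have [m0 m1] := measurable_half_pre mE.
have lE0 := lam_half0 mE; have lE1 := lam_half1 mE.
set E0 := half0 `&` _ in m0 lE0; set E1 := half1 `&` _ in m1 lE1.
have preE n : iter n.+1 (@baker R) @^-1` (E `*` bel a) =
    (iter n (@baker R) @^-1` (E0 `*` bel (2 * a))) `|`
    (iter n (@baker R) @^-1` (E1 `*` bel (2 * a - 1))).
  by rewrite -preimage_setU -baker_pre_rect.
(* For [a <= 1/2] only the rectangle over [E0] remains, and its base has half the measure of [E]. *)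
have [a2|a2] := leP a 2^-1.
  have [N hN] := ih _ m0 (2 * a) e e0; exists N.+1 => -[//|n]; rewrite ltnS => /hN.
  rewrite preE (_ : bel (2 * a - 1) = set0); last by apply: below_cc01_le0; lra.
  rewrite setX0 preimage_set0 setU0 lE0 (lam_below_halve a).
  rewrite (_ : lam (bel (2 * a - 1)) = 0); last first.
    by apply: lam_below_le0; lra.
  rewrite exprS; move: (_ ^+ _) (mu _) (mu _) => x y z.
  move: (lam E) (lam (bel _)) => t w.
  have -> : y * (t / 2 * w) = y * (t * ((w + 0) / 2)) by lra.
  have -> : t / 2 * x = t * (2^-1 * x) by lra.
  by [].
(* For [a > 1/2] the rectangle over [E0] is a full strip, whose mixing is known, and the induction
   applies over [E1]. *)
have e20 : 0 < e / 2 by rewrite divr_gt0.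
have [N1 hN1] := ih _ m1 (2 * a - 1) (e / 2) e20.
have [N2 hN2] : exists N : nat, (2^-1 ^+ N : R) < e / 2.
  have := cvg_half_expr => /cvgrPdist_lt /(_ _ e20)[N _ /(_ N (leqnn N))/=].
  by rewrite sub0r normrN => h; exists N; apply: le_lt_trans (ler_norm _) h.
exists (maxn N1 N2).+1 => -[//|n]; rewrite ltnS geq_max => /andP[n1 n2].
have := hN1 n n1.
have := @baker_mixing_vertical b c _ n m0; rewrite -/B.
have : (2^-1 ^+ n : R) <= 2^-1 ^+ N2.
  by apply: ler_wiXn2l => //; rewrite ?invr_ge0//; lra.
rewrite preE (_ : bel (2 * a) = setT); last by apply: below_ge1; lra.
have mX0 : measurable (E0 `*` (setT : set X)) by exact: measurableX.
have mX1 : measurable (E1 `*` bel (2 * a - 1)) by exact: measurableX.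
have mXn0 := @measurable_iter_baker_pre n _ mX0.
have mXn1 := @measurable_iter_baker_pre n _ mX1.
rewrite setIUr muU; [|exact: measurableI|exact: measurableI|]; last first.
  by apply/seteqP; split=> // q [[_ [[h _] _]] [_ [[h' _] _]]].
rewrite lE0 lE1 (lam_below_halve a) (_ : lam (bel (2 * a)) = 1); last first.
  by rewrite below_ge1 ?lamT//; lra.
rewrite exprS; move: (mu _) (mu _) (mu B) (lam (bel _)) (lam E) hN2 => x y z w t.
move: (_ ^+ _) (_ ^+ n) (_ ^+ p) => u v s hu hv.
rewrite !ler_norml => /andP[h1 h2] /andP[h3 h4].
have E1' : z * (t * ((1 + w) / 2)) = z * (t / 2) + z * (t / 2 * w) by lra.
have E2' : t * (2^-1 * s) = t / 2 * s by lra.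
by rewrite E1' E2'; apply/andP; split; lra.
Qed.

Lemma half_expr_lt (e : R) : 0 < e -> exists p : nat, (2^-1 ^+ p : R) < e.
Proof.
move=> e0; have /cvgrPdist_lt /(_ _ e0)[N _ /(_ N (leqnn N))/=] := cvg_half_expr.
by rewrite sub0r normrN => h; exists N; apply: le_lt_trans (ler_norm _) h.
Qed.

Lemma baker_mixing (A B : set (X * X)) : corners A -> corners B ->
  fine (m2 (B `&` iter n (@baker R) @^-1` A)) @[n --> \oo] --> fine (m2 B) * fine (m2 A).
Proof.
move=> [b _ [a _ <-]] [b' _ [c' _ <-]]; have mb := @measurable_below R (cc01 R).
apply/cvgrPdist_le => e e0; have e20 : 0 < e / 2 by rewrite divr_gt0.
have [p hp] := half_expr_lt e20.
have [N hN] := @baker_mixing_corner b' c' _ a p _ (mb b) e20.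
exists N => // n /hN h; rewrite distrC.
have -> : fine (m2 (bel b `*` bel a)) = lam (bel b) * lam (bel a) by exact: mu_rect.
apply: le_trans h _.
have l1 : lam (bel b) <= 1 by rewrite -lamT; exact: lamS.
have : lam (bel b) * 2^-1 ^+ p <= 2^-1 ^+ p by rewrite ler_piMl// exprn_ge0// invr_ge0.
by lra.
Qed.

Lemma baker_propAC : propAC (PF (m := m2) (@baker R)).
Proof.
apply: (mixing_propAC nonsingular_baker leb2_baker corners_generate corners_setI).
exact: baker_mixing.
Qed.

Lemma baker_iter_snd_lt1 n (p : X * X) : (msub_val p.2 : R) < 1 ->
  (msub_val (iter n (@baker R) p).2 : R) < 1.
Proof.
move=> p1; elim: n => // n; rewrite iterS; move: (iter n _ p) => q q1.
by rewrite baker_sndE /baker_snd; case: ifP => _; lra.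
Qed.

(** The baker map halves the height and adds 1/2 over the right half; doubling undoes both. Height 1
    over the left half has to be excluded: it goes to 1/2, which doubles to 0. *)
Lemma doubling_baker_snd (p : X * X) : (msub_val p.2 : R) < 1 ->
  doubling (baker p).2 = p.2.
Proof.
move=> p1; apply: msub_val_inj; rewrite [LHS]doublingE baker_sndE /baker_fst /baker_snd.
have /= := set_mem (svalP p.2); rewrite in_itv /= -/(msub_val p.2) => /andP[p0 _].
by case: (ltP (msub_val p.1 : R) 2^-1) => h; case: ifP => [|/negbT]; rewrite -?leNgt; lra.
Qed.

Lemma iter_doubling_baker_snd n (p : X * X) : (msub_val p.2 : R) < 1 ->
  iter n doubling (iter n (@baker R) p).2 = p.2.
Proof.
move=> p1; elim: n => // n ih; rewrite [iter n.+1 (@baker R) _]iterS iterSr.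
by rewrite doubling_baker_snd//; exact: baker_iter_snd_lt1.
Qed.

Let H : set (X * X) := setT `*` bel 2^-1.

Let mH : measurable H.
Proof. by apply: measurableX => //; exact: measurable_below. Qed.

(** The heights whose binary digit at place [n + 1] is 0. Each step pushes the digits of the height
    down by one place and inserts the first digit of the abscissa, so after [n] steps this place
    shows the first digit of the initial height. *)
Let A_ n : set (X * X) := setT `*` (iter n doubling @^-1` bel 2^-1).

Let mA n : measurable (A_ n).
Proof. by apply: measurableX => //; apply: measurable_doubling_pre; exact: measurable_below. Qed.

Let muH : mu H = 2^-1.
Proof. by rewrite /H mu_rect//; [rewrite lamT mul1r lam_half0T|exact: measurable_below]. Qed.

Let H_lt1 (p : X * X) : H p -> (msub_val p.2 : R) < 1.
Proof. by move=> [_]; rewrite /below /mkset; lra. Qed.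

Let muHA n : mu (H `&` iter n (@baker R) @^-1` A_ n) = 2^-1.
Proof.
rewrite -[RHS]muH; congr mu; apply/seteqP; split=> [p []//|p Hp]; split=> //.
rewrite /preimage /mkset; split => //; rewrite /preimage /mkset iter_doubling_baker_snd//.
  by case: Hp.
exact: H_lt1.
Qed.

(** By this time the place holds digit [k.+1] of the initial abscissa, which is independent of the
    height and is 0 on half of [H]. *)
Let muHA_later n k : mu (H `&` iter (n + k.+1) (@baker R) @^-1` A_ n) = 4^-1.
Proof.
have mh := @measurable_doubling_pre k _ measurable_half0.
have -> : H `&` iter (n + k.+1) (@baker R) @^-1` A_ n =
    (iter k doubling @^-1` half0) `*` bel 2^-1.
  have E p : H p -> A_ n (iter (n + k.+1) (@baker R) p) <->
      half0 (iter k doubling p.1).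
    move=> Hp; have q1 := baker_iter_snd_lt1 k.+1 (H_lt1 Hp).
    rewrite iterD -baker_iter_fst; rewrite /A_ /setX /preimage /mkset iter_doubling_baker_snd//.
    have := baker_iter_snd_lt1 k (H_lt1 Hp).
    rewrite iterS; move: (iter k _ p) => q {}q1.
    have /= := set_mem (svalP q.2); rewrite in_itv /= -/(msub_val q.2) => /andP[q0 _].
    rewrite /half0 /below /mkset baker_sndE /baker_snd.
    case: (ltP (msub_val q.1 : R) 2^-1) => h; split => //.
      by move=> _; split => //; lra.
    by move=> [_ h']; lra.
  apply/seteqP; split=> p.
    by move=> [Hp /(E _ Hp) h]; split => //; case: Hp.
  move=> [h1 h2]; have Hp : H p by split.
  by split => //; apply/(E _ Hp).
rewrite mu_rect//; last exact: measurable_below.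
by rewrite lam_doubling_iter ?lam_half0T//; [rewrite -invfM; congr (_^-1); lra|exact: measurable_half0].
Qed.

Lemma baker_not_propC : ~ propC (PF (m := m2) (@baker R)).
Proof.
have H0 : (0 < m2 H)%E.
  by rewrite -(fineK (fin_num_measure m2 _ mH)) lte_fin -/(mu H) muH invr_gt0.
have c0 : (0 : R) < 2^-1 by rewrite invr_gt0.
have dh := uniform_density_density mH H0.
apply: (not_propC (m := m2) c0 dh) => n k.
set h := uniform_density _ _.
have hE C : measurable C -> L1_int C h = 2 * mu (H `&` C).
  move=> mC; rewrite [LHS](L1_int_uniform m2)//.
  by rewrite -/(mu H) muH invrK mulrC.
have mAn j := @measurable_iter_baker_pre j _ (mA n).
(* On [A_ n] the two images have masses [2 * 1/2] and [2 * 1/4], which differ by the claimed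
   separation. *)
apply: le_trans (le_L1_int_norm (m := m2) _ (mA n)).
rewrite L1_intB// !(PF_iter_int nonsingular_baker)// !hE// muHA muHA_later.
by apply: le_trans (ler_norm _); lra.
Qed.

End baker_basics.

(** * The dual norm of bounded variation *)

Section bounded_pairing.
Context d (T : measurableType d) (R : realType).
Variable m : probability T R.
Implicit Types (x y : L1 m) (u v : T -> R) (A : set T).

Definition bounded_measurable u : Prop :=
  measurable_fun setT u /\ exists M, forall t, `|u t| <= M.

(** The bounded factor stays an honest function, and only [x] is a class, so [u] can be composed
    with [g] regardless of null sets. *)
Definition pairing x u : R := \int[m]_t (u t * x t).

Lemma bounded_measurable_ge0 u : bounded_measurable u ->
  exists2 M : R, 0 <= M & forall t, `|u t| <= M.
Proof.
move=> [_ [M uM]]; exists M => //; exact: le_trans (uM point).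
Qed.

Lemma bounded_measurableD u v : bounded_measurable u -> bounded_measurable v ->
  bounded_measurable (u \+ v).
Proof.
move=> [mu [M uM]] [mv [N vN]]; split; first exact: measurable_funD.
by exists (M + N) => t; apply: le_trans (ler_normD _ _) _; exact: lerD.
Qed.

Lemma bounded_measurableZ a u : bounded_measurable u -> bounded_measurable (a \*: u).
Proof.
move=> [mu [M uM]]; split; first exact: measurable_funM.
by exists (`|a| * M) => t /=; rewrite normrM ler_wpM2l.
Qed.

Lemma bounded_measurableM u v : bounded_measurable u -> bounded_measurable v ->
  bounded_measurable (u \* v).
Proof.
move=> [mu [M uM]] [mv [N vN]]; split; first exact: measurable_funM.
by exists (M * N) => t /=; rewrite normrM; exact: ler_pM.
Qed.

Lemma bounded_measurable_indic A : measurable A -> bounded_measurable (\1_A : T -> R).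
Proof.
move=> mA; split; first exact: measurable_indic.
by exists 1 => t; rewrite indicE ger0_norm// lern1 leq_b1.
Qed.

Lemma bounded_measurable_cst a : bounded_measurable (fun=> a).
Proof. by split; [exact: measurable_cst|exists `|a|]. Qed.

Lemma bounded_measurable_sum I (s : seq I) (F : I -> T -> R) :
  (forall i, bounded_measurable (F i)) ->
  bounded_measurable (fun t => \sum_(i <- s) F i t).
Proof.
move=> bF; elim: s => [|i s ih].
  under eq_fun do rewrite big_nil; exact: bounded_measurable_cst.
under eq_fun do rewrite big_cons; exact: bounded_measurableD.
Qed.

Lemma bounded_measurable_integrable u : bounded_measurable u ->
  m.-integrable setT (EFin \o u).
Proof. by move=> [mu [M uM]]; exact: bounded_integrable mu uM. Qed.

Lemma pairing_integrable x u : bounded_measurable u ->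
  m.-integrable setT (EFin \o (fun t => u t * x t)).
Proof.
move=> [mu [M uM]].
have Mx : m.-integrable setT (EFin \o (fun t => M * x t)).
  exact: (integrableZl measurableT M (integrable_L1 x)).
apply: (le_integrable _ _ _ Mx) => //.
  by apply/measurable_EFinP; apply: measurable_funM => //; exact: measurable_L1.
move=> t _; rewrite /= lee_fin !normrM ler_wpM2r//.
by rewrite (le_trans (uM t))// ler_norm.
Qed.

Lemma pairing_scaleD a x y u : bounded_measurable u ->
  pairing (a *: x + y) u = a * pairing x u + pairing y u.
Proof.
move=> bu; have [mu _] := bu.
have ix := pairing_integrable x bu; have iy := pairing_integrable y bu.
have iax : m.-integrable setT (EFin \o (fun t => a * (u t * x t))).
  exact: (integrableZl measurableT a ix).
rewrite /pairing -RintegralZl// -RintegralD//; apply: ae_eq_Rintegral => //.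
- by apply: measurable_funM => //; exact: measurable_L1.
- by apply: measurable_funD; do ?apply: measurable_funM => //; exact: measurable_L1.
move: (L1_add_ae (a *: x) y); apply: filter_app.
move: (L1_scale_ae a x); apply: filterS => t e1 e2 _.
by rewrite e2//= e1//= mulrDr mulrCA.
Qed.

Lemma pairingZl a x u : bounded_measurable u -> pairing (a *: x) u = a * pairing x u.
Proof.
move=> bu; have p0 : pairing 0 u = 0.
  have := pairing_scaleD (-1) 0 0 bu; rewrite scaler0 addr0 mulN1r addNr; exact.
by have := pairing_scaleD a x 0 bu; rewrite p0 !addr0.
Qed.

Lemma pairingBl x y u : bounded_measurable u ->
  pairing (x - y) u = pairing x u - pairing y u.
Proof. by move=> bu; rewrite addrC -scaleN1r pairing_scaleD// mulN1r addrC. Qed.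

Lemma pairing_scaleDr a x u v : bounded_measurable u -> bounded_measurable v ->
  pairing x (fun t => a * u t + v t) = a * pairing x u + pairing x v.
Proof.
move=> bu bv; have iu := pairing_integrable x bu; have iv := pairing_integrable x bv.
have iau : m.-integrable setT (EFin \o (fun t => a * (u t * x t))).
  exact: (integrableZl measurableT a iu).
rewrite /pairing -RintegralZl// -RintegralD//; apply: eq_Rintegral => t _ /=.
by rewrite mulrDl mulrA.
Qed.

Lemma pairingZr a x u : bounded_measurable u ->
  pairing x (a \*: u) = a * pairing x u.
Proof.
move=> bu; rewrite /pairing -RintegralZl//; last exact: pairing_integrable.
by apply: eq_Rintegral => t _ /=; rewrite mulrA.
Qed.

Lemma pairingDr x u v : bounded_measurable u -> bounded_measurable v ->
  pairing x (u \+ v) = pairing x u + pairing x v.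
Proof.
move=> bu bv; have := pairing_scaleDr 1 x bu bv; rewrite mul1r => <-.
by congr pairing; apply/funext => t; rewrite mul1r.
Qed.

Lemma pairingBr x u v : bounded_measurable u -> bounded_measurable v ->
  pairing x (u \- v) = pairing x u - pairing x v.
Proof.
move=> bu bv; have := pairing_scaleDr (-1) x bv bu; rewrite mulN1r addrC => <-.
by congr pairing; apply/funext => t; rewrite mulN1r addrC.
Qed.

Lemma pairing0r x : pairing x (fun=> 0) = 0.
Proof.
have := pairingZr 0 x (bounded_measurable_cst 0); rewrite mul0r => {2}<-.
by congr pairing; apply/funext => t; exact/esym/mulr0.
Qed.

Lemma pairing_sum I (s : seq I) x (F : I -> T -> R) :
  (forall i, bounded_measurable (F i)) ->
  pairing x (fun t => \sum_(i <- s) F i t) = \sum_(i <- s) pairing x (F i).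
Proof.
move=> bF; elim: s => [|i s ih].
  by under eq_fun do rewrite big_nil; rewrite big_nil pairing0r.
under eq_fun do rewrite big_cons; rewrite big_cons -ih.
by apply: pairingDr => //; exact: bounded_measurable_sum.
Qed.

Lemma le_pairing_norm x u M : measurable_fun setT u -> (forall t, `|u t| <= M) ->
  `|pairing x u| <= M * `|x|.
Proof.
move=> mu uM; have bu : bounded_measurable u by split=> //; exists M.
have iu := pairing_integrable x bu.
apply: (le_trans (le_normr_Rintegral measurableT iu)).
rewrite L1_norm_Rint -RintegralZl//; last exact: integrable_L1norm.
apply: le_Rintegral => //.
- by have := integrable_norm iu.
- exact: (integrableZl measurableT M (integrable_L1norm x measurableT)).
- by move=> t _ /=; rewrite normrM ler_wpM2r.
Qed.

Lemma pairing_indic x A : measurable A -> pairing x \1_A = L1_int A x.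
Proof.
move=> mA; rewrite /L1_int (@Rintegral_mkcond _ _ _ m)//; apply: eq_Rintegral => t _.
by rewrite patchE indicE; case: ifP => _; rewrite ?mul1r ?mul0r.
Qed.

Lemma pairing_mk f u : m.-integrable setT (EFin \o f) -> bounded_measurable u ->
  pairing (L1_mk m f) u = \int[m]_t (u t * f t).
Proof.
move=> fi [mu _]; apply: ae_eq_Rintegral => //.
- by apply: measurable_funM => //; exact: measurable_L1.
- by apply: measurable_funM => //; apply/measurable_EFinP; exact: measurable_int fi.
- by move: (L1_mk_ae fi); apply: filterS => t /= e _; rewrite e.
Qed.

(** The sign of [x] attains the norm, which lets norms be estimated by duality. *)
Lemma L1_norm_pairing x : exists u, [/\ measurable_fun setT u,
  forall t, `|u t| <= 1 & `|x| = pairing x u].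
Proof.
have mP := measurable_L1_pos x; have mN := measurableC mP.
have bP := bounded_measurable_indic mP; have bN := bounded_measurable_indic mN.
exists (\1_(L1_pos x) \- \1_(~` L1_pos x)); split.
- by apply: measurable_funB; [case: bP|case: bN].
- move=> t; rewrite /= !indicE in_setC.
  by case: (t \in _); rewrite /= ?subr0 ?sub0r ?normrN normr1.
- by rewrite pairingBr// !pairing_indic// L1_norm_pos.
Qed.

End bounded_pairing.

Section pairing_transfer.
Context d1 d2 (T1 : measurableType d1) (T2 : measurableType d2) (R : realType).
Variables (m1 : probability T1 R) (m2 : probability T2 R) (r : T1 -> T2).
Variables (x : L1 m1) (y : L1 m2).
Hypothesis mr : measurable_fun setT r.
Hypothesis rxy : forall B, measurable B -> L1_int (r @^-1` B) x = L1_int B y.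
Implicit Type u : T2 -> R.

Lemma bounded_measurable_comp u : bounded_measurable u -> bounded_measurable (u \o r).
Proof. by move=> [mu [M uM]]; split; [exact: measurableT_comp|exists M => t /=]. Qed.

(** Layer-cake form of rounding [u] down to a multiple of [1 / N], for [0 <= u <= 1]: a combination
    of indicators, to which [rxy] applies. *)
Let steps N u : T2 -> R :=
  fun t => \sum_(k < N) N%:R^-1 * \1_[set t | k.+1%:R <= N%:R * u t] t.

Let stepsE N u t : 0 <= u t <= 1 -> steps N u t = (Num.truncn (N%:R * u t))%:R / N%:R.
Proof.
move=> /andP[u0 u1]; have Nu0 : 0 <= N%:R * u t by rewrite mulr_ge0.
have TN : (Num.truncn (N%:R * u t) <= N)%N.
  by have := truncn_le (N%:R * u t); rewrite Nu0 -(ler_nat R) => /le_trans; apply; rewrite ler_piMr.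
rewrite /steps -mulr_sumr mulrC; congr (_ / _).
rewrite (eq_bigr (fun k : 'I_N => ((k < Num.truncn (N%:R * u t))%N)%:R)); last first.
  by move=> k _; rewrite indicE truncn_gt_nat; congr (nat_of_bool _)%:R; apply/idP/idP; rewrite inE.
rewrite -natr_sum; congr (_%:R); move: (Num.truncn _) TN => K KN.
by rewrite -big_mkcond/= -(big_ord_widen N (fun=> 1%N) KN) sum1_card card_ord.
Qed.

Let measurable_step N u k : measurable_fun setT u ->
  measurable [set t | (k.+1%:R : R) <= N%:R * u t].
Proof.
move=> mu; rewrite -[X in measurable X]setTI; apply: measurable_fun_le => //.
exact: measurable_funM.
Qed.

Let pairing_steps N u : measurable_fun setT u ->
  pairing x (steps N u \o r) = pairing y (steps N u).
Proof.
move=> mu; have mB k := @measurable_step N u k mu.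
have mrB k : measurable (r @^-1` [set t | (k.+1%:R : R) <= N%:R * u t]).
  by rewrite -[X in measurable X]setTI; exact: mr.
have bi k := bounded_measurable_indic R (mB k).
have bri k := bounded_measurable_indic R (mrB k).
rewrite (pairing_sum _ y (fun k : 'I_N => bounded_measurableZ N%:R^-1 (bi k))).
rewrite (_ : steps N u \o r = fun t => \sum_(k < N)
    (N%:R^-1 \*: \1_(r @^-1` [set t | k.+1%:R <= N%:R * u t])) t)//.
rewrite (pairing_sum _ x (fun k : 'I_N => bounded_measurableZ N%:R^-1 (bri k))).
by apply: eq_bigr => k _; rewrite !pairingZr// !pairing_indic// rxy.
Qed.

Let pairing_transfer01 u : measurable_fun setT u -> (forall t, 0 <= u t <= 1) ->
  pairing x (u \o r) = pairing y u.
Proof.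
move=> mu u01.
have bu : bounded_measurable u.
  by split=> //; exists 1 => t; have /andP[u0 u1] := u01 t; rewrite ger0_norm.
have bs N : bounded_measurable (steps N u).
  apply: bounded_measurable_sum => k; apply: bounded_measurableZ.
  exact/bounded_measurable_indic/measurable_step.
have close N t : `|u t - steps N.+1 u t| <= N.+1%:R^-1.
  rewrite stepsE//; have /andP[u0 _] := u01 t.
  have N0 : 0 < (N.+1%:R : R) by rewrite ltr0n.
  have /andP[h1 h2] := truncn_itv (mulr_ge0 (ltW N0) u0).
  rewrite ger0_norm ?subr_ge0 ?ler_pdivrMr 1?[u t * _]mulrC//.
  rewrite -(ler_pM2l N0) mulrBr divff ?gt_eqF// mulrCA divff ?gt_eqF// mulr1.
  by rewrite lerBlDl natr1; exact: ltW.
apply/eqP; rewrite -subr_eq0 -normr_le0; apply/ler_addgt0Pl => e e0; rewrite addr0.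
pose K := `|x| + `|y| + 1; have K0 : 0 < K by rewrite ltr_wpDl// addr_ge0.
have [N hN] : exists N : nat, (N.+1%:R^-1 : R) < e / K.
  by have [N] := ltr_add_invr (divr_gt0 e0 K0); rewrite add0r => h; exists N.
have hx : `|pairing x ((u \- steps N.+1 u) \o r)| <= N.+1%:R^-1 * `|x|.
  apply: le_pairing_norm => [|t]; last exact: close.
  by apply: measurableT_comp => //; apply: measurable_funB => //; case: (bs N.+1).
have hy : `|pairing y (u \- steps N.+1 u)| <= N.+1%:R^-1 * `|y|.
  apply: le_pairing_norm => [|t]; last exact: close.
  by apply: measurable_funB => //; case: (bs N.+1).
rewrite (pairingBr y bu (bs _)) in hy.
rewrite (_ : _ \o r = (u \o r) \- (steps N.+1 u \o r))// in hx.
rewrite (pairingBr x (bounded_measurable_comp bu) (bounded_measurable_comp (bs _))) in hx.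
rewrite pairing_steps// in hx.
have h : `|pairing x (u \o r) - pairing y u| <= N.+1%:R^-1 * K.
  rewrite (_ : _ - _ = (pairing x (u \o r) - pairing y (steps N.+1 u)) -
    (pairing y u - pairing y (steps N.+1 u))); last first.
    by move: (pairing _ _) (pairing _ _) (pairing _ _) => a b c; lra.
  apply: le_trans (ler_normB _ _) _; rewrite !mulrDr mulr1.
  by apply: ler_wpDr; [rewrite invr_ge0|exact: lerD].
apply: le_trans h _; rewrite -ler_pdivlMr//; exact: ltW.
Qed.

Lemma pairing_transfer u : bounded_measurable u -> pairing x (u \o r) = pairing y u.
Proof.
move=> bu; have [M M0 uM] := bounded_measurable_ge0 bu; have [mu _] := bu.
(* [v] is [u] rescaled affinely into [[0, 1]]; the added 1 keeps the divisor positive when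
   [M = 0]. *)
have c0 : 0 < 2 * M + 1 by lra.
pose v t := (2 * M + 1)^-1 * (u t + M).
have mv : measurable_fun setT v by apply: measurable_funM => //; exact: measurable_funD.
have v01 t : 0 <= v t <= 1.
  have := uM t; rewrite ler_norml => /andP[h1 h2].
  apply/andP; split; first by rewrite mulr_ge0 ?invr_ge0//; lra.
  by rewrite /v mulrC ler_pdivrMr//; lra.
have b1 d (T : measurableType d) : bounded_measurable ((fun=> (- M) * 1) : T -> R).
  exact: bounded_measurable_cst.
have bv : bounded_measurable v.
  by split=> //; exists 1 => t; have /andP[h0 h1] := v01 t; rewrite ger0_norm.
have uE : u = fun t => (2 * M + 1) * v t + (- M) * 1.
  by apply/funext => t; rewrite /v mulrA divff ?gt_eqF// mul1r mulr1 addrK.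
rewrite [in RHS]uE [in LHS]uE pairing_scaleDr//.
rewrite (_ : _ \o r = fun t => (2 * M + 1) * (v \o r) t + (- M) * 1)//.
rewrite pairing_scaleDr//; last exact: bounded_measurable_comp.
rewrite pairing_transfer01//; congr (_ + _).
rewrite (@pairingZr _ _ _ m1 (- M) x (fun=> 1)); last exact: bounded_measurable_cst.
rewrite (@pairingZr _ _ _ m2 (- M) y (fun=> 1)); last exact: bounded_measurable_cst.
congr (_ * _); rewrite -[LHS]/(pairing x ((fun=> 1) \o r)).
by apply: pairing_transfer01 => // t; rewrite ler01 lexx.
Qed.

End pairing_transfer.

Section PF_pairing.
Context d (T : measurableType d) (R : realType).
Variables (m : probability T R) (g : T -> T).
Hypothesis gns : nonsingular m g.

Lemma PF_iter_pairing n (x : L1 m) (u : T -> R) : bounded_measurable u ->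
  pairing (iter n (PF g) x) u = pairing x (u \o iter n g).
Proof.
move=> bu; apply/esym/pairing_transfer => //; first exact: (measurable_iter gns).
by move=> B mB; rewrite (PF_iter_int gns).
Qed.

End PF_pairing.

(** * Completeness of L1 *)

Section L1_completeness.
Context d (T : measurableType d) (R : realType).
Variable m : probability T R.
Implicit Types (x y h : L1 m) (A : set T).

Lemma L1_norm_le2 x (c : R) : (forall A, measurable A -> `|L1_int A x| <= c) ->
  `|x| <= 2 * c.
Proof.
move=> xc; have mP := measurable_L1_pos x; rewrite L1_norm_pos.
have h1 := xc _ mP; have h2 := xc _ (measurableC mP).
apply: le_trans (ler_norm _) _; apply: le_trans (ler_normB _ _) _.
by move: h1 h2; move: `|_| `|_| => a b; lra.
Qed.

Variables (F : set_system (L1 m)) (PF : ProperFilter F).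
Hypothesis F_cauchy : forall e : R, 0 < e -> exists y, \forall h \near F, `|h - y| <= e.

Let nu A : R := lim (L1_int A h @[h --> F]).

Let nuP A : measurable A -> L1_int A h @[h --> F] --> nu A.
Proof.
move=> mA; apply: cauchy_cvg; apply: cauchy_exP => e e0.
have [y hy] := F_cauchy (divr_gt0 e0 (ltr0n R 2)).
exists (L1_int A y); rewrite /ball_/nbhs/=; apply: filterS hy => h hy.
rewrite /preimage /mkset /ball/= distrC -L1_intB//.
apply: le_lt_trans (le_L1_int_norm _ mA) _; apply: le_lt_trans hy _.
by rewrite ltr_pdivrMr//; lra.
Qed.

Let nu_close (e : R) y A : measurable A -> (\forall h \near F, `|h - y| <= e) ->
  `|nu A - L1_int A y| <= e.
Proof.
move=> mA hy; apply/ler_addgt0Pl => c c0.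
have /cvgrPdist_le /(_ _ c0) hn := nuP mA.
have [h [h1 h2]] := filter_ex (filterI hn hy).
rewrite (_ : _ - _ = (nu A - L1_int A h) + L1_int A (h - y)); last first.
  by rewrite L1_intB// addrA subrK.
apply: le_trans (ler_normD _ _) _; apply: lerD => //.
exact: le_trans (le_L1_int_norm _ mA) h2.
Qed.

Let nu_bigU (G : (set T)^nat) n : (forall i, measurable (G i)) -> trivIset setT G ->
  \sum_(0 <= i < n) nu (G i) = nu (\big[setU/set0]_(i < n) G i).
Proof.
move=> mG tG; have mS k : measurable (\big[setU/set0]_(i < k) G i).
  exact: bigsetU_measurable.
have h1 : (fun h => \sum_(0 <= i < n) L1_int (G i) h) @ F -->
    nu (\big[setU/set0]_(i < n) G i).
  by under eq_fun do rewrite -L1_int_bigsetU//; exact: nuP.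
have h2 : (fun h => \sum_(0 <= i < n) L1_int (G i) h) @ F --> \sum_(0 <= i < n) nu (G i).
  by apply: cvg_big => [|i _]; [exact: add_continuous|exact: nuP].
exact: (cvg_unique _ h2 h1).
Qed.

(** Set integrals converge along [F] uniformly in the set, so the limit set function inherits
    countable additivity and absolute continuity, and its density is the limit. *)
Lemma L1_complete : exists x, F --> x.
Proof.
have [x xnu] : exists x : L1 m, forall A, measurable A -> L1_int A x = nu A.
  apply: L1_Radon_Nikodym => [G mG tG|A mA A0].
    have mU : measurable (\bigcup_k G k) by exact: bigcup_measurable.
    apply/cvgrPdist_le => e e0; have e30 : 0 < e / 3 by rewrite divr_gt0.
    have [y hy] := F_cauchy e30.
    have /cvgrPdist_le /(_ _ e30) := @L1_int_sigma _ _ _ m y G mG tG.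
    apply: filterS => n; rewrite nu_bigU//.
    have mS : measurable (\big[setU/set0]_(i < n) G i) by exact: bigsetU_measurable.
    rewrite -L1_int_bigsetU//.
    have := nu_close mU hy; have := nu_close mS hy.
    rewrite !ler_norml; move: (nu _) (nu _) (L1_int _ _) (L1_int _ _) => a b c f.
    by move=> /andP[? ?] /andP[? ?] /andP[? ?]; apply/andP; split; lra.
  apply/eqP; rewrite -normr_le0; apply/ler_addgt0Pl => e e0; rewrite addr0.
  have [y hy] := F_cauchy e0; have := nu_close mA hy.
  by rewrite L1_int_null// subr0.
exists x; apply/cvgrPdist_le => e e0; have e30 : 0 < e / 3 by rewrite divr_gt0.
have [y hy] := F_cauchy e30; apply: filterS (hy) => h hh.
have xy : `|x - y| <= 2 * (e / 3).
  by apply: L1_norm_le2 => A mA; rewrite L1_intB// xnu//; exact: nu_close.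
rewrite (_ : x - h = (x - y) - (h - y)); last by rewrite opprB addrA subrK.
apply: le_trans (ler_normB _ _) _; lra.
Qed.

End L1_completeness.

(** * Averaging over a grid *)

Section cells.
Context (R : realType).
Notation l := (@leb_cc01 R).
Notation X := (msub (cc01 R)).
Notation btw := (between (cc01 R)).
Implicit Types (u v : X -> R) (x y : L1 l) (z : X) (s t : R).

Definition int_between s t u : R := pairing (L1_indic l (btw s t)) u.

Lemma norm_int_between s t u M : 0 <= s -> s <= t -> t <= 1 -> measurable_fun setT u ->
  (forall z, `|u z| <= M) -> `|int_between s t u| <= M * (t - s).
Proof.
move=> s0 st t1 mu uM; apply: le_trans (le_pairing_norm _ mu uM) _.
have mst := measurable_between (cc01 R) s t.
by rewrite (norm_L1_indic l mst) leb_cc01_between.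
Qed.

Lemma between_cat s t r : s <= t -> t <= r ->
  btw s r = btw s t `|` btw t r /\ btw s t `&` btw t r = set0.
Proof.
move=> st tr; split; apply/seteqP; split=> // z; rewrite /between /below /setD /setU /setI /mkset.
- move=> [zr zs]; have [zt|tz] := ltP (msub_val z : R) t; first by left.
  by right; split=> //; apply/negP; rewrite -leNgt.
- case=> -[h1 h2]; split=> //; first exact: lt_le_trans h1 tr.
  by move: h2 => /negP; rewrite -leNgt => h2; apply/negP; rewrite -leNgt (le_trans st).
- by move=> [[h1 _] [_]].
Qed.

Lemma int_between_cat s t r u : s <= t -> t <= r -> bounded_measurable u ->
  int_between s r u = int_between s t u + int_between t r u.
Proof.
move=> st tr bu; have [E E0] := between_cat st tr.
have := pairing_scaleD 1 (L1_indic l (btw s t)) (L1_indic l (btw t r)) bu.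
rewrite mul1r scale1r => <-; congr pairing; apply: L1_ext => A mA.
have m1 := measurable_between (cc01 R) s t; have m2 := measurable_between (cc01 R) t r.
rewrite L1_intD// !L1_int_indic//; last exact: measurable_between.
rewrite E setIUl [LHS](fine_measureU l)//; [exact: measurableI|exact: measurableI|].
by rewrite setIACA E0 set0I.
Qed.

Lemma int_between_nil s u : bounded_measurable u -> int_between s s u = 0.
Proof.
by move=> bu; have := int_between_cat (lexx s) (lexx s) bu; lra.
Qed.

Lemma int_betweenBr s t u v : bounded_measurable u -> bounded_measurable v ->
  int_between s t (u \- v) = int_between s t u - int_between s t v.
Proof. exact: pairingBr. Qed.

Lemma int_betweenZr a s t u : bounded_measurable u ->
  int_between s t (a \*: u) = a * int_between s t u.
Proof. exact: pairingZr. Qed.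

Variable N : nat.
Let node (k : nat) : R := k%:R / N.+1%:R.

Let N0 : 0 < (N.+1%:R : R). Proof. by rewrite ltr0n. Qed.

Let node0 : node 0 = 0. Proof. by rewrite /node mul0r. Qed.

Let nodeN : node N.+1 = 1. Proof. by rewrite /node divff// gt_eqF. Qed.

Let nodeS k : node k.+1 = node k + N.+1%:R^-1.
Proof. by rewrite /node -natr1 mulrDl mul1r. Qed.

Let node_ge0 k : 0 <= node k. Proof. by rewrite divr_ge0. Qed.

Let node_mono j k : (j <= k)%N -> node j <= node k.
Proof. by move=> jk; rewrite ler_pM2r ?invr_gt0// ler_nat. Qed.

Let node_le1 k : (k <= N.+1)%N -> node k <= 1.
Proof. by rewrite -nodeN; exact: node_mono. Qed.

Let iN0 : 0 < (N.+1%:R^-1 : R). Proof. by rewrite invr_gt0. Qed.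

Definition cell (k : nat) : set X := btw (k%:R / N.+1%:R) (k.+1%:R / N.+1%:R).

Lemma measurable_cell k : measurable (cell k).
Proof. exact: measurable_between. Qed.

Let mcell := measurable_cell.

Lemma cell_disjoint j k : j != k -> cell j `&` cell k = set0.
Proof.
wlog jk : j k / (j < k)%N.
  move=> h; rewrite neq_ltn => /orP[jk|kj]; first by apply: h => //; rewrite ltn_eqF.
  by rewrite setIC; apply: h => //; rewrite ltn_eqF.
move=> _; apply/seteqP; split=> // z [[z1 _] [_ /negP]]; rewrite -leNgt => z2.
have := lt_le_trans (lt_le_trans z1 (node_mono jk)) z2.
by rewrite ltxx.
Qed.

(** Conditional expectation on the grid, [N.+1] being the inverse of the cell length. At the point
    1, which lies in no cell, it is 0. *)
Definition cell_avg u : X -> R := fun z =>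
  \sum_(k < N.+1) (N.+1%:R * pairing (L1_indic l (cell k)) u) * \1_(cell k) z.

Lemma bounded_cell_avg u : bounded_measurable (cell_avg u).
Proof.
apply: (@bounded_measurable_sum _ X R _ _ (fun k : 'I_N.+1 =>
  (N.+1%:R * pairing (L1_indic l (cell k)) u) \*: \1_(cell k))) => k.
exact/bounded_measurableZ/bounded_measurable_indic.
Qed.

Lemma pairing_cell_avg x u : pairing x (cell_avg u) =
  \sum_(k < N.+1) N.+1%:R * pairing (L1_indic l (cell k)) u * L1_int (cell k) x.
Proof.
have bk k : bounded_measurable (\1_(cell k) : X -> R) by exact: bounded_measurable_indic.
rewrite [LHS](@pairing_sum _ X R l _ _ x (fun k : 'I_N.+1 =>
  (N.+1%:R * pairing (L1_indic l (cell k)) u) \*: \1_(cell k))); last first.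
  by move=> k; exact: bounded_measurableZ.
by apply: eq_bigr => k _; rewrite pairingZr// pairing_indic.
Qed.

Variables (u : X -> R) (eta : R).
Hypothesis bu : bounded_measurable u.
Hypothesis ueta : forall s t, 0 <= s -> s <= t -> t <= 1 -> t - s <= N.+1%:R^-1 ->
  `|int_between s t u| <= eta.

Let kap (k : nat) := N.+1%:R * pairing (L1_indic l (cell k)) u.

Let kap_le k : (k < N.+1)%N -> `|kap k| <= N.+1%:R * eta.
Proof.
move=> kN; rewrite normrM ger0_norm// ler_pM2l//; apply: ueta.
- exact: node_ge0.
- exact: node_mono.
- exact: node_le1.
- by rewrite -/(node k) -/(node k.+1) nodeS addrAC subrr add0r.
Qed.

Lemma norm_cell_avg z : `|cell_avg u z| <= N.+1%:R * eta.
Proof.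
have eta0 : 0 <= eta by apply: le_trans (ueta (lexx 0) (lexx 0) ler01 _); rewrite ?subrr.
have [[k kz]|nk] := pselect (exists k : 'I_N.+1, cell k z).
  rewrite /cell_avg (bigD1 k)//= big1 ?addr0.
    by rewrite indicE mem_set// mulr1 kap_le.
  move=> j jk; rewrite indicE memNset ?mulr0// => jz.
  have : (cell j `&` cell k) z by [].
  by rewrite cell_disjoint.
rewrite /cell_avg big1 ?normr0 ?mulr_ge0// => j _; rewrite indicE memNset ?mulr0//.
by move=> jz; apply: nk; exists j.
Qed.

Let int_cell_avg k s : (k < N.+1)%N -> node k <= s -> s <= node k.+1 ->
  int_between (node k) s (cell_avg u) = kap k * (s - node k).
Proof.
move=> kN ks sk; rewrite /int_between pairing_cell_avg (bigD1 (Ordinal kN))//= big1 ?addr0.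
  rewrite -/(kap k) L1_int_indic//; last exact: measurable_between.
  have -> : btw (node k) s `&` cell k = btw (node k) s.
    apply/setIidPl => z [z1 z2]; split=> //; exact: lt_le_trans z1 sk.
  by rewrite leb_cc01_between//; apply: le_trans sk _; exact: node_le1.
move=> j jk; rewrite L1_int_indic//; last exact: measurable_between.
rewrite (_ : _ `&` _ = set0) ?measure0 ?mulr0//.
apply/seteqP; split=> // z [[z1 z2] zj].
have : (cell j `&` cell k) z.
  by split=> //; split=> //; exact: lt_le_trans z1 sk.
by rewrite cell_disjoint.
Qed.

Let w := u \- cell_avg u.

Let bw : bounded_measurable w.
Proof.
rewrite (_ : w = fun z : X => (-1) * cell_avg u z + u z); last first.
  by apply/funext => z; rewrite mulN1r addrC.
apply: bounded_measurableD => //; exact/bounded_measurableZ/bounded_cell_avg.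
Qed.

Let int_w_partial k s : (k < N.+1)%N -> node k <= s -> s <= node k.+1 ->
  `|int_between (node k) s w| <= 2 * eta.
Proof.
move=> kN ks sk; rewrite int_betweenBr//; last exact: bounded_cell_avg.
have s1 : s <= 1 by apply: le_trans sk _; exact: node_le1.
rewrite int_cell_avg//.
have sk' : s - node k <= N.+1%:R^-1 by rewrite lerBlDl -nodeS.
have h1 : `|int_between (node k) s u| <= eta by apply: ueta.
have h2 : `|kap k * (s - node k)| <= eta.
  rewrite normrM [X in _ * X]ger0_norm ?subr_ge0//.
  have := ler_pM (normr_ge0 _) (ltac:(by rewrite subr_ge0) : 0 <= s - node k) (kap_le kN) sk'.
  by rewrite mulrAC divff ?gt_eqF// mul1r.
by apply: le_trans (ler_normB _ _) _; lra.
Qed.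

Let int_w_cell k : (k < N.+1)%N -> int_between (node k) (node k.+1) w = 0.
Proof.
move=> kN; rewrite int_betweenBr//; last exact: bounded_cell_avg.
rewrite int_cell_avg// ?node_mono//.
by rewrite nodeS addrAC subrr add0r /kap mulrC mulrA mulVf ?gt_eqF// mul1r -nodeS subrr.
Qed.

Let int_w_node k : (k <= N.+1)%N -> int_between 0 (node k) w = 0.
Proof.
elim: k => [|k ih] kN; first by rewrite node0 int_between_nil.
by rewrite (int_between_cat (node_ge0 k) (node_mono (leqnSn k)))// ih ?int_w_cell ?addr0// ltnW.
Qed.

Let int_w_prefix s : 0 <= s -> s <= 1 -> `|int_between 0 s w| <= 2 * eta.
Proof.
have eta0 : 0 <= eta by apply: le_trans (ueta (lexx 0) (lexx 0) ler01 _); rewrite ?subrr.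
move=> s0; rewrite le_eqVlt => /predU1P[->|s1].
  by have := int_w_node (leqnn N.+1); rewrite nodeN => ->; rewrite normr0 mulr_ge0.
have /andP[h1 h2] := truncn_itv (mulr_ge0 s0 (ltW N0)).
set k := Num.truncn _ in h1 h2.
have kN : (k < N.+1)%N.
  by rewrite -(ltr_nat R); apply: le_lt_trans h1 _; rewrite gtr_pMl.
have ks : node k <= s by rewrite /node ler_pdivrMr.
have sk : s <= node k.+1 by rewrite /node ler_pdivlMr// ltW.
by rewrite (int_between_cat (node_ge0 k) ks)// (int_w_node (ltnW kN)) add0r; exact: int_w_partial.
Qed.

(** The integral of [u - cell_avg N u] over a full cell is 0, so a prefix only feels its last,
    incomplete cell: at most [eta] from each of the two terms. An interval is a difference of two
    prefixes. *)
Lemma cell_avg_close s t : 0 <= s -> s <= t -> t <= 1 ->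
  `|int_between s t (u \- cell_avg u)| <= 4 * eta.
Proof.
move=> s0 st t1; have := int_between_cat s0 st bw.
have := int_w_prefix (le_trans s0 st) t1; have := int_w_prefix s0 (le_trans st t1).
rewrite -/w; move: (int_between _ _ _) (int_between _ _ _) (int_between _ _ _) => a b c.
by rewrite !ler_norml => /andP[? ?] /andP[? ?] E; apply/andP; split; lra.
Qed.

End cells.

Section bounded_variation.
Context (R : realType).
Notation l := (@leb_cc01 R).
Notation X := (msub (cc01 R)).
Notation btw := (between (cc01 R)).
Implicit Types (u v : X -> R) (x y : L1 l) (z : X) (s t V c : R).

(* A test function plays the role of the derivative of a function of sup norm
   at most 1, so that bv_le is the dual definition of the BV norm and
   needs no representative of x. *)
Definition test_function u : Prop := bounded_measurable u /\
  forall s t, 0 <= s -> s <= t -> t <= 1 -> `|int_between s t u| <= 1.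

Definition bv_le V x : Prop := forall u, test_function u -> `|pairing x u| <= V.

Lemma bv_le_scale V x u c : 0 < c -> bounded_measurable u ->
  (forall s t, 0 <= s -> s <= t -> t <= 1 -> `|int_between s t u| <= c) ->
  bv_le V x -> `|pairing x u| <= c * V.
Proof.
move=> c0 bu uc xV; have bcu := bounded_measurableZ c^-1 bu.
have : `|pairing x (c^-1 \*: u)| <= V.
  apply: xV; split=> // s t s0 st t1.
  rewrite int_betweenZr// normrM ger0_norm ?invr_ge0 ?(ltW c0)//.
  by rewrite ler_pdivrMl// mulr1; exact: uc.
by rewrite pairingZr// normrM ger0_norm ?invr_ge0 ?(ltW c0)// ler_pdivrMl.
Qed.

Lemma bv_leD V V' x y a : bv_le V x -> bv_le V' y ->
  bv_le (`|a| * V + V') (a *: x + y).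
Proof.
move=> xV yV u tu; have [bu _] := tu; rewrite pairing_scaleD//.
apply: le_trans (ler_normD _ _) _; apply: lerD; last exact: yV.
by rewrite normrM ler_wpM2l//; exact: xV.
Qed.

Lemma bv_le_between s t : 0 <= s -> s <= t -> t <= 1 ->
  bv_le 1 (L1_indic l (btw s t)).
Proof. by move=> s0 st t1 u [_ u1]; exact: u1. Qed.

(** Each test function is bounded, so each inequality defining [bv_le V] is closed in norm, although
    the test functions have no common bound. *)
Lemma bv_le_cvg V x : (forall e : R, 0 < e -> exists2 y, bv_le V y & `|x - y| <= e) ->
  bv_le V x.
Proof.
move=> xy u tu; have [bu _] := tu; have [M M0 uM] := bounded_measurable_ge0 bu.
apply/ler_addgt0Pl => e e0; have M1 : 0 < M + 1 by rewrite ltr_wpDl.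
have [y yV xye] := xy _ (divr_gt0 e0 M1).
have -> : pairing x u = pairing (x - y) u + pairing y u by rewrite pairingBl// subrK.
apply: le_trans (ler_normD _ _) _; apply: lerD; last exact: yV.
have [mu _] := bu; apply: le_trans (le_pairing_norm _ mu uM) _.
apply: (@le_trans _ _ ((M + 1) * (e / (M + 1)))).
  by apply: ler_pM => //; rewrite lerDl.
by rewrite mulrC divfK// gt_eqF.
Qed.

Definition cell_proj N x : L1 l :=
  \sum_(k < N.+1) (N.+1%:R * L1_int (@cell R N k) x) *: L1_indic l (@cell R N k).

Lemma pairing_L1_sum I (r : seq I) (F : I -> L1 l) u : bounded_measurable u ->
  pairing (\sum_(i <- r) F i) u = \sum_(i <- r) pairing (F i) u.
Proof.
move=> bu; elim: r => [|i r ih].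
  by rewrite !big_nil -(scale0r 0) pairingZl// mul0r.
by rewrite !big_cons -ih -[F i]scale1r pairing_scaleD// mul1r scale1r.
Qed.

Lemma pairing_cell_proj N x u : bounded_measurable u ->
  pairing (cell_proj N x) u = pairing x (cell_avg N u).
Proof.
move=> bu; rewrite pairing_cell_avg pairing_L1_sum//.
by apply: eq_bigr => k _; rewrite pairingZl// mulrAC.
Qed.

(* cell_proj is adjoint to cell_avg, so that cell_avg_close applies to the sign of
   x - cell_proj N x. *)
Lemma cell_proj_close N V x : bv_le V x -> `|x - cell_proj N x| <= 4 / N.+1%:R * V.
Proof.
move=> xV; have [u [mu u1 ->]] := L1_norm_pairing (x - cell_proj N x).
have bu : bounded_measurable u by split=> //; exists 1.
have N0 : 0 < (N.+1%:R : R) by rewrite ltr0n.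
have ueta s t : 0 <= s -> s <= t -> t <= 1 -> t - s <= N.+1%:R^-1 ->
    `|int_between s t u| <= N.+1%:R^-1.
  move=> s0 st t1 ts; apply: le_trans (norm_int_between s0 st t1 mu u1) _.
  by rewrite mul1r.
have bc := bounded_cell_avg N u.
rewrite pairingBl// pairing_cell_proj// -pairingBr//.
apply: le_trans (ler_norm _) _; apply: bv_le_scale xV.
- by rewrite divr_gt0.
- rewrite (_ : _ \- _ = fun z : X => (-1) * cell_avg N u z + u z); last first.
    by apply/funext => z; rewrite mulN1r addrC.
  by apply: bounded_measurableD => //; exact: bounded_measurableZ.
- by move=> s t s0 st t1; exact: (cell_avg_close bu ueta).
Qed.

Definition bv_ball M V : set (L1 l) := [set x | `|x| <= M /\ bv_le V x].

Lemma norm_cell_le N k : (k < N.+1)%N -> fine (l (@cell R N k)) <= N.+1%:R^-1.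
Proof.
move=> kN; rewrite leb_cc01_between ?divr_ge0//.
- by rewrite -mulrBl -natrB// subSnn mul1r.
- by rewrite ler_pM2r ?invr_gt0// ler_nat.
- by rewrite ler_pdivrMr// mul1r ler_nat.
Qed.

(** The finite-rank maps [cell_proj N] approximate the identity uniformly on the ball, and along an
    ultrafilter their finitely many coefficients converge. The ultrafilter is therefore Cauchy. *)
Lemma compact_bv_ball M V : compact (bv_ball M V).
Proof.
rewrite compact_ultra => U UU UB; have PU : ProperFilter U := ultra_proper.
have V0 : 0 <= V.
  have [x [_ xV]] := filter_ex UB; apply: le_trans (normr_ge0 _) (xV (fun=> 0) _).
  split; first exact: bounded_measurable_cst.
  by move=> s t _ _ _; rewrite /int_between pairing0r normr0.
have ex_coef N (k : 'I_N.+1) : exists c : R, L1_int (@cell R N k) x @[x --> U] --> c.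
  apply: (@ultra_bounded_cvg _ _ _ _ M); apply: filterS UB => x [xM _].
  by apply: le_trans xM; apply: le_L1_int_norm; exact: measurable_cell.
have [x Ux] : exists x, U --> x.
  apply: L1_complete => e e0.
  have [N hN] : exists N : nat, 4 / N.+1%:R * V <= e / 2.
    (* With [1 / (N + 1) < e / (8 (V + 1))] the projection error [4 V / (N + 1)] is at most
       [e / 2]. *)
    have K0 : 0 < 8 * (V + 1) by rewrite mulr_gt0// ltr_wpDl.
    have [N] := ltr_add_invr (divr_gt0 e0 K0); rewrite add0r => h; exists N.
    have N0 : 0 < (N.+1%:R : R) by rewrite ltr0n.
    have i0 : 0 < (N.+1%:R^-1 : R) by rewrite invr_gt0.
    move: h i0; rewrite ltr_pdivlMr//; move: (N.+1%:R^-1) => i h i0.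
    by rewrite 2!mulrDr in h; lra.
  pose c (k : 'I_N.+1) := sval (cid (ex_coef N k)).
  have cP (k : 'I_N.+1) : L1_int (@cell R N k) x @[x --> U] --> c k := svalP (cid (ex_coef N k)).
  exists (\sum_(k < N.+1) (N.+1%:R * c k) *: L1_indic l (@cell R N k)).
  have N0 : 0 < (N.+1%:R : R) by rewrite ltr0n.
  have e'0 : 0 < e / 2 / N.+1%:R by rewrite !divr_gt0.
  have near_c : \forall x \near U, forall k : 'I_N.+1, `|c k - L1_int (@cell R N k) x| <= e / 2 / N.+1%:R.
    by apply: filter_forall => k; have /cvgrPdist_le /(_ _ e'0) := cP k.
  apply: filterS2 UB near_c => x [_ xV] xc.
  rewrite -(subrK (cell_proj N x) x) -addrA; apply: le_trans (ler_normD _ _) _.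
  rewrite [leRHS](splitr e); apply: lerD; first exact: le_trans (cell_proj_close N xV) hN.
  rewrite /cell_proj -sumrB; apply: le_trans (ler_norm_sum _ _ _) _.
  apply: (@le_trans _ _ (\sum_(k < N.+1) e / 2 / N.+1%:R)); last first.
    by rewrite sumr_const card_ord -(mulr_natr (e / 2 / N.+1%:R)) divfK ?gt_eqF.
  apply: ler_sum => k _; rewrite -scalerBl normrZ -mulrBr normrM ger0_norm//.
  rewrite norm_L1_indic; last exact: measurable_cell.
  have h1 := xc k; rewrite distrC in h1.
  have h2 := norm_cell_le (ltn_ord k).
  have := ler_pM (normr_ge0 _) (fine_ge0 (measure_ge0 l _)) h1 h2.
  by rewrite ler_pdivlMr// mulrC mulrA.
exists x; split=> //; split.
  apply/ler_addgt0Pl => e e0.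
  have /cvgrPdist_le /(_ _ e0) hx := Ux; have [y [hy [yM _]]] := filter_ex (filterI hx UB).
  rewrite -(subrK y x); apply: le_trans (ler_normD _ _) _; exact: lerD.
apply: bv_le_cvg => e e0.
have /cvgrPdist_le /(_ _ e0) hx := Ux; have [y [hy [_ yV]]] := filter_ex (filterI hx UB).
by exists y.
Qed.

End bounded_variation.

(** * A Lasota-Yorke inequality by duality *)

Section dual_Lasota_Yorke.
Context (R : realType).
Notation l := (@leb_cc01 R).
Notation X := (msub (cc01 R)).
Variable g : X -> X.
Hypothesis gns : nonsingular l g.
Implicit Types (u v : X -> R) (x y : L1 l) (z : X) (s t V c : R).

Lemma continuous_PF_iter n : continuous (iter n (PF g) : L1 l -> L1 l).
Proof.
move=> x; apply: (@cvgrPdist_le _ _ _ (nbhs x) (nbhs_filter x) _ _).2 => e e0; near=> y.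
rewrite -(PF_iterB gns); apply: le_trans (norm_PF_iter_le gns _ _) _.
near: y; exact: cvgr_dist_le.
Unshelve. all: by end_near. Qed.

Lemma bv_dense x (e : R) : 0 < e -> exists y, exists2 V, bv_le V y & `|x - y| <= e.
Proof.
pose W x := forall e : R, 0 < e -> exists y, exists2 V, bv_le V y & `|x - y| <= e.
suff : W x by exact.
(* The whole interval is [[0, 1[] up to the null point 1; this brings every indicator into the range
   of [bv_le_between]. *)
have indic_T : L1_indic l setT = L1_indic l (below (cc01 R) 1).
  have m1 := measurable_below (cc01 R) 1.
  apply: L1_ext => A mA; rewrite !L1_int_indic// setTI.
  rewrite [below _ _ `&` A]setIC.
  have mI := measurableI _ _ mA m1; have mD := measurableD mA m1.
  have mC := measurable_above (cc01 R) 1.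
  have D0 : fine (l (A `\` below (cc01 R) 1)) = 0.
    apply/eqP; rewrite eq_le fine_ge0// andbT.
    have <- : fine (l (~` below (cc01 R) 1)) = 0.
      by rewrite fine_probability_setC// leb_cc01_below// subrr.
    apply: fine_le; rewrite ?fin_num_measure//.
    by apply: le_measure; rewrite ?inE// => z [].
  rewrite -[in LHS](setUIDK A (below (cc01 R) 1)) [LHS](fine_measureU l mI mD) ?D0 ?addr0//.
  by apply/seteqP; split=> // z [[_ z1] [_ z2]].
have W_indic b : W (L1_indic l (below (cc01 R) b)).
  wlog b1 : b / b <= 1.
    move=> h; have [b1|b1] := leP b 1; first exact: h.
    by rewrite below_ge1// indic_T; exact: h.
  move=> c c0; exists (L1_indic l (below (cc01 R) b)), 1; last by rewrite subrr normr0 ltW.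
  have [b0|b0] := leP b 0.
    rewrite below_cc01_le0//; have := bv_le_between (lexx (0 : R)) (lexx 0) ler01.
    by rewrite /between setDv.
  have := bv_le_between (lexx (0 : R)) (ltW b0) b1.
  by rewrite /between (below_cc01_le0 (lexx 0)) setD0.
apply: (L1_dense (W := W) (measurable_belows (cc01 R)) (@belows_setI _ _)).
- move=> a y z Wy Wz c c0.
  have a0 : 0 < 2 * (`|a| + 1) by rewrite mulr_gt0// ltr_wpDl.
  have [y' [V yV hy]] := Wy _ (divr_gt0 c0 a0).
  have c20 : 0 < c / 2 by rewrite divr_gt0.
  have [z' [V' zV hz]] := Wz _ c20.
  exists (a *: y' + z'), (`|a| * V + V'); first exact: bv_leD.
  rewrite opprD addrACA -scalerBr; apply: le_trans (ler_normD _ _) _.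
  rewrite normrZ [leRHS](splitr c); apply: lerD => //.
  apply: le_trans (ler_wpM2l (normr_ge0 a) hy) _.
  have -> : `|a| * (c / (2 * (`|a| + 1))) = c / 2 * (`|a| / (`|a| + 1)).
    by rewrite invfM mulrCA mulrA [RHS]mulrACA.
  by rewrite ler_piMr ?(ltW c20)// ler_pdivrMr ?mul1r ?lerDl// ltr_wpDl.
- move=> y hy c c0; have c20 : 0 < c / 2 by rewrite divr_gt0.
  have [z Wz yz] := hy _ c20; have [z' [V zV hz]] := Wz _ c20.
  exists z', V => //; rewrite -(subrK z y) -addrA; apply: le_trans (ler_normD _ _) _.
  by rewrite [leRHS](splitr c); apply: lerD => //; exact: ltW.
- by have := W_indic 2; rewrite below_ge1//; lra.
- by move=> _ [b _ <-].
Qed.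

Variables (p N : nat).
(** The value 1/8 is set against the factor 4 of [cell_avg_close], leaving a contraction by 1/2. *)
Hypothesis short : forall u s t, test_function u -> 0 <= s -> s <= t -> t <= 1 ->
  t - s <= N.+1%:R^-1 -> `|int_between s t (u \o iter p.+1 g)| <= 8^-1.

Let P : L1 l -> L1 l := iter p.+1 (PF g).

(** The composed test function is split on the grid: the oscillating part is 1/2 times a test
    function, and the averaged part is bounded by [N.+1 / 8]. *)
Let Lasota_Yorke x V : bv_le V x ->
  bv_le (2^-1 * V + N.+1%:R * 8^-1 * `|x|) (P x).
Proof.
move=> xV u tu; have [bu _] := tu; rewrite (PF_iter_pairing gns)//.
have bv : bounded_measurable (u \o iter p.+1 g).
  exact: (bounded_measurable_comp (measurable_iter gns p.+1) bu).
set v := u \o _ in bv *.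
have sv s t : 0 <= s -> s <= t -> t <= 1 -> t - s <= N.+1%:R^-1 ->
    `|int_between s t v| <= 8^-1 by exact: short.
have bc := bounded_cell_avg N v.
have bw : bounded_measurable (v \- cell_avg N v).
  rewrite (_ : _ \- _ = fun z : X => (-1) * cell_avg N v z + v z); last first.
    by apply/funext => z; rewrite mulN1r addrC.
  by apply: bounded_measurableD => //; exact: bounded_measurableZ.
have -> : pairing x v = pairing x (v \- cell_avg N v) + pairing x (cell_avg N v).
  by rewrite pairingBr// subrK.
apply: le_trans (ler_normD _ _) _; apply: lerD.
  apply: bv_le_scale xV => // s t s0 st t1.
  by apply: le_trans (cell_avg_close bv sv s0 st t1) _; lra.
have [mc _] := bc; apply: le_pairing_norm => // z; exact: norm_cell_avg.
Qed.

(** The fixed point of [K = K / 2 + 2 N.+1 / 8], where 2 bounds the norms along the orbit. *)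
Let K : R := N.+1%:R * 2^-1.

Let variation_iter k x V : `|x| <= 2 -> bv_le V x ->
  bv_le (2^-1 ^+ k * V + K) (iter k P x) /\ `|iter k P x| <= 2.
Proof.
move=> x2 xV; elim: k => [|k [ih1 ih2]].
  split=> // u tu; rewrite expr0 mul1r; apply: le_trans (xV u tu) _.
  by rewrite lerDl mulr_ge0.
split; last by rewrite iterS; apply: le_trans (norm_PF_iter_le gns _ _) ih2.
move=> u tu; apply: le_trans (Lasota_Yorke ih1 tu) _.
have : N.+1%:R * 8^-1 * `|iter k P x| <= N.+1%:R * 8^-1 * 2.
  by rewrite ler_wpM2l// mulr_ge0.
rewrite exprS /K; move: (N.+1%:R : R) (_ ^+ k) => a b.
have -> : 2^-1 * b * V = 2^-1 * (b * V) by rewrite mulrA.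
by move: (b * V) (a * _ * `|_|) => c d; lra.
Qed.

Let F0 : set (L1 l) := bv_ball 2 (K + 1).
(** The inequality concerns [iter p.+1 (PF g)]; the images under the lower iterates take care of
    times that are not multiples of [p.+1]. *)
Let F : set (L1 l) := \bigcup_(j in `I_p.+1) (iter j (PF g) @` F0).

Lemma short_integrals_propC : propC (PF (m := l) g).
Proof.
exists F.
  rewrite /F bigcup_mkord; apply: bigsetU_compact => j _; apply: continuous_compact.
    exact/continuous_subspaceT/continuous_PF_iter.
  exact: compact_bv_ball.
move=> h /densitiesP[h0 h1].
have nh : `|h| = 1 by rewrite L1_norm_ge0E//; exact/ae_ge0_L1_intP.
apply: dist_to_cvg0 => e e0.
(* The density is replaced by a nearby [h'] of finite dual variation; the minimum with 1 keeps its
   norm at most 2, and contraction keeps the error at most [e] at all times. *)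
have e10 : 0 < Num.min e 1 by rewrite lt_min e0 ltr01.
have [h' [V h'V]] := bv_dense h e10; rewrite le_min => /andP[hh' hh'1].
have h'2 : `|h'| <= 2.
  rewrite -(subrK h h'); apply: le_trans (ler_normD _ _) _.
  by rewrite distrC nh; lra.
(* From [k0] on, the initial variation has decayed to at most 1, the slack provided in [F0]. *)
have [k0 hk0] : exists k0, forall k, (k0 <= k)%N -> 2^-1 ^+ k * V <= 1.
  exists (Num.truncn V) => k Vk; rewrite exprVn ler_pdivrMl ?exprn_gt0// mulr1.
  apply: le_trans (ltW (truncnS_gt V)) _; rewrite -natrX ler_nat.
  by apply: leq_ltn_trans Vk _; exact: ltn_expl.
exists (k0 * p.+1)%N => // n /= kn.
exists (iter n (PF g) h'); last first.
  by rewrite -(PF_iterB gns); apply: le_trans (norm_PF_iter_le gns _ _) _.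
exists (n %% p.+1)%N; first exact: ltn_pmod.
exists (iter (n %/ p.+1) P h').
  have [v1 v2] := variation_iter (n %/ p.+1) h'2 h'V.
  split=> // u tu; apply: le_trans (v1 u tu) _; rewrite addrC lerD2l; apply: hk0.
  by rewrite leq_divRL.
by rewrite -iterM -iterD; congr iter; rewrite [in RHS](divn_eq n p.+1) addnC mulnC.
Qed.

End dual_Lasota_Yorke.

(** * Expanding branches and piecewise expanding maps *)

(* Stands in for differentiation: the hypothesis says that K bounds the derivative
   of E, and no differentiability of integrals is needed to check it. *)
Lemma quadratic_increments (R : realType) (E : R -> R) (s t K K' : R) : s <= t -> 0 <= K' ->
  (forall x y, s <= x -> x <= y -> y <= t -> `|E y - E x| <= K * (y - x) + K' * (y - x) ^+ 2) ->
  `|E t - E s| <= K * (t - s).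
Proof.
move=> st K'0 hE; apply/ler_addgt0Pl => e e0.
have ts0 : 0 <= t - s by rewrite subr_ge0.
(* Over [N.+1] equal steps the quadratic errors add up to [K' (t - s)^2 / (N + 1)]. *)
have [N hN] : exists N : nat, K' * (t - s) ^+ 2 * N.+1%:R^-1 <= e.
  have c0 : 0 < K' * (t - s) ^+ 2 + 1 by rewrite ltr_wpDl// mulr_ge0// sqr_ge0.
  have [N] := ltr_add_invr (divr_gt0 e0 c0); rewrite add0r ltr_pdivlMr// => h; exists N.
  by apply: le_trans (ltW h); rewrite mulrC ler_wpM2l ?invr_ge0// lerDl.
have N0 : 0 < (N.+1%:R : R) by rewrite ltr0n.
pose delta := (t - s) / N.+1%:R; have d0 : 0 <= delta by rewrite divr_ge0// ltW.
pose node (k : nat) := s + k%:R * delta.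
have nodeN : node N.+1 = t by rewrite /node mulrC divfK ?gt_eqF// addrC subrK.
have nodeS k : node k.+1 = node k + delta by rewrite /node -natr1 mulrDl mul1r addrA.
have main k : (k <= N.+1)%N -> `|E (node k) - E s| <= k%:R * (K * delta + K' * delta ^+ 2).
  elim: k => [|k ih] kN; first by rewrite /node !mul0r addr0 subrr normr0.
  rewrite -(subrK (E (node k)) (E (node k.+1))) -addrA -natr1 mulrDl mul1r addrC.
  apply: le_trans (ler_normD _ _) _; apply: lerD; first by apply: ih; exact: ltnW.
  have dE : node k.+1 - node k = delta by rewrite nodeS addrAC subrr add0r.
  rewrite -[in leRHS]dE; apply: hE.
  - by rewrite /node lerDl mulr_ge0.
  - by rewrite nodeS lerDl.
  - by rewrite -nodeN /node lerD2l ler_wpM2r// ler_nat.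
have := main N.+1 (leqnn _); rewrite nodeN => /le_trans; apply.
have E1 : N.+1%:R * delta = t - s by rewrite mulrC divfK// gt_eqF.
rewrite mulrDr addrC; apply: lerD; last by rewrite mulrCA E1.
apply: le_trans hN; rewrite mulrCA -mulrA; apply: ler_wpM2l => //.
by rewrite expr2 mulrA E1 /delta mulrA -expr2.
Qed.

Section interval_integrals.
Context (R : realType).
Notation l := (@leb_cc01 R).
Notation X := (msub (cc01 R)).
Notation btw := (between (cc01 R)).
Implicit Types (u v b : X -> R) (z : X) (s t x y : R).

Lemma bounded_measurableBr u v : bounded_measurable u -> bounded_measurable v ->
  bounded_measurable (u \- v).
Proof.
move=> bu bv; rewrite (_ : _ \- _ = fun z => u z + (-1) * v z).
  by apply: bounded_measurableD => //; exact: bounded_measurableZ.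
by apply/funext => z; rewrite mulN1r.
Qed.

Lemma int_between_indic s t u : bounded_measurable u ->
  int_between s t u = pairing (L1_indic l setT) (\1_(btw s t) \* u).
Proof.
move=> bu; have mb := measurable_between (cc01 R) s t.
have bi : bounded_measurable (\1_(btw s t) \* u).
  by apply: bounded_measurableM => //; exact: bounded_measurable_indic.
rewrite /int_between pairing_mk//; last exact: integrable_indic.
rewrite pairing_mk//; last exact: integrable_indic.
by apply: eq_Rintegral => z _; rewrite /= !indicE in_setT mulr1 mulrC.
Qed.

Lemma eq_int_between s t u v : bounded_measurable u -> bounded_measurable v ->
  (forall z, btw s t z -> u z = v z) -> int_between s t u = int_between s t v.
Proof.
move=> bu bv uv; rewrite !int_between_indic//; congr pairing; apply/funext => z /=.
rewrite indicE; have [|] := boolP (z \in _); last by rewrite !mul0r.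
by move=> /set_mem /uv ->.
Qed.

Lemma norm_int_between_local s t u M : 0 <= s -> s <= t -> t <= 1 -> 0 <= M ->
  bounded_measurable u -> (forall z, btw s t z -> `|u z| <= M) ->
  `|int_between s t u| <= M * (t - s).
Proof.
move=> s0 st t1 M0 bu uM; have mb := measurable_between (cc01 R) s t.
have bi : bounded_measurable (\1_(btw s t) \* u).
  by apply: bounded_measurableM => //; exact: bounded_measurable_indic.
rewrite (eq_int_between bu bi); last by move=> z sz; rewrite /= indicE mem_set// mul1r.
have [mi _] := bi; apply: norm_int_between => // z; rewrite /= indicE.
have [|] := boolP (z \in _); last by rewrite mul0r normr0.
by move=> /set_mem /uM; rewrite mul1r.
Qed.

Lemma int_between_cst s t c : 0 <= s -> s <= t -> t <= 1 ->
  int_between s t (fun=> c) = c * (t - s).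
Proof.
move=> s0 st t1; have b1 : bounded_measurable (\1_setT : X -> R).
  exact: bounded_measurable_indic.
rewrite -(leb_cc01_between s0 st t1).
have mb := measurable_between (cc01 R) s t.
rewrite -(setIT (btw s t)) -(L1_int_indic l mb measurableT) -pairing_indic// -pairingZr//.
by congr pairing; apply/funext => z /=; rewrite indicE in_setT; exact/esym/mulr1.
Qed.

(** The fundamental theorem of calculus: the integral from [s] minus [f] has increments of quadratic
    order, hence is constant. *)
Lemma int_between_derive (f f' : R -> R) (F : X -> R) L s t :
  0 <= s -> s <= t -> t <= 1 -> 0 <= L -> bounded_measurable F ->
  (forall z, btw s t z -> F z = f' (msub_val z)) ->
  (forall x y, s <= x -> x <= y -> y <= t -> `|f' y - f' x| <= L * (y - x)) ->
  (forall x y, s <= x -> x <= y -> y <= t -> `|f y - f x - f' x * (y - x)| <= L * (y - x) ^+ 2) ->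
  int_between s t F = f t - f s.
Proof.
move=> s0 st t1 L0 bF FE f'L fL.
suff : `|(int_between s t F - f t) - (int_between s s F - f s)| <= 0 * (t - s).
  rewrite mul0r normr_le0 int_between_nil// sub0r => /eqP.
  by move: (int_between _ _ _) => i; lra.
pose E x := int_between s x F - f x.
apply: (@quadratic_increments R E s t 0 (2 * L)) => // [|x y sx xy yt]; first by rewrite mulr_ge0.
have x0 := le_trans s0 sx; have y1 := le_trans yt t1.
have h1 : `|int_between x y (F \- (fun=> f' x))| <= L * (y - x) * (y - x).
  apply: norm_int_between_local => //.
  - by rewrite mulr_ge0// subr_ge0.
  - by apply: bounded_measurableBr => //; exact: bounded_measurable_cst.
  - move=> z [zy zx].
    have xz : x <= msub_val z by rewrite leNgt; exact/negP.
    have zy' : (msub_val z : R) <= y by exact: ltW.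
    rewrite /= FE; last first.
      split; first exact: lt_le_trans zy yt.
      by rewrite /below /mkset; apply/negP; rewrite -leNgt (le_trans sx).
    apply: le_trans (f'L _ _ sx xz (le_trans zy' yt)) _.
    by rewrite ler_wpM2l// lerD2r.
rewrite int_betweenBr// ?int_between_cst// in h1; last exact: bounded_measurable_cst.
have := fL _ _ sx xy yt; rewrite /E mul0r add0r.
have -> : 2 * L * (y - x) ^+ 2 = L * (y - x) * (y - x) + L * (y - x) ^+ 2.
  by rewrite -[in RHS]mulrA -expr2 -mulrA mulr_natl mulr2n.
have -> : int_between s y F - f y - (int_between s x F - f x) =
    (int_between x y F - f' x * (y - x)) - (f y - f x - f' x * (y - x)).
  by rewrite (int_between_cat sx xy bF); move: (int_between _ _ _) (int_between _ _ _) (_ * _) => i j k; lra.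
by move=> h2; apply: le_trans (ler_normB _ _) _; exact: lerD.
Qed.

(** Integration by parts: once [om x] times the integral of [b] is subtracted from the integral of
    [u], the increments of the difference come from the variation of [om] alone, up to quadratic
    order. *)
Lemma int_between_by_parts (u b : X -> R) (om : R -> R) (theta L D : R) s t :
  0 <= s -> s <= t -> t <= 1 -> 0 <= L -> 0 <= D ->
  bounded_measurable u -> bounded_measurable b ->
  (forall z, btw s t z -> u z = om (msub_val z) * b z) ->
  (forall x, s <= x -> x <= t -> `|int_between s x b| <= D) ->
  (forall x y, s <= x -> x <= y -> y <= t -> `|om y - om x| <= L * (y - x)) ->
  `|om t| <= theta ->
  `|int_between s t u| <= theta * D + L * D * (t - s).
Proof.
move=> s0 st t1 L0 D0 bu bb ub bD omL omt.
have [M M0 bM] := bounded_measurable_ge0 bb.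
pose E x := int_between s x u - om x * int_between s x b.
have : `|E t - E s| <= L * D * (t - s).
  apply: (@quadratic_increments R E s t _ (M * L)) => // [|x y sx xy yt]; first by rewrite mulr_ge0.
  have x0 := le_trans s0 sx; have y1 := le_trans yt t1.
  have boy : bounded_measurable (om y \*: b) by exact: bounded_measurableZ.
  have h1 : `|int_between x y (u \- (om y \*: b))| <= M * L * (y - x) * (y - x).
    apply: norm_int_between_local => //.
    - by rewrite !mulr_ge0// subr_ge0.
    - exact: bounded_measurableBr.
    - move=> z [zy zx].
      have xz : x <= msub_val z by rewrite leNgt; exact/negP.
      have zy' : (msub_val z : R) <= y by exact: ltW.
      rewrite /= ub; last first.
        split; first exact: lt_le_trans zy yt.
        by rewrite /below /mkset; apply/negP; rewrite -leNgt (le_trans sx).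
      rewrite -mulrBl normrM distrC mulrC -mulrA; apply: ler_pM => //.
      apply: le_trans (omL _ _ (le_trans sx xz) zy' yt) _.
      by rewrite ler_wpM2l// lerD2l lerN2.
  rewrite int_betweenBr// int_betweenZr// in h1.
  have h2 : `|(om y - om x) * int_between s x b| <= L * D * (y - x).
    rewrite normrM mulrAC; apply: ler_pM => //; first exact: omL.
    by apply: bD => //; exact: le_trans yt.
  have -> : E y - E x = (int_between x y u - om y * int_between x y b) -
      (om y - om x) * int_between s x b.
    rewrite /E (int_between_cat sx xy bu) (int_between_cat sx xy bb) mulrDr mulrBl.
    move: (int_between _ _ _) (int_between x y u) (_ * _) (_ * int_between x y b) (_ * _) => i j k k' k''.
    by lra.
  apply: le_trans (ler_normB _ _) _; rewrite addrC; apply: lerD => //.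
  by rewrite expr2 mulrA.
have Es : E s = 0 by rewrite /E !int_between_nil// mulr0 subrr.
rewrite Es subr0 => h; rewrite -(subrK (om t * int_between s t b) (int_between s t u)) -/(E t).
apply: le_trans (ler_normD _ _) _; rewrite addrC; apply: lerD => //.
by rewrite normrM; apply: ler_pM => //; exact: bD.
Qed.

End interval_integrals.

Lemma clamp_nonexpansive (R : realDomainType) (s t x y : R) : s <= t -> x <= y ->
  Num.max s (Num.min x t) <= Num.max s (Num.min y t) /\
  Num.max s (Num.min y t) - Num.max s (Num.min x t) <= y - x.
Proof.
move=> st xy; have [xt|xt] := leP x t; have [yt|yt] := leP y t;
  have [sx|sx] := leP s x; have [sy|sy] := leP s y; have [s_t|s_t] := leP s t;
  split; lra.
Qed.

(** Clamping extends the slope from [[s, t]] to a bounded measurable function on the whole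
    interval. *)
Definition clamped_slope (R : realType) (f' : R -> R) (s t : R) (z : msub (cc01 R)) : R :=
  f' (Num.max s (Num.min (msub_val z) t)).

(** * Change of variables on a monotone branch *)

Section monotone_branch.
Context (R : realType).
Notation l := (@leb_cc01 R).
Notation X := (msub (cc01 R)).
Notation btw := (between (cc01 R)).
Notation bel := (below (cc01 R)).
Variables (g : X -> X) (f f' : R -> R) (s t theta L M : R).
Hypothesis mg : measurable_fun setT g.
Hypotheses (s0 : 0 <= s) (st : s <= t) (t1 : t <= 1).
Hypotheses (L0 : 0 <= L) (theta1 : theta <= 1).
Hypothesis gf : forall z : X, s <= (msub_val z : R) <= t ->
  (msub_val (g z) : R) = f (msub_val z).
Hypothesis f'L : forall x y, s <= x -> x <= y -> y <= t -> `|f' y - f' x| <= L * (y - x).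
Hypothesis fMVT : forall x y, s <= x -> x < y -> y <= t ->
  exists2 c, x <= c <= y & f y - f x = f' c * (y - x).
Hypothesis f'theta : forall x, s <= x -> x <= t -> f' x != 0 /\ `|f' x|^-1 <= theta.
Hypothesis f'M : forall x, s <= x -> x <= t -> `|f' x| <= M.
Hypothesis fC : {within `[s, t], continuous f}.
Implicit Types (u v : X -> R) (z : X) (x y : R).

Let fL x y : s <= x -> x <= y -> y <= t -> `|f y - f x - f' x * (y - x)| <= L * (y - x) ^+ 2.
Proof.
move=> sx; rewrite le_eqVlt => /predU1P[<- _|xy yt].
  by rewrite !subrr mulr0 subr0 normr0 expr2 mulr0 mulr0.
have [c /andP[xc cy] ->] := fMVT sx xy yt.
have y0 : 0 <= y - x by rewrite subr_ge0 ltW.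
rewrite -mulrBl normrM (ger0_norm y0) expr2 mulrA ler_wpM2r//.
apply: le_trans (f'L sx xc (le_trans cy yt)) _.
by rewrite ler_wpM2l// lerD2r.
Qed.

Let clamp x : R := Num.max s (Num.min x t).

Let clamp_in x : s <= clamp x /\ clamp x <= t.
Proof. by rewrite /clamp le_max lexx ge_max st ge_min lexx orbT. Qed.

Let clamp_id x : s <= x -> x <= t -> clamp x = x.
Proof. by move=> sx xt; rewrite /clamp (min_l xt) (max_r sx). Qed.

Let clampK x y : x <= y -> clamp x <= clamp y /\ clamp y - clamp x <= y - x.
Proof.
move=> xy; exact: clamp_nonexpansive.
Qed.

Let F := clamped_slope f' s t.

Let f'_clamp x y : `|f' (clamp y) - f' (clamp x)| <= L * `|y - x|.
Proof.
wlog xy : x y / x <= y.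
  by move=> h; have [|/ltW] := leP x y => xy; [|rewrite distrC [X in L * X]distrC]; exact: h.
have [h1 h2] := clampK xy; have [a1 a2] := clamp_in x; have [b1 b2] := clamp_in y.
apply: le_trans (f'L a1 h1 b2) _; rewrite ger0_norm ?subr_ge0//; exact: ler_wpM2l.
Qed.

Lemma bounded_clamped_slope : bounded_measurable (clamped_slope f' s t).
Proof.
split; last by exists M => z; have [h1 h2] := clamp_in (msub_val z); exact: f'M.
apply: (@measurableT_comp _ _ _ _ _ _ (f' \o clamp) _ (fun z : X => (msub_val z : R))).
  apply: continuous_measurable_fun => x; apply/cvgrPdist_le => e e0.
  have L1 : 0 < L + 1 by rewrite ltr_wpDl.
  have e1 : 0 < e / (L + 1) by rewrite divr_gt0.
  near=> y; apply: le_trans (f'_clamp y x) _.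
  apply: (@le_trans _ _ ((L + 1) * `|x - y|)); first by rewrite ler_wpM2r// lerDl.
  rewrite mulrC -ler_pdivlMr//; near: y; exact: cvgr_dist_le.
exact: (@measurable_msub_val _ _ (cc01 R)).
Unshelve. all: by end_near. Qed.

Let bF : bounded_measurable F := bounded_clamped_slope.

Let btw_in x y z : s <= x -> y <= t -> btw x y z ->
  s <= (msub_val z : R) <= t /\ x <= msub_val z /\ (msub_val z : R) < y.
Proof.
move=> sx yt [zy /negP]; rewrite -leNgt => xz.
by split=> //; rewrite (le_trans sx xz) (ltW (lt_le_trans zy yt)).
Qed.

Let FE z : s <= (msub_val z : R) <= t -> F z = f' (msub_val z).
Proof. by move=> /andP[h1 h2]; rewrite /F /clamped_slope -/(clamp _) clamp_id. Qed.

Let int_F x y : s <= x -> x <= y -> y <= t -> int_between x y F = f y - f x.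
Proof.
move=> sx xy yt; apply: (@int_between_derive R f f' F L) => //.
- exact: le_trans sx.
- exact: le_trans t1.
- by move=> z /(btw_in sx yt) [h _]; exact: FE.
- by move=> x1 y1 h1 h2 h3; apply: f'L => //; [exact: le_trans h1|exact: le_trans yt].
- by move=> x1 y1 h1 h2 h3; apply: fL => //; [exact: le_trans h1|exact: le_trans yt].
Qed.

Let f_in x : s <= x -> x <= t -> 0 <= f x <= 1.
Proof.
move=> sx xt; have x01 : (cc01 R : set R) x.
  by rewrite /= in_itv/= (le_trans s0 sx) (le_trans xt t1).
have := @gf (msub_mk x01); rewrite [msub_val _]/= => <-; last by rewrite sx.
by rewrite cc01_ge0 cc01_le1.
Qed.

(** The slope carried by [[s, t[]. Its pushforward by [g] is plus or minus the indicator of the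
    image interval, which is the change of variables formula. *)
Let w : L1 l := L1_mk l (\1_(btw s t) \* F).

Let bw : bounded_measurable (\1_(btw s t) \* F).
Proof.
apply: bounded_measurableM => //; apply: bounded_measurable_indic.
exact: measurable_between.
Qed.

Let mst := measurable_between (cc01 R) s t.

Let L1_int_w A : measurable A -> L1_int A w = pairing (L1_indic l A) (\1_(btw s t) \* F).
Proof.
move=> mA; rewrite -pairing_indic// pairing_mk//; last 2 first.
- exact: bounded_measurable_integrable.
- exact: bounded_measurable_indic.
rewrite pairing_mk//; last exact: integrable_indic.
by apply: eq_Rintegral => z _; rewrite mulrC.
Qed.

Let L1_int_w_between x y : s <= x -> x <= y -> y <= t -> L1_int (btw x y) w = f y - f x.
Proof.
move=> sx xy yt; rewrite -int_F// L1_int_w; last exact: measurable_between.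
apply: (eq_int_between (s := x) (t := y)) => // z /(btw_in sx yt)[/andP[h1 h2] [h3 h4]].
rewrite /= indicE mem_set ?mul1r//; split; last by apply/negP; rewrite -leNgt.
exact: lt_le_trans h4 yt.
Qed.

Let pairing_w v : bounded_measurable v ->
  pairing w (v \o g) = int_between s t (fun z => v (g z) * F z).
Proof.
move=> bv; have bvg := bounded_measurable_comp mg bv.
rewrite pairing_mk//; last exact: bounded_measurable_integrable.
rewrite /int_between pairing_mk//; [|exact: integrable_indic|exact: bounded_measurableM].
by apply: eq_Rintegral => z _ /=; rewrite mulrCA mulrC.
Qed.

Let null_point x : l [set z : X | (msub_val z : R) = x] = 0%E.
Proof.
apply/eqP; rewrite eq_le measure_ge0 andbT /leb_cc01 /msub_measure.
rewrite -[leRHS](lebesgue_measure_set1 x); apply: le_measure; rewrite ?inE.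
- apply: measurable_msub_image; rewrite -[X in measurable X]setTI.
  exact: (@measurable_msub_val _ _ (cc01 R) measurableT [set x]).
- exact: measurable_set1.
- by move=> _ [z /= zx <-].
Qed.

(** A decreasing branch reverses the open and closed ends of half-open intervals; the mismatch is a
    single null point. *)
Let L1_int_w_eq A B x : measurable A -> measurable B ->
  (forall z, btw s t z -> (msub_val z : R) != x -> A z <-> B z) ->
  L1_int A w = L1_int B w.
Proof.
move=> mA mB AB; have mi C : measurable C -> measurable_fun setT (\1_C : X -> R).
  by move=> mC; exact: measurable_indic.
have [mw _] := bw.
rewrite -!pairing_indic// !pairing_mk//; try exact: bounded_measurable_integrable;
  try exact: bounded_measurable_indic.
apply: ae_eq_Rintegral => //; try by apply: measurable_funM => //; exact: mi.
exists [set z : X | (msub_val z : R) = x]; split; [|exact: null_point|].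
  rewrite -[X in measurable X]setTI.
  exact: (@measurable_msub_val _ _ (cc01 R) measurableT [set x]).
move=> z /= zAB; apply: contrapT => zx; apply: zAB => _.
rewrite !indicE; have [/set_mem zb|] := boolP (z \in btw s t); last by rewrite !mul0r !mulr0.
congr (_%:R * _); have /AB := zb => /(_ (introN eqP zx)) h.
by congr nat_of_bool; apply/idP/idP; rewrite !inE => /h.
Qed.

Let measurable_pre B : measurable B -> measurable (g @^-1` B).
Proof. by move=> mB; rewrite -[X in measurable X]setTI; exact: mg. Qed.

Let clampI a b c z : btw a b z ->
  bel c z <-> (msub_val z : R) < Num.max a (Num.min c b).
Proof.
move=> [zb /negP]; rewrite -leNgt lt_max lt_min => az; rewrite /below /mkset.
have -> : ((msub_val z : R) < b) = true by [].
by rewrite andbT (ltNge _ a) az.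
Qed.

Let btw_below a b c : a <= b -> btw a b `&` bel c = btw a (Num.max a (Num.min c b)).
Proof.
move=> ab; apply/seteqP; split=> z.
  by move=> [zab /(clampI c zab) h]; split=> //; case: zab.
move=> [zc za]; have zab : btw a b z.
  split=> //; move: zc; rewrite /below /mkset lt_max lt_min => /orP[|/andP[//]].
  by move=> h; exfalso; apply: za.
by split=> //; apply/(clampI c zab).
Qed.

Let f_ivt a b c : a <= b -> Num.min (f s) (f t) = a -> Num.max (f s) (f t) = b ->
  exists x, [/\ s <= x, x <= t & f x = Num.max a (Num.min c b)].
Proof.
move=> ab ha hb; have [|x] := @IVT R f s t (Num.max a (Num.min c b)) st fC.
  rewrite ha hb le_max lexx/= ge_max ab ge_min lexx orbT//.
by rewrite in_itv/= => /andP[h1 h2] h3; exists x.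
Qed.

Section increasing.
Hypothesis f'_gt0 : forall x, s <= x -> x <= t -> 0 < f' x.

Let f_mono x y : s <= x -> x < y -> y <= t -> f x < f y.
Proof.
move=> sx xy yt; have [c /andP[xc cy] E] := fMVT sx xy yt.
rewrite -subr_gt0 E mulr_gt0 ?subr_gt0// f'_gt0//; first exact: le_trans xc.
exact: le_trans yt.
Qed.

Let f_le x y : s <= x -> x <= y -> y <= t -> f x <= f y.
Proof. by move=> sx; rewrite le_eqVlt => /predU1P[->//|xy yt]; exact/ltW/f_mono. Qed.

Let g_btw z : btw s t z -> btw (f s) (f t) (g z).
Proof.
move=> /(btw_in (lexx s) (lexx t)) [zst [sz zt]]; split; rewrite /below /mkset gf//.
  exact: f_mono.
by apply/negP; rewrite -leNgt; apply: f_le => //; exact: ltW.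
Qed.

(** The level [c], truncated to the range of the branch, is attained at some [x] by continuity, and
    the preimage of [[0, c[] within the branch is [[s, x[]. *)
Let inc_w c : L1_int (g @^-1` bel c) w = L1_int (bel c) (L1_indic l (btw (f s) (f t))).
Proof.
have fst := f_le (lexx s) st (lexx t).
have [x [sx xt fx]] := f_ivt c fst (min_l fst) (max_r fst).
have mfst := measurable_between (cc01 R) (f s) (f t).
rewrite L1_int_indic//; last exact: measurable_below.
rewrite btw_below// -fx leb_cc01_between//; last 3 first.
- by have /andP[] := f_in (lexx s) st.
- exact: f_le.
- by have /andP[] := f_in sx xt.
rewrite -L1_int_w_between//; apply: (@L1_int_w_eq _ _ s).
- by apply: measurable_pre; exact: measurable_below.
- exact: measurable_between.
move=> z zst _; have [/andP[sz' zt'] [sz zt]] := btw_in (lexx s) (lexx t) zst.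
have h := clampI c (g_btw zst); rewrite -fx (gf (introT andP (conj sz' zt'))) in h.
split=> [/h fzx|[zx _]].
  split; last by case: zst.
  by rewrite /below /mkset ltNge; apply/negP => xz; have := f_le sx xz zt'; rewrite leNgt fzx.
by apply/h; exact: f_mono.
Qed.

Lemma int_between_inc v : bounded_measurable v ->
  int_between s t (fun z => v (g z) * clamped_slope f' s t z) = int_between (f s) (f t) v.
Proof.
move=> bv; rewrite -pairing_w//; apply: pairing_transfer => //.
apply: (L1_int_ext_pi mg (measurable_belows (cc01 R)) (@belows_setI _ _)).
  have fst := f_le (lexx s) st (lexx t).
  rewrite L1_int_indic//; last exact: measurable_between.
  rewrite setIT leb_cc01_between//; last 2 first.
  - by have /andP[] := f_in (lexx s) st.
  - by have /andP[] := f_in st (lexx t).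
  by rewrite -L1_int_w_between//; apply: (@L1_int_w_eq _ _ s) => // z zst _; split.
by move=> _ [c _ <-]; exact: inc_w.
Qed.

End increasing.

Section decreasing.
Hypothesis f'_lt0 : forall x, s <= x -> x <= t -> f' x < 0.

Let f_anti x y : s <= x -> x < y -> y <= t -> f y < f x.
Proof.
move=> sx xy yt; have [c /andP[xc cy] E] := fMVT sx xy yt.
rewrite -subr_lt0 E pmulr_llt0 ?subr_gt0// f'_lt0//; first exact: le_trans xc.
exact: le_trans yt.
Qed.

Let f_ge x y : s <= x -> x <= y -> y <= t -> f y <= f x.
Proof. by move=> sx; rewrite le_eqVlt => /predU1P[->//|xy yt]; exact/ltW/f_anti. Qed.

Let g_btw z : btw s t z -> (msub_val z : R) != s -> btw (f t) (f s) (g z).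
Proof.
move=> /(btw_in (lexx s) (lexx t)) [zst [sz zt]] zs; split; rewrite /below /mkset gf//.
  by apply: f_anti => //; [rewrite lt_neqAle eq_sym zs|exact: ltW].
by apply/negP; rewrite -leNgt; apply: f_ge => //; exact: ltW.
Qed.

(** Within the branch the preimage is []x, t[], equal to [[x, t[] up to the point [x]. *)
Let dec_w c : L1_int (g @^-1` bel c) w =
  L1_int (bel c) ((-1) *: L1_indic l (btw (f t) (f s))).
Proof.
have fst := f_ge (lexx s) st (lexx t).
have [x [sx xt fx]] := f_ivt c fst (min_r fst) (max_l fst).
have mfst := measurable_between (cc01 R) (f t) (f s).
have mc := measurable_below (cc01 R) c.
rewrite L1_intZ// L1_int_indic//.
rewrite btw_below// -fx leb_cc01_between//; last 3 first.
- by have /andP[] := f_in st (lexx t).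
- exact: f_ge.
- by have /andP[] := f_in sx xt.
rewrite mulN1r opprB -L1_int_w_between//; apply: (@L1_int_w_eq _ _ x).
- exact: measurable_pre.
- exact: measurable_between.
move=> z zst zx; have [/andP[sz' zt'] [sz zt]] := btw_in (lexx s) (lexx t) zst.
(* At [z = s] the value is [f s], the excluded end of the image interval, so [g_btw] does not
   apply. *)
have [zs|zs] := eqVneq (msub_val z : R) s.
  have sx' : s < x by rewrite lt_neqAle sx andbT -zs.
  split; last by move=> [_ /negP]; rewrite -leNgt zs leNgt sx'.
  have := f_anti (lexx s) sx' xt; rewrite fx gt_max gt_min ltxx orbF => /andP[_ cs].
  rewrite /preimage /below /mkset gf ?zs ?lexx//.
  by move=> fc; have := lt_trans fc cs; rewrite ltxx.
have h := clampI c (g_btw zst zs); rewrite -fx (gf (introT andP (conj sz' zt'))) in h.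
split=> [/h fzx|[_ /negP]].
  split; first by case: zst.
  by apply/negP; rewrite -leNgt leNgt; apply/negP => xz; have := f_anti sz' xz xt; rewrite ltNge ltW.
rewrite -leNgt => xz.
by apply/h; apply: f_anti => //; rewrite lt_neqAle eq_sym zx.
Qed.

Lemma int_between_dec v : bounded_measurable v ->
  int_between s t (fun z => v (g z) * clamped_slope f' s t z) = - int_between (f t) (f s) v.
Proof.
move=> bv; rewrite -mulN1r /int_between -pairingZl// -/(int_between _ _ _) -pairing_w//.
apply: pairing_transfer => //.
apply: (L1_int_ext_pi mg (measurable_belows (cc01 R)) (@belows_setI _ _)).
  have fst := f_ge (lexx s) st (lexx t).
  rewrite L1_intZ// L1_int_indic//; last exact: measurable_between.
  rewrite setIT leb_cc01_between//; last 2 first.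
  - by have /andP[] := f_in st (lexx t).
  - by have /andP[] := f_in (lexx s) st.
  rewrite mulN1r opprB.
  by rewrite -L1_int_w_between//; apply: (@L1_int_w_eq _ _ s) => // z zst _; split.
by move=> _ [c _ <-]; exact: dec_w.
Qed.

End decreasing.

End monotone_branch.

(** * One expanding branch *)

Section expanding_branch.
Context (R : realType).
Notation X := (msub (cc01 R)).
Notation btw := (between (cc01 R)).
Variables (g : X -> X) (f f' : R -> R) (s t theta L M : R).
Hypothesis mg : measurable_fun setT g.
Hypotheses (s0 : 0 <= s) (st : s <= t) (t1 : t <= 1).
Hypotheses (L0 : 0 <= L) (theta1 : theta <= 1).
Hypothesis gf : forall z : X, s <= (msub_val z : R) <= t ->
  (msub_val (g z) : R) = f (msub_val z).
Hypothesis f'L : forall x y, s <= x -> x <= y -> y <= t -> `|f' y - f' x| <= L * (y - x).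
Hypothesis fMVT : forall x y, s <= x -> x < y -> y <= t ->
  exists2 c, x <= c <= y & f y - f x = f' c * (y - x).
Hypothesis f'theta : forall x, s <= x -> x <= t -> `|f' x|^-1 <= theta.
Hypothesis f'M : forall x, s <= x -> x <= t -> `|f' x| <= M.
Hypothesis fC : {within `[s, t], continuous f}.
Hypothesis f'_sign : (forall x, s <= x -> x <= t -> 0 < f' x) \/
  (forall x, s <= x -> x <= t -> f' x < 0).
Implicit Types (v : X -> R) (z : X) (x y p q : R).

Let f'_neq0 x : s <= x -> x <= t -> f' x != 0.
Proof.
by move=> sx xt; case: f'_sign => /(_ x sx xt) h; [rewrite gt_eqF|rewrite lt_eqF].
Qed.

Variables (v : X -> R) (D : R).
Hypotheses (bv : bounded_measurable v) (D0 : 0 <= D).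
Hypothesis vD : forall x y, s <= x <= t -> s <= y <= t -> f x <= f y ->
  `|int_between (f x) (f y) v| <= D.

Let sub_within x : s <= x -> x <= t -> {within `[s, x], continuous f}.
Proof.
move=> sx xt; apply: continuous_subspaceW fC => y /=; rewrite !in_itv/= => /andP[-> yx].
exact: le_trans xt.
Qed.

(** By change of variables this is, up to sign, an integral of [v] between [f s] and [f x]. *)
Let int_prefix x : s <= x -> x <= t ->
  `|int_between s x (fun z => v (g z) * clamped_slope f' s x z)| <= D.
Proof.
move=> sx xt; have x1 := le_trans xt t1; have fxC := sub_within sx xt.
have gfx z : s <= (msub_val z : R) <= x -> (msub_val (g z) : R) = f (msub_val z).
  by move=> /andP[h1 h2]; apply: gf; rewrite h1 (le_trans h2 xt).
have f'Lx y y' : s <= y -> y <= y' -> y' <= x -> `|f' y' - f' y| <= L * (y' - y).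
  by move=> h1 h2 h3; apply: f'L => //; exact: le_trans xt.
have fMVTx y y' : s <= y -> y < y' -> y' <= x ->
    exists2 c, y <= c <= y' & f y' - f y = f' c * (y' - y).
  by move=> h1 h2 h3; apply: fMVT => //; exact: le_trans xt.
have f'Mx y : s <= y -> y <= x -> `|f' y| <= M.
  by move=> h1 h2; apply: f'M => //; exact: le_trans xt.
have sst : s <= s <= t by rewrite lexx.
have sxt : s <= x <= t by rewrite sx.
have fsx (s_x : s < x) := fMVTx s x (lexx s) s_x (lexx x).
have x_s : 0 <= x - s by rewrite subr_ge0.
case: f'_sign => h.
  rewrite (@int_between_inc R g f f' s x L M)//.
    apply: vD => //; move: sx fsx; rewrite le_eqVlt => /predU1P[->//|s_x] /(_ s_x).
    move=> [c /andP[sc cx] E]; rewrite -subr_ge0 E mulr_ge0// ltW// h//.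
    exact: le_trans xt.
  by move=> y h1 h2; apply: h => //; exact: le_trans xt.
rewrite (@int_between_dec R g f f' s x L M)// ?normrN.
  apply: vD => //; move: sx fsx; rewrite le_eqVlt => /predU1P[->//|s_x] /(_ s_x).
  move=> [c /andP[sc cx] E]; rewrite -subr_le0 E mulr_le0_ge0// ltW// h//.
  exact: le_trans xt.
by move=> y h1 h2; apply: h => //; exact: le_trans xt.
Qed.

Let slope_eq x z : x <= t -> btw s x z -> clamped_slope f' s x z = f' (msub_val z).
Proof.
move=> xt [zx /negP]; rewrite -leNgt => sz.
by rewrite /clamped_slope (min_l (ltW zx)) (max_r sz).
Qed.

(** [v o g] is [1 / f'] times [(v o g) f'], whose prefix integrals are controlled. Integration by
    parts applies with [om = 1 / f'], bounded by [theta] and [L]-Lipschitz because [theta <= 1]. *)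
Lemma int_between_branch : `|int_between s t (v \o g)| <= theta * D + L * D * (t - s).
Proof.
have bF x : s <= x -> x <= t -> bounded_measurable (clamped_slope f' s x).
  move=> sx xt; apply: (@bounded_clamped_slope R f' s x L M) => //.
    by move=> y y' h1 h2 h3; apply: f'L => //; exact: le_trans xt.
  by move=> y h1 h2; apply: f'M => //; exact: le_trans xt.
have bvg := bounded_measurable_comp mg bv.
have bb x : s <= x -> x <= t -> bounded_measurable (fun z => v (g z) * clamped_slope f' s x z).
  by move=> sx xt; apply: bounded_measurableM => //; exact: bF.
have theta0 : 0 <= theta by apply: le_trans (f'theta (lexx s) st); rewrite invr_ge0.
apply: (@int_between_by_parts R _ (fun z => v (g z) * clamped_slope f' s t z)
  (fun x => (f' x)^-1)) => //.
- exact: bb.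
- move=> z zst; rewrite (slope_eq (lexx t) zst) mulrCA mulVf ?mulr1//.
  by case: zst => zt /negP; rewrite -leNgt => sz; apply: f'_neq0 => //; exact: ltW.
- move=> x sx xt; rewrite (@eq_int_between R s x _ (fun z => v (g z) * clamped_slope f' s x z)).
  + exact: int_prefix.
  + exact: bb.
  + exact: bb.
  + move=> z zsx; rewrite (slope_eq xt zsx) (slope_eq (lexx t))//.
    by case: zsx => zx zs; split=> //; exact: lt_le_trans xt.
- move=> x y sx xy yt; have sy := le_trans sx xy; have xt := le_trans xy yt.
  have nx := f'_neq0 sx xt; have ny := f'_neq0 sy yt.
  have -> : (f' y)^-1 - (f' x)^-1 = (f' x - f' y) * (f' x)^-1 * (f' y)^-1.
    by rewrite mulrBl mulrBl mulfV// mul1r mulrAC mulfV// mul1r.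
  rewrite !normrM !normfV distrC -mulrA.
  have y0 : 0 <= L * (y - x) by rewrite mulr_ge0// subr_ge0.
  rewrite -[leRHS]mulr1; apply: ler_pM => //; first exact: f'L.
  rewrite -[leRHS]mulr1; apply: ler_pM => //; rewrite ?invr_ge0//.
    exact: le_trans (f'theta sx xt) theta1.
  exact: le_trans (f'theta sy yt) theta1.
- by rewrite normfV; apply: f'theta.
Qed.

End expanding_branch.

Lemma finite_set_gap (R : realType) (S : set R) : finite_set S ->
  exists2 delta : R, 0 < delta & forall x y, S x -> S y -> x < y -> delta <= y - x.
Proof.
move=> finS.
have gap (r : seq R) : exists2 delta : R, 0 < delta & forall d, d \in r -> 0 < d -> delta <= d.
  elim: r => [|d r [delta d0 hd]]; first by exists 1.
  have [dpos|dneg] := ltP 0 d; last first.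
    by exists delta => // e; rewrite in_cons => /predU1P[->|/hd//]; rewrite ltNge dneg.
  exists (Num.min d delta); first by rewrite lt_min dpos.
  move=> e; rewrite in_cons ge_min => /predU1P[->|/hd h /h ->]; first by rewrite lexx.
  by rewrite orbT.
have [r Er] := (finite_seqP _).1 (finite_image2 (fun x y => y - x) finS finS).
have [delta d0 hd] := gap r; exists delta => // x y Sx Sy xy.
apply: hd; last by rewrite subr_gt0.
suff : [set` r] (y - x) by [].
by rewrite -Er; exists x => //; exists y.
Qed.

(** * Intervals containing at most one cut *)

Section removing_cuts.
Context (R : realType).
Notation X := (msub (cc01 R)).
Variables (v : X -> R) (S : set R) (a C : R).
Hypotheses (bv : bounded_measurable v) (a0 : 0 <= a) (C0 : 0 <= C).
Hypothesis vS : forall s t, 0 <= s -> s <= t -> t <= 1 ->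
  (forall x, s <= x -> x <= t -> ~ S x) -> `|int_between s t v| <= a + C * (t - s).

(** Cuts may sit at the ends: shaving off [eta] on both sides avoids them and costs at most [e / 2]
    each, [v] being bounded. *)
Lemma int_between_open s t : 0 <= s -> s <= t -> t <= 1 ->
  (forall x, s < x -> x < t -> ~ S x) -> `|int_between s t v| <= a + C * (t - s).
Proof.
move=> s0; rewrite le_eqVlt => /predU1P[<- _ _|st t1 nS].
  by rewrite int_between_nil// normr0 subrr mulr0 addr0.
have [M M0 vM] := bounded_measurable_ge0 bv; have [mv _] := bv.
apply/ler_addgt0Pl => e e0; have M1 : 0 < M + 1 by rewrite ltr_wpDl.
pose eta := Num.min ((t - s) / 2) (e / 2 / (M + 1)).
have eta0 : 0 < eta by rewrite lt_min !divr_gt0// subr_gt0.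
have eta1 : eta <= (t - s) / 2 by rewrite ge_min lexx.
have eta2 : M * eta <= e / 2.
  have : eta <= e / 2 / (M + 1) by rewrite ge_min lexx orbT.
  rewrite ler_pdivlMr// => h; apply: le_trans h; rewrite mulrC ler_wpM2l ?(ltW eta0)//.
  by rewrite lerDl.
have [h1 h2 h3] : [/\ s <= s + eta, s + eta <= t - eta & t - eta <= t].
  by move: eta0 eta1; clear eta2; move: eta => k; split; lra.
have bnd p q : 0 <= p -> p <= q -> q <= 1 -> q - p = eta -> `|int_between p q v| <= e / 2.
  by move=> p0 pq q1 E; apply: le_trans (norm_int_between p0 pq q1 mv vM) _; rewrite E.
rewrite (int_between_cat h1 (le_trans h2 h3))// (int_between_cat h2 h3)//.
have b1 : `|int_between s (s + eta) v| <= e / 2.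
  apply: bnd => //; first exact: le_trans (le_trans h2 h3) t1.
  by rewrite addrAC subrr add0r.
have b2 : `|int_between (t - eta) t v| <= e / 2.
  apply: bnd => //; last by rewrite subKr.
  exact: le_trans s0 (le_trans h1 h2).
have b3 : `|int_between (s + eta) (t - eta) v| <= a + C * (t - s).
  apply: le_trans (vS _ h2 _ _) _.
  - exact: le_trans h1.
  - exact: le_trans h3 t1.
  - move=> x sx xt; apply: nS.
      by apply: lt_le_trans sx; rewrite ltrDl.
    by apply: le_lt_trans xt _; rewrite ltrBlDr ltrDl.
  - by rewrite lerD2l ler_wpM2l// lerB// ?lerBlDr; lra.
apply: le_trans (ler_normD _ _) _; apply: le_trans (lerD (lexx _) (ler_normD _ _)) _.
by move: b1 b2 b3; move: `|_| `|_| `|_| (C * _) => p q r k; lra.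
Qed.

Variable delta : R.
Hypothesis gapS : forall x y, S x -> S y -> x < y -> delta <= y - x.

(** Cuts are at least [delta] apart, so at most one is interior; splitting there doubles [a], while
    the term in [C] is additive. *)
Lemma int_between_short s t : 0 <= s -> s <= t -> t <= 1 -> t - s <= delta ->
  `|int_between s t v| <= 2 * a + C * (t - s).
Proof.
move=> s0 st t1 ts; have [[c [Sc sc ct]]|nc] := pselect (exists c, [/\ S c, s < c & c < t]).
  rewrite (int_between_cat (ltW sc) (ltW ct))//.
  have h1 : `|int_between s c v| <= a + C * (c - s).
    apply: int_between_open => //; [exact: ltW|exact: le_trans (ltW ct) t1|].
    move=> x sx xc Sx; have := gapS Sx Sc xc; rewrite leNgt => /negP; apply.
    by move: ts sx ct; lra.
  have h2 : `|int_between c t v| <= a + C * (t - c).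
    apply: int_between_open => //; [exact: le_trans s0 (ltW sc)|exact: ltW|].
    move=> x cx xt Sx; have := gapS Sc Sx cx; rewrite leNgt => /negP; apply.
    by move: ts xt sc; lra.
  apply: le_trans (ler_normD _ _) _; apply: le_trans (lerD h1 h2) _.
  by rewrite !mulrBr; move: (C * c) (C * s) (C * t) => i j k; lra.
apply: le_trans (int_between_open s0 st t1 _) _.
  by move=> x sx xt Sx; apply: nc; exists x.
by rewrite lerD2r ler_peMl// ler1n.
Qed.

End removing_cuts.

(** * Piecewise expanding maps *)

Section piecewise_expanding.
Context (R : realType).
Notation l := (@leb_cc01 R).
Notation X := (msub (cc01 R)).
Variables (g : X -> X) (n : nat) (I : 'I_n -> set R) (f f' f'' : 'I_n -> R -> R).
Hypothesis gns : nonsingular l g.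
Hypothesis gI : piecewise_C2 g I f f' f''.
Hypothesis f'_gt1 : forall (i : 'I_n) x, closure ((I i)°) x ->
  f' i x != 0 /\ 1 / `|f' i x| < 1.
Implicit Types (i : 'I_n) (x y s t c : R) (z : X) (u : X -> R).

Let J i := (I i)°.

Let I01 i x : I i x -> 0 <= x <= 1.
Proof.
move=> Ix; have [[IE _ _] _ _] := gI.
have : (cc01 R : set R) x by rewrite -IE; exists i.
by rewrite /= in_itv.
Qed.

Let JI i x : J i x -> I i x. Proof. exact: interior_subset. Qed.

Let IlbP i : has_lbound (I i).
Proof. by exists 0 => x /I01/andP[]. Qed.

Let IubP i : has_ubound (I i).
Proof. by exists 1 => x /I01/andP[]. Qed.

Let JE i : J i = [set r | inf (I i) < r < sup (I i)].
Proof. by have [_ Iint _] := gI; exact: interval_bounded_interior. Qed.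

Let J_convex i x y c : J i x -> J i y -> x <= c -> c <= y -> J i c.
Proof.
rewrite JE /= => /andP[h1 _] /andP[_ h2] xc cy.
by rewrite (lt_le_trans h1 xc) (le_lt_trans cy h2).
Qed.

Let J_disjoint i j x : J i x -> J j x -> i = j.
Proof.
move=> ix jx; have [[_ tI _] _ _] := gI.
by apply: tI => //; exists x; split; exact: JI.
Qed.

(** The cuts of [g]: each is an end of some piece, pieces reduced to one point included. *)
Definition gaps : set R := [set x | 0 <= x <= 1 /\ forall i, ~ J i x].

Let finite_gaps : finite_set gaps.
Proof.
apply: (@sub_finite_set _ _ (\bigcup_(i in setT) ([set inf (I i)] `|` [set sup (I i)]))).
  move=> x [x01 nJ]; have [[IE _ _] _ _] := gI.
  have [i _ Ix] : cover [set: 'I_n] I x by rewrite IE /= in_itv.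
  exists i => //; have := nJ i; rewrite JE /= => /negP.
  rewrite negb_and -!leNgt => /orP[xi|xi]; [left|right]; apply/eqP; rewrite eq_le xi ?andbT/=.
    exact: ge_inf.
  exact: ub_le_sup.
apply: bigcup_finite => //; by move=> i _; rewrite finite_setU; split; exact: finite_set1.
Qed.

(** Connectedness: the interiors of the pieces are open and disjoint, so the trace on [[s, t]] of
    the one containing [s] is open and closed. *)
Let piece_of s t : 0 <= s -> s <= t -> t <= 1 ->
  (forall x, s <= x -> x <= t -> ~ gaps x) ->
  exists i, forall x, s <= x -> x <= t -> J i x.
Proof.
move=> s0 st t1 ng.
have cov x : s <= x -> x <= t -> exists i, J i x.
  move=> sx xt; apply: contrapT => h; apply: (ng x sx xt); split.
    by rewrite (le_trans s0 sx) (le_trans xt t1).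
  by move=> i Jx; apply: h; exists i.
have [i Js] := cov s (lexx s) st; exists i.
pose B := `[s, t]%classic `&` J i.
have : B = `[s, t]%classic.
  apply: (@segment_connected R s t).
  - by exists s; split=> //; rewrite /= in_itv/= lexx.
  - by exists (J i) => //; exact: open_interior.
  - exists (~` \bigcup_(j in [set j | j != i]) J j).
      by apply: open_closedC; apply: bigcup_open => j _; exact: open_interior.
    apply/seteqP; split=> x [xst Jx]; split=> //.
      by move=> [j /= ji Jjx]; move: ji; rewrite (J_disjoint Jjx Jx) eqxx.
    move: (xst); rewrite /= in_itv/= => /andP[sx xt]; have [j Jjx] := cov x sx xt.
    have [<-//|ji] := eqVneq j i.
    by exfalso; apply: Jx; exists j.
move=> /seteqP[_ sub] x sx xt.
by have [] := sub x; rewrite ?/= ?in_itv/= ?sx.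
Qed.

Let K i := closure (J i).

Let JK i x : J i x -> K i x. Proof. exact: subset_closure. Qed.

Let compact_K i : compact (K i).
Proof.
apply: (subclosed_compact _ (@segment_compact R 0 1)); first exact: closed_closure.
have -> : [set` `[0, 1]] = closure (`[0, 1]%classic : set R).
  exact/closure_id/itv_closed.
by apply: closureS => x /JI /I01; rewrite /= in_itv.
Qed.

Let within_K i (h : R -> R) : {within closure (I i), continuous h} -> {within K i, continuous h}.
Proof. by apply: continuous_subspaceW; apply: closureS; exact: interior_subset. Qed.

Let C2 i := (let: And3 _ _ h := gI in h i).

Let bounded_K i (h : R -> R) : {within closure (I i), continuous h} ->
  exists2 M, 0 <= M & forall x, K i x -> `|h x| <= M.
Proof.
move=> hC; have [M [_ hM]] := compact_bounded (continuous_compact (within_K hC) (@compact_K i)).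
exists (`|M| + 1); first by rewrite addr_ge0.
move=> x Kx; apply: hM; last by exists x.
by apply: le_lt_trans (ler_norm _) _; rewrite ltrDl.
Qed.

(** The values of [|f' i|] on the compact [K i] avoid 1, hence a ball around 1; being above 1, they
    are at least [1 + e]. The argument covers an empty [K i] as well. *)
Let contraction_K i : exists2 theta, theta < 1 & forall x, K i x -> `|f' i x|^-1 <= theta.
Proof.
have [[_ f'C _ _ _] _] := C2 i.
pose A : set R := [set `|f' i x| | x in K i].
have cA : compact A.
  rewrite (_ : A = Num.norm @` (f' i @` K i)); last by rewrite image_comp.
  apply: continuous_compact; last exact: continuous_compact (within_K f'C) (@compact_K i).
  exact/continuous_subspaceT/norm_continuous.
have nA : nbhs (1 : R) (~` A).
  apply: open_nbhs_nbhs; split.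
    by apply: closed_openC; apply: compact_closed => //; exact: Rhausdorff.
  move=> [x /f'_gt1 [f0 f1] fx]; move: f1; rewrite fx div1r invr1 ltxx//.
have [e /= e0 he] := nA.
have e10 : 0 < 1 + e by rewrite addr_gt0.
exists (1 + e)^-1; first by rewrite invf_lt1// ltrDl.
move=> x Kx; have [f0 f1] := f'_gt1 Kx; have fp : 0 < `|f' i x| by rewrite normr_gt0.
rewrite lef_pV2 ?posrE//; rewrite div1r invf_lt1// in f1.
rewrite leNgt; apply/negP => fe.
apply: (he `|f' i x|); last by exists x.
by rewrite /ball_/= ltr0_norm ?subr_lt0// opprB ltrBlDl.
Qed.

Let uniform_constants : exists theta L M : R,
  [/\ 0 <= theta < 1, 0 <= L, 0 <= M &
   forall i x, J i x -> [/\ `|f' i x|^-1 <= theta, `|f'' i x| <= L & `|f' i x| <= M]].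
Proof.
have hth i := contraction_K i.
have hL i : exists2 M, 0 <= M & forall x, K i x -> `|f'' i x| <= M.
  by have [[_ _ h _ _] _] := C2 i; exact: bounded_K.
have hM i : exists2 M, 0 <= M & forall x, K i x -> `|f' i x| <= M.
  by have [[_ h _ _ _] _] := C2 i; exact: bounded_K.
pose th i := s2val (cid2 (hth i)).
pose Lc i := s2val (cid2 (hL i)).
pose Mc i := s2val (cid2 (hM i)).
exists (\big[Num.max/0]_i th i), (\big[Num.max/0]_i Lc i), (\big[Num.max/0]_i Mc i).
split.
- rewrite bigmax_ge_id/=; apply: bigmax_lt => // i _; exact: (s2valP (cid2 (hth i))).
- exact: bigmax_ge_id.
- exact: bigmax_ge_id.
move=> i x /JK Kx; split.
- by apply: le_trans (s2valP' (cid2 (hth i)) x Kx) _; exact: le_bigmax.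
- by apply: le_trans (s2valP' (cid2 (hL i)) x Kx) _; exact: le_bigmax.
- by apply: le_trans (s2valP' (cid2 (hM i)) x Kx) _; exact: le_bigmax.
Qed.

Let MVT_J i (h h' : R -> R) x y : (forall x, J i x -> is_derive x 1 h (h' x)) ->
  J i x -> J i y -> x < y -> exists2 c, x <= c <= y & h y - h x = h' c * (y - x).
Proof.
move=> dh Jx Jy xy; have [||c] := @MVT R h h' x y xy.
- by move=> c; rewrite in_itv/= => /andP[xc cy]; apply: dh; apply: (J_convex Jx Jy); exact: ltW.
- apply: derivable_within_continuous => c; rewrite in_itv/= => /andP[xc cy].
  by have [] := dh c (J_convex Jx Jy xc cy).
by rewrite in_itv/= => /andP[xc cy] hc; exists c => //; rewrite !ltW.
Qed.

Let within_J i s t (h h' : R -> R) : (forall x, J i x -> is_derive x 1 h (h' x)) ->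
  (forall x, s <= x -> x <= t -> J i x) -> {within `[s, t], continuous h}.
Proof.
move=> dh st; apply: derivable_within_continuous => c; rewrite in_itv/= => /andP[sc ct].
by have [] := dh c (st c sc ct).
Qed.

(** Between two opposite signs the slope would vanish. That it does not is a separate clause of
    [f'_gt1], since the inverse of 0 is 0 and would satisfy the inequality. *)
Let f'_sign i s t : s <= t -> (forall x, s <= x -> x <= t -> J i x) ->
  (forall x, s <= x -> x <= t -> 0 < f' i x) \/ (forall x, s <= x -> x <= t -> f' i x < 0).
Proof.
move=> st Jst; have [[_ _ _ _ df'] _] := C2 i.
have ne x : s <= x -> x <= t -> f' i x != 0.
  by move=> sx xt; have [] := f'_gt1 (JK (Jst _ sx xt)).
have key x y : s <= x -> x <= y -> y <= t -> ~ (Num.min (f' i x) (f' i y) <= 0 <= Num.max (f' i x) (f' i y)).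
  move=> sx xy yt h; have Jxy c : x <= c -> c <= y -> J i c.
    by move=> h1 h2; apply: Jst; [exact: le_trans h1|exact: le_trans yt].
  have [c] := IVT xy (within_J df' Jxy) h; rewrite in_itv/= => /andP[xc cy] /eqP.
  by apply/negP/ne; [exact: le_trans xc|exact: le_trans yt].
have [p|p|/eqP] := ltgtP (f' i s) 0; last by rewrite (negbTE (ne s (lexx s) st)).
- right => x sx xt; rewrite ltNge; apply/negP => fx0; apply: (key s x (lexx s) sx xt).
  by rewrite ge_min le_max (ltW p) fx0 orbT.
- left => x sx xt; rewrite ltNge; apply/negP => fx0; apply: (key s x (lexx s) sx xt).
  by rewrite ge_min le_max (ltW p) fx0 orbT.
Qed.

Let f_inj i x y : J i x -> J i y -> f i x = f i y -> x = y.
Proof.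
wlog xy : x y / x <= y.
  by move=> h Jx Jy E; have [|/ltW] := leP x y => xy; [|apply/esym]; apply: h.
move=> Jx Jy E; move: xy; rewrite le_eqVlt => /predU1P[//|xy].
have [[_ _ _ df _] _] := C2 i; have [c /andP[xc cy]] := MVT_J df Jx Jy xy.
rewrite E subrr => /esym/eqP; rewrite mulf_eq0 subr_eq0 (gt_eqF xy) orbF.
by have [/negbTE -> _] := f'_gt1 (JK (J_convex Jx Jy xc cy)).
Qed.

(** Induction on [m]: inside one piece, [int_between_branch] applied to [u o g^m] multiplies the
    main term by [theta]; the new cuts are the gaps and the preimages of the old cuts. *)
Let short_on_pieces : exists2 theta, 0 <= theta < 1 & forall m : nat,
  exists S : set R, [/\ finite_set S & exists2 C, 0 <= C & forall u s t,
    test_function u -> 0 <= s -> s <= t -> t <= 1 ->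
    (forall x, s <= x -> x <= t -> ~ S x) ->
    `|int_between s t (u \o iter m g)| <= theta ^+ m + C * (t - s)].
Proof.
have [theta [L [M [/andP[theta0 theta1] L0 M0 consts]]]] := uniform_constants.
have [mg _] := gns.
exists theta; first by rewrite theta0.
elim=> [|m [S [finS [C C0 hC]]]].
  exists set0; split=> //; exists 0 => // u s t [_ u1] s0 st t1 _.
  by rewrite expr0 mul0r addr0; exact: u1.
exists (gaps `|` \bigcup_(i in setT) (J i `&` f i @^-1` S)); split.
  rewrite finite_setU; split=> //; apply: bigcup_finite => // i _.
  (* Pairing the value with membership in [J i] presents the set as a full preimage, on which [F] is
     injective because [f i] is injective on [J i]. *)
  pose F x := (f i x, `[< J i x >]).
  rewrite (_ : _ `&` _ = F @^-1` [set (y, true) | y in S]); last first.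
    apply/seteqP; split=> x; first by move=> [Jx Sx]; exists (f i x) => //; rewrite /F asboolT.
    by move=> [y Sy [yE Jx]]; split; [exact/asboolP|rewrite /preimage /mkset -yE].
  apply: finite_preimage; last exact: finite_image.
  move=> x y; rewrite !inE => -[x' _ [_ Jx]] [y' _ [_ Jy]] [E _].
  by apply: f_inj E; apply/asboolP.
(* The first term comes from the old constant, image intervals being at most [M (t - s)] long; the
   second from the Lipschitz term [L D (t - s)] with [D <= 1 + C M]. *)
exists (theta * C * M + L * (1 + C * M)); first by rewrite addr_ge0 ?mulr_ge0// addr_ge0// mulr_ge0.
move=> u s t tu s0 st t1 nS.
have [i Jst] := piece_of s0 st t1 (fun x sx xt gx => nS x sx xt (or_introl gx)).
have nSf x : s <= x -> x <= t -> ~ S (f i x).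
  by move=> sx xt Sfx; apply: (nS x sx xt); right; exists i => //; split=> //; exact: Jst.
have [[fC _ _ df df'] gf] := C2 i.
have [bu _] := tu.
have bv : bounded_measurable (u \o iter m g) := bounded_measurable_comp (measurable_iter gns m) bu.
have fstC := within_J df Jst.
have MVTst x y : s <= x -> x < y -> y <= t ->
    exists2 c, x <= c <= y & f i y - f i x = f' i c * (y - x).
  move=> sx xy yt; apply: (MVT_J df) => //; apply: Jst => //.
  - exact: le_trans (ltW xy) yt.
  - exact: le_trans (ltW xy).
have f_lip x y : s <= x -> x <= y -> y <= t -> `|f i y - f i x| <= M * (t - s).
  move=> sx; rewrite le_eqVlt => /predU1P[<- xt|xy yt].
    by rewrite subrr normr0 mulr_ge0// subr_ge0.
  have [c /andP[xc cy] ->] := MVTst _ _ sx xy yt.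
  have y0 : 0 <= y - x by rewrite subr_ge0 ltW.
  rewrite normrM (ger0_norm y0); apply: ler_pM => //; last by rewrite lerB.
  by have [_ _] := consts i c (Jst c (le_trans sx xc) (le_trans cy yt)).
have gfst z : s <= (msub_val z : R) <= t -> (msub_val (g z) : R) = f i (msub_val z).
  by move=> /andP[h1 h2]; apply: gf; exact: Jst.
have f01 x : s <= x -> x <= t -> 0 <= f i x <= 1.
  move=> sx xt; have x01 : (cc01 R : set R) x.
    by rewrite /= in_itv/= (le_trans s0 sx) (le_trans xt t1).
  have := gfst (msub_mk x01); rewrite [msub_val _]/= => <-; last by rewrite sx.
  by rewrite cc01_ge0 cc01_le1.
have ts0 : 0 <= t - s by rewrite subr_ge0.
pose D := theta ^+ m + C * (M * (t - s)).
have D0 : 0 <= D by rewrite addr_ge0 ?exprn_ge0// !mulr_ge0.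
have vD x y : s <= x <= t -> s <= y <= t -> f i x <= f i y ->
    `|int_between (f i x) (f i y) (u \o iter m g)| <= D.
  move=> /andP[sx xt] /andP[sy yt] fxy.
  have /andP[fx0 _] := f01 x sx xt; have /andP[_ fy1] := f01 y sy yt.
  have fdist : f i y - f i x <= M * (t - s).
    apply: le_trans (ler_norm _) _; have [xy|/ltW yx] := leP x y; first exact: f_lip.
    by rewrite distrC; exact: f_lip.
  apply: le_trans (hC _ _ _ tu fx0 fxy fy1 _) _; last first.
    by rewrite lerD2l; exact: ler_wpM2l.
  (* A cut between [f i x] and [f i y] would be the image of a point of [[s, t]], by intermediate
     values. *)
  have ivt a b c : s <= a -> a <= b -> b <= t ->
      Num.min (f i a) (f i b) <= c <= Num.max (f i a) (f i b) -> ~ S c.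
    move=> sa ab bt; have abC : {within `[a, b], continuous (f i)}.
      by apply: (within_J df) => x' ax xb; apply: Jst; [exact: le_trans ax|exact: le_trans bt].
    move=> h Sc; have [x'] := IVT ab abC h; rewrite in_itv/= => /andP[ax xb] E.
    by apply: (nSf x'); rewrite ?E//; [exact: le_trans ax|exact: le_trans bt].
  move=> c h1 h2; have [xy|/ltW yx] := leP x y.
    by apply: (ivt x y) => //; rewrite ge_min le_max h1 h2 orbT.
  by apply: (ivt y x) => //; rewrite ge_min le_max h1 h2 orbT.
rewrite (_ : u \o iter m.+1 g = (u \o iter m g) \o g); last first.
  by apply/funext => z; rewrite /= -iterSr.
have f'Lst x y : s <= x -> x <= y -> y <= t -> `|f' i y - f' i x| <= L * (y - x).
  move=> sx; rewrite le_eqVlt => /predU1P[<- xt|xy yt].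
    by rewrite !subrr normr0 mulr0.
  have sy := le_trans sx (ltW xy); have xt := le_trans (ltW xy) yt.
  have [c /andP[xc cy] ->] := MVT_J df' (Jst _ sx xt) (Jst _ sy yt) xy.
  have y0 : 0 <= y - x by rewrite subr_ge0 ltW.
  rewrite normrM (ger0_norm y0) ler_wpM2r//.
  by have [] := consts i c (Jst c (le_trans sx xc) (le_trans cy yt)).
have := @int_between_branch R g (f i) (f' i) s t theta L M mg s0 st t1 L0 (ltW theta1)
  gfst f'Lst MVTst _ _ fstC (f'_sign st Jst) _ D bv D0 vD.
move=> /(_ _ _)/le_trans; apply.
- by move=> x sx xt; have [] := consts i x (Jst x sx xt).
- by move=> x sx xt; have [] := consts i x (Jst x sx xt).
have D1 : D <= 1 + C * M.
  apply: lerD; first by rewrite exprn_ile1// ltW.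
  by rewrite mulrA ler_piMr ?mulr_ge0// lerBlDr; apply: le_trans t1 _; rewrite lerDl.
have LD : L * D * (t - s) <= L * (1 + C * M) * (t - s).
  by rewrite ler_wpM2r// ler_wpM2l.
rewrite mulrDl addrA; apply: lerD => //.
by rewrite /D mulrDr exprS !mulrA.
Qed.

Lemma piecewise_expanding_propC : propC (PF (m := l) g).
Proof.
have [theta /andP[theta0 theta1] hQ] := short_on_pieces.
(* Doubled by one interior cut and increased by a linear term of at most 1/32, the value 1/64 stays
   below the 1/8 asked for by [short_integrals_propC]. *)
have [p hp] : exists p : nat, theta ^+ p.+1 <= 64^-1.
  have : `|theta| < 1 by rewrite ger0_norm.
  move=> /cvg_expr /cvgrPdist_le /(_ 64^-1); rewrite invr_gt0 => /(_ (ltr0n _ 64))[p _ hp].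
  exists p; have := hp p.+1 (leqnSn p); rewrite /= sub0r normrN ger0_norm// exprn_ge0//.
have [S [finS [C C0 hC]]] := hQ p.+1.
have [delta delta0 gapS] := finite_set_gap finS.
have C1 : 0 < C + 1 by rewrite ltr_wpDl.
(* The grid step is shorter than the least gap between cuts, and short enough for the linear term to
   be at most 1/32. *)
have : 0 < Num.min delta (32^-1 / (C + 1)) by rewrite lt_min delta0 divr_gt0// invr_gt0.
move=> /ltr_add_invr[N]; rewrite add0r lt_min => /andP[/ltW N1]; rewrite ltr_pdivlMr// => /ltW N2.
apply: (@short_integrals_propC R g gns p N) => u s t tu s0 st t1 ts.
have [bu _] := tu.
have bv : bounded_measurable (u \o iter p.+1 g).
  exact: (bounded_measurable_comp (measurable_iter gns p.+1) bu).
have vS a b : 0 <= a -> a <= b -> b <= 1 -> (forall x, a <= x -> x <= b -> ~ S x) ->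
    `|int_between a b (u \o iter p.+1 g)| <= theta ^+ p.+1 + C * (b - a).
  by move=> a0 ab b1; exact: hC.
apply: le_trans (int_between_short bv (exprn_ge0 _ theta0) C0 vS gapS s0 st t1 (le_trans ts N1)) _.
have ts0 : 0 <= t - s by rewrite subr_ge0.
have : C * (t - s) <= 32^-1.
  apply: le_trans N2; rewrite mulrC; apply: ler_pM => //; by rewrite lerDl.
by move: hp; move: (_ ^+ _) (C * _) => a b; lra.
Qed.

End piecewise_expanding.

Theorem proposition1p24 (R : realType) :
  (* (1) *)
  (forall (g : msub (cc01 R) -> msub (cc01 R)) (n : nat) (I : 'I_n -> set R)
      (f f' f'' : 'I_n -> R -> R),
    nonsingular (@leb_cc01 R) g ->
    piecewise_C2 g I f f' f'' ->
    (forall (i : 'I_n) (x : R), closure ((I i)°) x ->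
      f' i x != 0 /\ 1 / `|f' i x| < 1) ->
    satisfies (@leb_cc01 R) g propC /\ ~ satisfies (@leb_cc01 R) g propUC) /\
  (* (2) *)
  (satisfies (@leb_cc01 R \x @leb_cc01 R)%E (@baker R) propAC /\
   ~ satisfies (@leb_cc01 R \x @leb_cc01 R)%E (@baker R) propC) /\
  (* (3) *)
  (forall alpha : R, irrational alpha ->
    satisfies (@leb_co01 R) (rotation alpha) propMC /\
    ~ satisfies (@leb_co01 R) (rotation alpha) propAC) /\
  (* (4) *)
  (forall alpha : R, rational alpha ->
    satisfies (@leb_co01 R) (rotation alpha) propWAP /\
    ~ satisfies (@leb_co01 R) (rotation alpha) propMC) /\
  (* (5) *)
  (forall (d : measure_display) (X : measurableType d) (m : probability X R)
      (g : X -> X) (Xm Xp : msubset X)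
      (gXm : g @` Xm `<=` Xm) (gXp : g @` Xp `<=` Xp),
    nonsingular m g ->
    (Xm : set X) `|` Xp = setT -> (Xm : set X) `&` Xp = set0 ->
    (0 < m Xm)%E -> (0 < m Xp)%E ->
    satisfies (normalized_restriction m Xp) (msub_map gXp) propS ->
    ~ satisfies (normalized_restriction m Xm) (msub_map gXm) propS ->
    satisfies m g propS /\ ~ satisfies m g propWAP).
Proof.
split; [|split; [|split; [|split]]].
- move=> g n I f f' f'' gns gI f'_gt1; split.
    by split=> //; exact: (piecewise_expanding_propC gns gI f'_gt1).
  by case=> _; apply: (not_propUC gns); exact: leb_cc01_divisible.
- split; first by split; [exact: nonsingular_baker|exact: baker_propAC].
  by case=> _; exact: baker_not_propC.
- move=> alpha irr; split.
    by split; [exact: nonsingular_rotation|exact: irrational_rotation_propMC].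
  by case=> _; exact: irrational_rotation_not_propAC.
- move=> alpha rat; split.
    by split; [exact: nonsingular_rotation|exact: rational_rotation_propWAP].
  by case=> _; exact: rational_rotation_not_propMC.
- move=> d X m g Xm Xp gXm gXp gns XU XI Xm0 Xp0 [_ Sp] nSm; split.
    by split=> //; exact: (propS_extend gns Xp0 Sp).
  case=> _ wap; apply: nSm; split; first exact: nonsingular_msub_map.
  exact: (WAP_propS_restrict gXm gns XU XI).
Qed.
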